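(* Let $\theta>0$, let $X=\{X_t,t\ge 0\}$ be the Ornstein-Uhlenbeck process solving $X_0=0$, $dX_t=-\theta X_t\,dt+dW_t$, $t\ge 0$, where $W$ is a standard Brownian motion, and let $(\Delta_n)_{n\ge1}$ be a deterministic sequence of positive numbers with $\Delta_n\to0$ and $T:=n\Delta_n\to\infty$ as $n\to\infty$. With $t_i=i\Delta_n$, $i=0,\dots,n$, set $$\widehat{\theta}_n:=-\frac{\sum_{i=1}^{n}X_{t_{i-1}}\left(X_{t_i}-X_{t_{i-1}}\right)}{\Delta_n\sum_{i=1}^{n}X_{t_{i-1}}^2},\qquad G_n:=\frac{1}{\sqrt{T}}\sum_{i=1}^{n}e^{-\theta t_i}X_{t_{i-1}}\left(\zeta_{t_i}-\zeta_{t_{i-1}}\right),\qquad \zeta_t:=\int_0^t e^{\theta s}\,dW_s .$$ Then there exists a constant $C>0$ such that, for all $n\ge1$, $$d_W\left(\frac{\frac{1}{2\theta}\sqrt{T}}{\sqrt{E(G_n^2)}}\left(\widehat{\theta}_n-\theta\right),\mathcal{N}\right)\le C\left(\frac{1}{\sqrt{n\Delta_n}}+\sqrt{n\Delta_n^3}\right).$$ Moreover, $$d_W\left(\sqrt{\frac{T}{2\theta}}\left(\widehat{\theta}_n-\theta\right),\mathcal{N}\right)\le C\left(\frac{1}{\sqrt{n\Delta_n}}+\sqrt{n\Delta_n^3}\right).$$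
   Context: $\mathcal{N}$ denotes a standard normal random variable. For random variables $U,V$ the Wasserstein distance is $d_W(U,V):=\sup_{f\in Lip(1)}|E[f(U)]-E[f(V)]|$, where $Lip(1)$ is the set of all Lipschitz functions $f:\mathbb{R}\to\mathbb{R}$ with Lipschitz constant at most $1$. Explicitly, $X_t=\int_0^t e^{-\theta(t-s)}\,dW_s=e^{-\theta t}\zeta_t$. The number $T=n\Delta_n$ depends on $n$. By convention, $C$ denotes a positive constant which may depend on $\theta$ but on nothing else.
   Formalization: ''For all n≥1'' is false (n=1 gives 0/0; n=2 gives d_W=∞), as is C depending on θ only for all n≥3; proved instead: both bounds for all n≥3 with C possibly depending on the sequence Δ_n, and for all n large enough (depending on the sequence) with C depending only on θ. *)

(* Defs.v *)
(* MathComp and MathComp-Analysis.  Processes are families of random variables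
   indexed by R, of which only the nonnegative times matter. *)
From HB Require Import structures.
From mathcomp Require Import all_boot all_order all_algebra.
From mathcomp Require Import all_classical all_reals all_analysis.

Set Implicit Arguments.
Unset Strict Implicit.
Unset Printing Implicit Defensive.

Import Order.TTheory GRing.Theory Num.Theory.
Import numFieldNormedType.Exports.

Local Open Scope classical_set_scope.
Local Open Scope ring_scope.

(* No subfamilies are needed: taking some B i := setT gives the product rule for
   the others. *)
Definition mutually_independent (R : realType) (d : measure_display)
    (Omega : measurableType d) (P : probability Omega R)
    (n : nat) (Y : 'I_n -> Omega -> R) : Prop :=
  forall B : 'I_n -> set R, (forall i, measurable (B i)) ->
    P (\bigcap_(i in [set: 'I_n]) (Y i @^-1` B i)) =
    (\prod_(i < n) P (Y i @^-1` B i))%E.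

Definition increment (R : realType) (d : measure_display)
    (Omega : measurableType d) (P : probability Omega R)
    (W : R -> {RV P >-> R}) (s t : R) (w : Omega) : R := W t w - W s w.

(* normal_prob takes the standard deviation as second parameter. *)
Definition brownian_motion (R : realType) (d : measure_display)
    (Omega : measurableType d) (P : probability Omega R)
    (W : R -> {RV P >-> R}) : Prop :=
  [/\ {ae P, forall w, W 0 w = 0},
      (forall (t : nat -> R) (m : nat), 0 <= t 0%N ->
         {homo t : i j / (i <= j)%N >-> i <= j} ->
         mutually_independent P
           (fun i : 'I_m => increment W (t i) (t i.+1))),
      (forall s t : R, 0 <= s -> s < t ->
         forall A : set R, measurable A ->
         P (increment W s t @^-1` A) =
         normal_prob 0 (Num.sqrt (t - s)) A)
    & {ae P, forall w, {within `[0, +oo[, continuous (fun t : R => W t w)}}].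

Definition OU_process (R : realType) (d : measure_display)
    (Omega : measurableType d) (P : probability Omega R) (theta : R)
    (W X : R -> {RV P >-> R}) : Prop :=
  {ae P, forall w,
    [/\ {within `[0, +oo[, continuous (fun t : R => X t w)},
        X 0 w = 0
      & forall t : R, 0 <= t ->
          X t w - X 0 w =
          - theta * (\int[lebesgue_measure]_(s in `[0, t]) X s w)
          + (W t w - W 0 w)]}.

(* The step function with value step_val i on ]step_knot i, step_knot i.+1],
   for i < step_size. *)
Record step_function (R : realType) := StepFunction {
  step_size : nat;
  step_knot : nat -> R;
  step_val : nat -> R }.

Definition step_partition (R : realType) (t : R) (phi : step_function R)
    : Prop :=
  [/\ step_knot phi 0 = 0, step_knot phi (step_size phi) = t
    & forall i, (i < step_size phi)%N ->
        step_knot phi i <= step_knot phi i.+1].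

Definition step_eval (R : realType) (phi : step_function R) (x : R) : R :=
  \sum_(i < step_size phi)
    step_val phi i * \1_(`]step_knot phi i, step_knot phi i.+1]) x.

Definition step_integral (R : realType) (d : measure_display)
    (Omega : measurableType d) (P : probability Omega R)
    (W : R -> {RV P >-> R}) (phi : step_function R) (w : Omega) : R :=
  \sum_(i < step_size phi)
    step_val phi i * increment W (step_knot phi i) (step_knot phi i.+1) w.

(* Z is (a version of) the Wiener integral of f over [0, t] with respect to W:
   f is in L^2([0, t]) and Z is the L^2(P)-limit of the integrals of step
   functions tending to f in L^2([0, t]).  When W is a Brownian motion such step
   functions exist and, by the Ito isometry, the limit does not depend on their
   choice. *)
Definition wiener_integral (R : realType) (d : measure_display)
    (Omega : measurableType d) (P : probability Omega R)
    (W : R -> {RV P >-> R}) (f : R -> R) (t : R) (Z : {RV P >-> R}) : Prop :=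
  [/\ measurable_fun `[0, t] f,
      (\int[lebesgue_measure]_(x in `[0%R, t]) ((f x) ^+ 2)%:E < +oo)%E
    & forall phi : nat -> step_function R,
        (forall k, step_partition t (phi k)) ->
        (\int[lebesgue_measure]_(x in `[0%R, t])
           ((step_eval (phi k) x - f x) ^+ 2)%:E)%E @[k --> \oo] --> 0%E ->
        ('E_P[fun w => ((step_integral W (phi k) w - Z w) ^+ 2)%R])%E
          @[k --> \oo] --> 0%E].

(* Extended-real valued.  If E[f(U)] is infinite or undefined for some
   1-Lipschitz f, then truncating f already makes the supremum +oo, so the value
   given by the library to an undefined expectation plays no role. *)
Definition wasserstein (R : realType)
    (d : measure_display) (Omega : measurableType d) (P : probability Omega R)
    (d' : measure_display) (Omega' : measurableType d')
    (Q : probability Omega' R) (U : Omega -> R) (V : Omega' -> R) : \bar R :=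
  ereal_sup [set (`| 'E_P[f \o U] - 'E_Q[f \o V] |)%E
            | f in [set f : R -> R | (1 : R).-lipschitz f]].

Section estimator.
Context (R : realType) (d : measure_display) (Omega : measurableType d).
Variables (P : probability Omega R) (theta : R) (Delta : nat -> R).
Variables X zeta : R -> {RV P >-> R}.

Definition horizon (n : nat) : R := n%:R * Delta n.

Definition grid (n i : nat) : R := i%:R * Delta n.

(* In both sums below the index is shifted by one: i runs from 0 to n - 1. *)
Definition theta_hat (n : nat) (w : Omega) : R :=
  - ((\sum_(i < n) X (grid n i) w * increment X (grid n i) (grid n i.+1) w) /
     (Delta n * \sum_(i < n) X (grid n i) w ^+ 2)).

Definition G_stat (n : nat) (w : Omega) : R :=
  (Num.sqrt (horizon n))^-1 *
  \sum_(i < n) expR (- theta * grid n i.+1) * X (grid n i) w *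
               increment zeta (grid n i) (grid n i.+1) w.

Definition rate (n : nat) : R :=
  (Num.sqrt (n%:R * Delta n))^-1 + Num.sqrt (n%:R * Delta n ^+ 3).
End estimator.

(* Meaningful for n >= 3 only.  Since X 0 = 0, theta_hat is 0 / 0 and E[G^2] = 0
   when n = 1.  When n = 2, with h := Delta 2,
     theta_hat = - (X_(2h) - X_h) / (h * X_h)
   is an affine function of a ratio of two independent centered Gaussians, i.e.
   a (shifted and scaled) Cauchy variable: it is not integrable and both
   distances are +oo. *)
Definition wasserstein_bounds (R : realType)
    (d : measure_display) (Omega : measurableType d) (P : probability Omega R)
    (d' : measure_display) (Omega' : measurableType d')
    (Q : probability Omega' R) (N : Omega' -> R)
    (theta : R) (Delta : nat -> R) (X zeta : R -> {RV P >-> R})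
    (C : R) (n : nat) : Prop :=
  let T := horizon Delta n in
  let error w := theta_hat Delta X n w - theta in
  let EG2 := fine ('E_P[fun w => (G_stat theta Delta X zeta n w ^+ 2)%R])%E in
  (wasserstein P Q
     (fun w => ((2 * theta)^-1 * Num.sqrt T) / Num.sqrt EG2 * error w)%R N
   <= (C * rate Delta n)%:E)%E /\
  (wasserstein P Q (fun w => Num.sqrt (T / (2 * theta)) * error w)%R N
   <= (C * rate Delta n)%:E)%E.

(* Main.v *)
Require Import Defs.
From HB Require Import structures.
From mathcomp Require Import all_boot all_order all_algebra.
From mathcomp Require Import all_classical all_reals all_analysis.
From mathcomp Require Import ring lra measurable_realfun.

Set Implicit Arguments.
Unset Strict Implicit.
Unset Printing Implicit Defensive.

Import Order.TTheory GRing.Theory Num.Theory.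
Import numFieldNormedType.Exports.

Local Open Scope classical_set_scope.
Local Open Scope ring_scope.

(** Along the grid, X is the autoregression X_(i+1) = a X_i + e_i with
a = exp(-theta Delta_n) and i.i.d. centered Gaussian noise e. With
M = sum X_i e_i and S = sum X_i^2, the error of the estimator is the bias
(1 - a) / Delta_n - theta, of order Delta_n, minus M / (Delta_n S), while G_n
is M / sqrt T almost surely.

Stein's method gives the normal approximation of M: Gaussian integration by
parts in each coordinate yields E[M f(M)] = Var(e) E[(S + R) f'(M)], where R is
a martingale transform of lower order, and S / n concentrates around
1 / (2 theta) by the energy identity of the recursion. Replacing the random
denominator S / n by its mean costs E[|M| |S/n - 1/(2 theta)| / (S/n)], which
needs a bound on E[(S/n)^-4] uniform in n. It comes from averaging, over
starting points i, products of 16 values |X_(i + k L)|^(-1/2) at distances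
L Delta_n of order 1: each new value has, conditionally on the past, a Gaussian
law of variance bounded below, so these products are peeled off one factor at a
time. *)

(** The law of the noise is carried to the space of real sequences, where independence and normality
    are used only through [resampling]: coordinate [i] can be redrawn without changing the law, so
    each computation is a one-dimensional Gaussian integral with the other coordinates frozen.

    With [g = - kappa M], the normalized error [U] satisfies [d_W(U, N) <= d_W(g, N) + E|U - g|].
    The denominator enters only the second part. Since [(S/n - c)^2] has mean of order [1/T],
    splitting [|g| |S/n - c| (S/n)^-1] at the rate [1/sqrt T] leaves fourth moments of [g] and of
    [(S/n)^-1]: hence the exponent -4.

    The obstacle is that [1/|X|] has infinite Gaussian mean. The arithmetic-geometric inequality
    over [k] values turns [(S/n)^-4] into a product of powers [|X|^(-8/k)], integrable for [k > 8];
    [k = 16] gives the exponent -1/2, whose mean is bounded uniformly in the center of the Gaussian.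

    The constant depending on [theta] alone requires [Delta n] small and [T] large. For the other
    [n >= 3] only finiteness is proved, by a separate argument, since for [n = 3] the sum [S] has
    just two terms that are not identically zero. *)

Notation integ mu f := (mu.-integrable setT (EFin \o f)).

(** * Calculus of real-valued expectations *)

Section real_expectations.
Context d (T : measurableType d) (R : realType).
Variable mu : {measure set T -> \bar R}.
Implicit Types f g : T -> R.

Lemma integ_meas f : integ mu f -> measurable_fun setT f.
Proof. by case/integrableP => /measurable_EFinP. Qed.

Lemma integ_le f g : measurable_fun setT f -> integ mu g ->
  (forall x, `|f x| <= g x) -> integ mu f.
Proof.
move=> mf ig fg; apply: (le_integrable measurableT _ _ ig).
  exact/measurable_EFinP.
move=> x _ /=; rewrite lee_fin (le_trans (fg x))//.
exact: ler_norm.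
Qed.

Lemma integD f g : integ mu f -> integ mu g -> integ mu (fun x => f x + g x).
Proof. by move=> ig jg; exact: (integrableD measurableT ig jg). Qed.

Lemma integB f g : integ mu f -> integ mu g -> integ mu (fun x => f x - g x).
Proof. by move=> ig jg; exact: (integrableB measurableT ig jg). Qed.

Lemma integZ (k : R) f : integ mu f -> integ mu (fun x => k * f x).
Proof. by move=> ig; exact: (integrableZl measurableT k ig). Qed.

Lemma integ_norm f : integ mu f -> integ mu (fun x => `|f x|).
Proof. by move=> ig; exact: (integrable_norm ig). Qed.

Lemma integ_sum (n : nat) (F : 'I_n -> T -> R) :
  (forall i, integ mu (F i)) -> integ mu (fun x => \sum_(i < n) F i x).
Proof.
move=> iF; rewrite (_ : EFin \o _ = fun x => \sum_(i < n) (F i x)%:E)%E.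
  by apply: integrable_sum => //= i _; exact: iF.
by apply/funext => x; rewrite /= sumEFin.
Qed.

Lemma EZ (k : R) f : integ mu f -> \int[mu]_x (k * f x) = k * \int[mu]_x f x.
Proof. by move=> ?; rewrite RintegralZl. Qed.

Lemma ED f g : integ mu f -> integ mu g ->
  \int[mu]_x (f x + g x) = \int[mu]_x f x + \int[mu]_x g x.
Proof. by move=> ? ?; rewrite RintegralD. Qed.

Lemma EB f g : integ mu f -> integ mu g ->
  \int[mu]_x (f x - g x) = \int[mu]_x f x - \int[mu]_x g x.
Proof. by move=> ? ?; rewrite RintegralB. Qed.

Lemma E_le f g : integ mu f -> integ mu g -> (forall x, f x <= g x) ->
  \int[mu]_x f x <= \int[mu]_x g x.
Proof. by move=> ? ? fg; apply: le_Rintegral. Qed.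

Lemma E_sum (n : nat) (F : 'I_n -> T -> R) : (forall i, integ mu (F i)) ->
  \int[mu]_x (\sum_(i < n) F i x) = \sum_(i < n) \int[mu]_x F i x.
Proof.
elim: n F => [|n ih] F iF.
  under eq_Rintegral do rewrite big_ord0.
  by rewrite big_ord0 /Rintegral integral0.
under eq_Rintegral do rewrite big_ord_recl.
rewrite RintegralD//; last exact: integ_sum.
by rewrite big_ord_recl ih.
Qed.

Lemma E_norm f : integ mu f -> `|\int[mu]_x f x| <= \int[mu]_x `|f x|.
Proof. by move=> ?; exact: le_normr_Rintegral. Qed.

Lemma E_fine f : integ mu f -> (\int[mu]_x (f x)%:E = (\int[mu]_x f x)%:E)%E.
Proof. by move=> fi; rewrite /Rintegral fineK//; exact: integrable_fin_num. Qed.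

Lemma E_ae f g : measurable_fun setT f -> measurable_fun setT g ->
  {ae mu, forall x, f x = g x} -> \int[mu]_x f x = \int[mu]_x g x.
Proof.
move=> mf mg fg; congr fine; apply: ae_eq_integral => //.
- exact/measurable_EFinP.
- exact/measurable_EFinP.
by apply: filterS fg => x /= ->.
Qed.

Lemma integ_ae f g : measurable_fun setT f ->
  {ae mu, forall x, f x = g x} -> integ mu g -> integ mu f.
Proof.
move=> mf fg /integrableP[mg ig]; apply/integrableP; split.
  exact/measurable_EFinP.
rewrite (_ : (\int[mu]_x _)%E = (\int[mu]_x `|(EFin \o g) x|)%E)//.
apply: ae_eq_integral => //.
- by apply: measurableT_comp => //; exact/measurable_EFinP.
- exact: measurableT_comp.
by apply: filterS fg => x /= ->.
Qed.

Lemma integ_fin f (C : R) : measurable_fun setT f ->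
  (\int[mu]_x `|f x|%:E <= C%:E)%E -> integ mu f.
Proof.
move=> mf fC; apply/integrableP; split; first exact/measurable_EFinP.
by apply: le_lt_trans fC _; exact: ltry.
Qed.

End real_expectations.

(** * Expectations under a probability measure, bounded convergence *)

Section prob_expectations.
Context d (T : measurableType d) (R : realType).
Variable P : probability T R.
Implicit Types f g : T -> R.

Lemma integ_cst (k : R) : integ P (cst k).
Proof.
by apply: finite_measure_integrable_cst.
Qed.

Lemma E_cst (k : R) : \int[P]_x k = k.
Proof. by rewrite Rintegral_cst//= probability_setT mulr1. Qed.

Lemma integ_bounded f (k : R) : measurable_fun setT f ->
  (forall x, `|f x| <= k) -> integ P f.
Proof. by move=> mf fk; apply: (integ_le mf (integ_cst k)). Qed.

Lemma E_bounded_cvg (f_ : nat -> T -> R) f (k : R) :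
  (forall n, measurable_fun setT (f_ n)) -> measurable_fun setT f ->
  {ae P, forall x, f_ ^~ x n @[n --> \oo] --> f x} ->
  (forall n x, `|f_ n x| <= k) ->
  (\int[P]_x f_ n x) @[n --> \oo] --> \int[P]_x f x.
Proof.
move=> mf_ mf cf bf.
have ae_fg : {ae P, forall x n, [set: T] x ->
    (`|(EFin \o f_ n) x| <= (cst k%:E) x)%E}.
  by apply: aeW => x n _ /=; rewrite lee_fin.
have ae_f : {ae P, forall x, [set: T] x ->
    (fun n => EFin (f_ n x)) n @[n --> \oo] --> (f x)%:E}.
  by apply: filterS cf => x fx _; apply: cvg_EFin fx; exact: nearW.
have [fi _ H] := @dominated_convergence _ T R P setT measurableT
  (fun n => EFin \o f_ n) (EFin \o f) (cst k%:E)
  (fun n => (measurable_EFinP _ _).2 (mf_ n))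
  ((measurable_EFinP _ _).2 mf) ae_f (integ_cst k) ae_fg.
apply: fine_cvg; rewrite -/(Rintegral P setT f).
by rewrite /= in H; rewrite fineK//; exact: integrable_fin_num.
Qed.

End prob_expectations.

(** * Gaussian measures: density, exponential moments, integration by parts *)

Section gaussian.
Context (R : realType).
Notation leb := (@lebesgue_measure R).
Notation gamma s := (@normal_prob R 0 s).
Notation pdf s := (@normal_pdf R 0 s).

Lemma integrable_normal_prob (s : R) (f : R -> R) : integ (gamma s) f ->
  (\int[gamma s]_x (f x)%:E = \int[leb]_x (f x * pdf s x)%:E)%E.
Proof.
move=> fi.
rewrite -(Radon_Nikodym_change_of_variables (normal_prob_dominates 0 s))//=.
have mf := integ_meas fi.
apply: ae_eq_integral => //.
- apply: emeasurable_funM; first exact/measurable_EFinP.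
  apply: (measurable_int leb).
  by apply: Radon_Nikodym_integrable; exact: normal_prob_dominates.
- apply/measurable_EFinP/measurable_funM => //; exact: measurable_normal_pdf.
under [X in ae_eq _ _ _ X]eq_fun do rewrite EFinM.
apply: ae_eqe_mul2l => /=.
rewrite Radon_NikodymE//=; first exact: normal_prob_dominates.
move=> abmu.
case: cid => /= h [h1 h2 h3].
apply: integral_ae_eq => //=.
- by apply/measurable_EFinP; exact: measurable_normal_pdf.
- by move=> E E01 mE; rewrite -h3.
Qed.

(** Truncation at level [n] reduces to bounded functions, covered by the integrable case; monotone
    convergence on both sides removes the truncation. *)
Lemma ge0_integral_normal_prob (s : R) (f : R -> R) : measurable_fun setT f ->
  (forall x, 0 <= f x) ->
  (\int[gamma s]_x (f x)%:E = \int[leb]_x (f x * pdf s x)%:E)%E.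
Proof.
move=> mf f0.
pose fn n x := Num.min (f x) n%:R.
have mfn n : measurable_fun setT (fn n) by apply: measurable_minr.
have fn0 n x : 0 <= fn n x by rewrite /fn le_min f0 ler0n.
have ndfn x : {homo fn^~ x : n m / (n <= m)%N >-> n <= m}.
  by move=> n m nm; rewrite /fn le_min ge_min lexx/= ge_min ler_nat nm orbT.
have fnf x : \forall n \near \oo, fn n x = f x.
  near=> n; rewrite /fn min_l//.
  near: n; exact: nbhs_infty_ger.
have cvg_fn x : (fn n x)%:E @[n --> \oo] --> (f x)%:E.
  by apply: cvg_near_cst; near do rewrite (_ : fn _ _ = f x)//; exact: fnf.
have cvg_fnp x : (fn n x * pdf s x)%:E @[n --> \oo] --> (f x * pdf s x)%:E.
  apply: cvg_near_cst; have := fnf x; apply: filterS => n -> //.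
have bnd n : integ (gamma s) (fn n).
  apply: (@integ_bounded _ _ _ _ _ n%:R); first exact: mfn.
  move=> x.
  by rewrite ger0_norm ?fn0// ge_min lexx orbT.
have L : (\int[gamma s]_x (fn n x)%:E @[n --> \oo] --> \int[gamma s]_x (f x)%:E)%E.
  rewrite (_ : (\int[gamma s]_x (f x)%:E)%E =
      (\int[gamma s]_x (limn (fun n => (fn n x)%:E)))%E); last first.
    by apply: eq_integral => x _; apply/esym/cvg_lim => //; exact: cvg_fn.
  apply: cvg_monotone_convergence => //.
  - by move=> n; apply/measurable_EFinP; exact: mfn.
  - by move=> n x _; rewrite lee_fin.
  - by move=> x _ n m nm; rewrite lee_fin; exact: ndfn.
have L2 : (\int[leb]_x (fn n x * pdf s x)%:E @[n --> \oo] -->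
    \int[leb]_x (f x * pdf s x)%:E)%E.
  rewrite (_ : (\int[leb]_x (f x * pdf s x)%:E)%E =
      (\int[leb]_x (limn (fun n => (fn n x * pdf s x)%:E)))%E); last first.
    by apply: eq_integral => x _; apply/esym/cvg_lim => //; exact: cvg_fnp.
  apply: cvg_monotone_convergence => //.
  - move=> n; apply/measurable_EFinP; apply: measurable_funM; first exact: mfn.
    exact: measurable_normal_pdf.
  - by move=> n x _; rewrite lee_fin mulr_ge0 ?normal_pdf_ge0.
  - move=> x _ n m nm; rewrite lee_fin ler_wpM2r ?normal_pdf_ge0//.
    exact: ndfn.
apply: cvg_unique L _ => //.
rewrite (_ : (fun n => _) = fun n => (\int[leb]_x (fn n x * pdf s x)%:E)%E)//.
by apply/funext => n; exact: integrable_normal_prob.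
Unshelve. all: end_near. Qed.

Lemma integ_normal_probP (s : R) (f : R -> R) : measurable_fun setT f ->
  integ leb (fun x => f x * pdf s x) -> integ (gamma s) f.
Proof.
move=> mf /integrableP[_ fi]; apply/integrableP; split; first exact/measurable_EFinP.
have -> : (\int[gamma s]_x `|(EFin \o f) x|)%E =
    (\int[gamma s]_x (`|f x|)%:E)%E by [].
rewrite ge0_integral_normal_prob//; last exact: measurableT_comp.
apply: le_lt_trans fi; rewrite le_eqVlt; apply/orP; left; apply/eqP.
apply: eq_integral => x _ /=.
by rewrite normrM (ger0_norm (normal_pdf_ge0 _ _ _)).
Qed.

Lemma integ_normal_pdf (s : R) (f : R -> R) : integ (gamma s) f ->
  integ leb (fun x => f x * pdf s x).
Proof.
move=> fi; have mf := integ_meas fi.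
apply/integrableP; split.
  by apply/measurable_EFinP/measurable_funM => //; exact: measurable_normal_pdf.
have /integrableP[_] := fi.
have -> : (\int[gamma s]_x `|(EFin \o f) x|)%E =
    (\int[gamma s]_x (`|f x|)%:E)%E by [].
rewrite ge0_integral_normal_prob//; last exact: measurableT_comp.
apply: le_lt_trans; rewrite le_eqVlt; apply/orP; left; apply/eqP.
apply: eq_integral => x _ /=.
by rewrite normrM (ger0_norm (normal_pdf_ge0 _ _ _)).
Qed.

Lemma E_normal_prob (s : R) (f : R -> R) : integ (gamma s) f ->
  \int[gamma s]_x f x = \int[leb]_x (f x * pdf s x).
Proof. by move=> fi; rewrite /Rintegral integrable_normal_prob. Qed.

(** Half of the Gaussian exponent absorbs the linear term, because [(c s - |x| / (2 s))^2 >= 0]. The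
    other half is, up to a constant, the density with standard deviation [sqrt 2 * s]. *)
Lemma expR_mul_normal_pdf (s c x : R) : s != 0 ->
  expR (c * `|x|) * pdf s x <=
  (normal_peak s * expR (c ^+ 2 * s ^+ 2)) * expR (- (x ^+ 2 / (4 * s ^+ 2))).
Proof.
move=> s0; rewrite normal_pdfE// /normal_fun.
rewrite mulrCA -[leRHS]mulrA ler_wpM2l ?normal_peak_ge0// -!expRD ler_expR.
have s2 : 0 < s ^+ 2 by rewrite exprn_even_gt0.
rewrite subr0 -[X in X * `|x| + _]mulr1.
have -> : x ^+ 2 = `|x| ^+ 2 by rewrite real_normK ?num_real.
set y := `|x|.
have : 0 <= (c * s - y / (2 * s)) ^+ 2 by exact: sqr_ge0.
have -> : (c * s - y / (2 * s)) ^+ 2 =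
  c ^+ 2 * s ^+ 2 - c * y + y ^+ 2 / (4 * s ^+ 2) by field.
have -> : - y ^+ 2 / (s ^+ 2 *+ 2) = - 2 * (y ^+ 2 / (4 * s ^+ 2)).
  by rewrite -mulr_natr; field.
lra.
Qed.

Lemma integ_gauss_expR (s c : R) : s != 0 ->
  integ (gamma s) (fun x => expR (c * `|x|)).
Proof.
move=> s0.
have mexp : measurable_fun setT (fun x : R => expR (c * `|x|)).
  by apply: measurableT_comp => //; apply: measurable_funM => //; exact: measurableT_comp.
apply: integ_normal_probP => //.
have s2 : Num.sqrt 2 * s != 0 by rewrite mulf_neq0// gt_eqF// sqrtr_gt0.
pose K := (normal_peak s * expR (c ^+ 2 * s ^+ 2)) / normal_peak (Num.sqrt 2 * s).
have B x : `|expR (c * `|x|) * pdf s x| <= K * pdf (Num.sqrt 2 * s) x; last first.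
  apply: integ_le; last exact: B.
    by apply: measurable_funM => //; exact: measurable_normal_pdf.
  by apply: integZ; exact: integrable_normal_pdf.
rewrite ger0_norm ?mulr_ge0 ?expR_ge0 ?normal_pdf_ge0//.
apply: le_trans (expR_mul_normal_pdf c x s0) _.
rewrite normal_pdfE//.
set q := normal_peak (_ * s).
have q0 : q != 0 by rewrite gt_eqF// normal_peak_gt0.
have -> : K * (q * normal_fun 0 (Num.sqrt 2 * s) x) =
    normal_peak s * expR (c ^+ 2 * s ^+ 2) * normal_fun 0 (Num.sqrt 2 * s) x.
  by rewrite /K -/q; field.
rewrite ler_wpM2l//; first by rewrite mulr_ge0 ?expR_ge0 ?normal_peak_ge0.
rewrite /normal_fun ler_expR subr0 exprMn sqr_sqrtr//.
rewrite le_eqVlt; apply/orP; left; apply/eqP.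
rewrite -[in RHS]mulr_natr; field.
exact: s0.
Qed.

Lemma integ_gauss_growth (s c C : R) (f : R -> R) : s != 0 ->
  measurable_fun setT f ->
  (forall x, `|f x| <= C * expR (c * `|x|)) -> integ (gamma s) f.
Proof.
move=> s0 mf fC.
by apply: integ_le; [exact: mf| |exact: fC]; apply: integZ; exact: integ_gauss_expR.
Qed.

Lemma is_derive_normal_pdf (s x : R) : s != 0 ->
  is_derive x 1 (pdf s) (- (x / s ^+ 2) * pdf s x).
Proof.
move=> s0.
rewrite normal_pdfE//.
have -> : normal_fun 0 s = fun y : R => expR (- (s ^+ 2 *+ 2)^-1 * (y * y)).
  by apply/funext => y; rewrite /normal_fun subr0 expr2 mulrC mulrN mulNr.
apply: is_derive_eq.
rewrite /GRing.scale/=; set e := expR _.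
by rewrite -[s ^+ 2 *+ 2]mulr_natr; field.
Qed.

Lemma integral_cvg_restrict (h : R -> R) (D_ : nat -> set R) (D : set R) :
  integ leb h -> (forall n, measurable (D_ n)) -> measurable D ->
  (forall x, \forall n \near \oo, (x \in D_ n) = (x \in D)) ->
  (\int[leb]_(x in D_ n) h x) @[n --> \oo] --> \int[leb]_(x in D) h x.
Proof.
move=> ih mD_ mD DD; have mh := integ_meas ih.
have mr E : measurable E -> measurable_fun setT (EFin \o (h \_ E)).
  move=> mE; apply/measurable_EFinP; apply/(measurable_restrictT _ mE).
  exact: measurable_funTS.
have H1 n : measurable_fun setT (EFin \o (h \_ (D_ n))) by exact: mr.
have H2 : {ae leb, forall x, [set: R] x ->
    (EFin \o (h \_ (D_ n))) x @[n --> \oo] --> (EFin \o (h \_ D)) x}.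
  apply: aeW => x _; apply: cvg_near_cst; near=> n => /=.
  rewrite !patchE; congr (EFin (if _ then _ else _)).
  by near: n; exact: DD.
have H3 : {ae leb, forall x n, [set: R] x ->
    (`|(EFin \o (h \_ (D_ n))) x| <= (fun x => (`|h x|)%:E) x)%E}.
  apply: aeW => x n _ /=; rewrite lee_fin patchE.
  by case: ifP => // _; rewrite normr0.
have [ihD _ H] := @dominated_convergence _ _ R leb setT measurableT _ _ _
  H1 (mr _ mD) H2 (integ_norm ih) H3.
rewrite Rintegral_mkcond; apply: fine_cvg.
rewrite fineK; last exact: integrable_fin_num.
rewrite /= in H.
rewrite (_ : (fun n => _) = fun n => (\int[leb]_x (EFin \o (h \_ (D_ n))) x)%E)//.
apply/funext => n; rewrite integral_mkcond.
by apply: eq_integral => x _; rewrite restrict_EFin.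
Unshelve. all: end_near. Qed.

Lemma integral_cvg_full (h : R -> R) : integ leb h ->
  (\int[leb]_(x in `[- n.+1%:R, n.+1%:R]) h x) @[n --> \oo] --> \int[leb]_x h x.
Proof.
move=> ih; apply: (@integral_cvg_restrict h (fun n => `[- n.+1%:R, n.+1%:R]%classic)) => //.
move=> x; near=> n; rewrite [RHS]mem_set//; apply/mem_set => /=.
rewrite in_itv/= -ler_norml.
apply: le_trans (_ : n%:R <= _); last by rewrite ler_nat.
near: n; exact: nbhs_infty_ger.
Unshelve. all: end_near. Qed.

(** These are the boundary terms of integration by parts on growing segments. Bounding the remaining
    Gaussian factor by means of [e^y >= 1 + y] already gives decay in [1 / n]. *)
Lemma exp_gauss_cvg0 (s C : R) (H : R -> R) : s != 0 ->
  (forall x, `|H x| <= C * (expR (`|x|) * pdf s x)) ->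
  H (n.+1%:R) - H (- n.+1%:R) @[n --> \oo] --> (0 : R).
Proof.
move=> s0 HC.
have s2 : 0 < s ^+ 2 by rewrite exprn_even_gt0.
pose K := `|C| * (normal_peak s * expR (1 ^+ 2 * s ^+ 2)) * (4 * s ^+ 2).
have K0 : 0 <= K.
  apply: mulr_ge0; last by rewrite mulr_ge0// ltW.
  by rewrite mulr_ge0// mulr_ge0 ?normal_peak_ge0 ?expR_ge0.
have B (x : R) (n : nat) : `|x| = n.+1%:R -> `|H x| <= K * n.+1%:R^-1.
  move=> xn.
  apply: le_trans (HC x) _.
  apply: (@le_trans _ _ (`|C| * (expR `|x| * pdf s x))).
    by rewrite ler_wpM2r ?ler_norm// mulr_ge0 ?expR_ge0 ?normal_pdf_ge0.
  rewrite /K -!(mulrA `|C|) ler_wpM2l//.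
  have := expR_mul_normal_pdf 1 x s0; rewrite mul1r => /le_trans; apply.
  rewrite -(mulrA (normal_peak s * _)) ler_wpM2l//.
    by rewrite mulr_ge0 ?expR_ge0 ?normal_peak_ge0.
  have -> : x ^+ 2 = n.+1%:R ^+ 2 by rewrite -xn real_normK ?num_real.
  have n0 : 0 < 4 * s ^+ 2 / n.+1%:R :> R.
    by apply: divr_gt0; rewrite ?ltr0n// mulr_gt0.
  rewrite expRN -[leRHS]invrK lef_pV2 ?posrE ?expR_gt0 ?invr_gt0//.
  rewrite invf_div.
  apply: le_trans (expR_ge1Dx _).
  apply: (@le_trans _ _ (n.+1%:R ^+ 2 / (4 * s ^+ 2))); last by rewrite lerDr.
  rewrite ler_wpM2r//; first by rewrite invr_ge0 mulr_ge0// ltW.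
  by rewrite expr2 ler_peMr// ler1n.
apply/norm_cvg0P.
apply: (@squeeze_cvgr _ _ _ _ (cst 0) (fun n => (2 * K) * n.+1%:R^-1)).
- near=> n; rewrite normr_ge0/=.
  apply: le_trans (ler_normB _ _) _.
  rewrite [leRHS](_ : _ = K * n.+1%:R^-1 + K * n.+1%:R^-1); last by ring.
  by apply: lerD; apply: B; rewrite ?normrN normr_nat.
- exact: cvg_cst.
- rewrite -[X in _ --> X](mulr0 (2 * K)).
  apply: cvgMr; exact: cvg_harmonic.
Unshelve. all: end_near. Qed.

(** The two-sided version applied to [H] cut off to 0 on the negative half-line. *)
Lemma exp_gauss_cvg0p (s C : R) (H : R -> R) : s != 0 ->
  (forall x, `|H x| <= C * (expR (`|x|) * pdf s x)) ->
  H (n.+1%:R) @[n --> \oo] --> (0 : R).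
Proof.
move=> s0 HC; pose G x := if 0 < x then H x else 0.
have C0 x : 0 <= C * (expR (`|x|) * pdf s x) by exact: le_trans (HC x).
have /(exp_gauss_cvg0 s0) : forall x, `|G x| <= C * (expR (`|x|) * pdf s x).
  by move=> x; rewrite /G; case: ifPn => // _; rewrite normr0.
rewrite (_ : (fun n => _ - _) = fun n => H n.+1%:R)//.
apply/funext => n; rewrite /G ltr0n/= (_ : _ < - _ = false) ?subr0//.
by apply/negbTE; rewrite -leNgt oppr_le0 ler0n.
Qed.

(** Stein's identity. The function [h] of the proof is the derivative of [g * pdf s]; by the
    fundamental theorem on growing segments its integral is the limit of boundary terms, that is
    0. *)
Lemma gauss_ibp (s C : R) (g g' : R -> R) : s != 0 ->
  (forall x : R, is_derive x 1 g (g' x)) -> continuous g' ->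
  (forall x, `|g x| <= C * expR `|x|) -> (forall x, `|g' x| <= C * expR `|x|) ->
  \int[gamma s]_x (x * g x) = s ^+ 2 * \int[gamma s]_x g' x.
Proof.
move=> s0 dg cg' gC g'C.
have s2 : 0 < s ^+ 2 by rewrite exprn_even_gt0.
have cg : continuous g.
  by move=> x; apply: differentiable_continuous; apply/derivable1_diffP; have [] := dg x.
have mg : measurable_fun setT g by exact: continuous_measurable_fun.
have mg' : measurable_fun setT g' by exact: continuous_measurable_fun.
have C0 : 0 <= C.
  have := le_trans (normr_ge0 _) (gC 0).
  by rewrite normr0 expR0 mulr1.
have ig' : integ (gamma s) g'.
  by apply: (@integ_gauss_growth s 1 C) => // x; rewrite mul1r.
have ixg : integ (gamma s) (fun x => x * g x).
  apply: (@integ_gauss_growth s 2 C) => //; first exact: measurable_funM.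
  move=> x; rewrite normrM (_ : 2 * `|x| = `|x| + `|x|) ?expRD; last by ring.
  rewrite mulrA [leRHS]mulrC.
  apply: ler_pM => //.
  by apply: le_trans (expR_ge1Dx _); rewrite lerDr.
pose h x := g' x * pdf s x - (s ^+ 2)^-1 * (x * g x * pdf s x).
have ih : integ leb h.
  apply: integB; first exact: integ_normal_pdf.
  by apply: integZ; exact: integ_normal_pdf.
have dH (x : R) : is_derive x 1 (fun x => g x * pdf s x) (h x).
  have dp := is_derive_normal_pdf x s0; have dgx := dg x.
  apply: is_derive_eq.
  rewrite /h /GRing.scale/=; field.
  exact: s0.
have ch : continuous h.
  move=> x; apply: cvgB.
    by apply: cvgM; [exact: cg'|exact: continuous_normal_pdf].
  apply: cvgM; first exact: cvg_cst.
  apply: cvgM; last exact: continuous_normal_pdf.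
  by apply: cvgM; [exact: cvg_id|exact: cg].
have cH : continuous (fun x => g x * pdf s x).
  by move=> x; apply: cvgM; [exact: cg|exact: continuous_normal_pdf].
have H0 : \int[leb]_x h x = 0.
  have := integral_cvg_full ih.
  have -> : (fun n => \int[leb]_(x in `[- n.+1%:R, n.+1%:R]) h x) =
      fun n => g n.+1%:R * pdf s n.+1%:R - g (- n.+1%:R) * pdf s (- n.+1%:R).
    apply/funext => n; rewrite /Rintegral.
    rewrite (@continuous_FTC2 _ _ (fun x => g x * pdf s x)) ?EFinB//.
    - by rewrite gtrN.
    - exact: continuous_subspaceT.
    - split.
      + by move=> x _; have [] := dH x.
      + by apply: cvg_at_right_filter; exact: cH.
      + by apply: cvg_at_left_filter; exact: cH.
    - by move=> x _; rewrite derive1E; have [_ ->] := dH x.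
  move/cvg_unique; apply => //.
  apply: (@exp_gauss_cvg0 s C (fun x => g x * pdf s x) s0) => x.
  by rewrite normrM (ger0_norm (normal_pdf_ge0 _ _ _)) mulrA ler_wpM2r ?normal_pdf_ge0.
move: H0; rewrite EB; [|exact: integ_normal_pdf|by apply: integZ; exact: integ_normal_pdf].
rewrite EZ; last exact: integ_normal_pdf.
rewrite -!E_normal_prob// => /eqP; rewrite subr_eq0 => /eqP ->.
by rewrite mulrA divff ?mul1r// gt_eqF.
Qed.

End gaussian.

(** * Barrier bound for Stein's equation *)

Section stein.
Context (R : realType).
Notation pdf s := (@normal_pdf R 0 s).

Lemma normal_pdf_gt0 (s x : R) : s != 0 -> 0 < pdf s x.
Proof.
move=> s0; rewrite normal_pdfE//; apply: mulr_gt0; last exact: expR_gt0.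
exact: normal_peak_gt0.
Qed.

(** The quantity [x0 * f x0 + k x0] is [f'] at [x0]. Only one side and one half-line are treated;
    the others follow by changing the signs of [f] and of the variable. *)
Lemma stein_barrier (f k : R -> R) (c x0 : R) :
  (forall x : R, is_derive x 1 f (x * f x + k x)) ->
  (forall x y, `|k x - k y| <= `|x - y|) -> `|k 0| <= c ->
  f n.+1%:R * pdf 1 n.+1%:R @[n --> \oo] --> (0 : R) ->
  1 <= x0 -> - (1 + c) <= x0 * f x0 + k x0.
Proof.
move=> df klip k0 f0 x01.
have x00 : 0 < x0 by exact: lt_le_trans x01.
pose K := k x0; pose dl := x0 - K.
have c0 : 0 <= c by exact: le_trans k0.
(* A barrier: [u = (f + b) * pdf 1] is nonincreasing on [[x0, +oo[] and tends to 0, so [u x0 >= 0],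
   that is [f x0 >= - b x0]. The Lipschitz condition enters as [k t <= t - dl]. Equality in the
   second clause would hold for [b = 1 - dl * m] with [m] the Mills ratio of the normal law;
   explicit bounds of [m] suffice. *)
suff [b [b' [D [db bineq bD bx0]]]] : exists b b' : R -> R, exists D : R,
    [/\ forall t : R, 0 < t -> is_derive t 1 b (b' t),
        forall t, x0 <= t -> t - dl + b' t - t * b t <= 0,
        forall t, x0 <= t -> `|b t| <= D
      & - (1 + c) <= K - x0 * b x0].
  apply: le_trans bx0 _; rewrite -/K [leRHS]addrC lerD2l -mulrN ler_pM2l//.
  rewrite -subr_ge0 opprK.
  pose u t := (f t + b t) * pdf 1 t.
  have du (t : R) : 0 < t -> is_derive t 1 u ((k t + b' t - t * b t) * pdf 1 t).
    move=> t0; have dft := df t; have dbt := db t t0.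
    have dp := @is_derive_normal_pdf R 1 t (oner_neq0 _).
    by apply: is_derive_eq; rewrite /GRing.scale/= expr1n; field.
  have nu t : x0 <= t -> u t <= u x0.
    move=> x0t.
    have itv z : z \in `]x0, t[ -> 0 < z.
      by rewrite in_itv/= => /andP[+ _]; apply: lt_trans.
    apply: (@ler0_derive1_nincr _ u x0 t) => //.
    - by move=> z /itv z0; have [] := du z z0.
    - move=> z zx; rewrite derive1E; have [_ ->] := du z (itv _ zx).
      rewrite pmulr_lle0 ?normal_pdf_gt0//.
      move: zx; rewrite in_itv/= => /andP[/ltW xz _].
      apply: (le_trans _ (bineq z xz)).
      have := le_trans (ler_norm _) (klip z x0).
      rewrite ger0_norm ?subr_ge0// -/K /dl; lra.
    - apply: derivable_within_continuous => z; rewrite in_itv/= => /andP[xz _].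
      by have [] := du z (lt_le_trans x00 xz).
  have u0 : u n.+1%:R @[n --> \oo] --> (0 : R).
    rewrite -[X in _ --> X]addr0 /u.
    under eq_fun do rewrite mulrDl.
    apply: cvgD => //.
    pose B t := if x0 <= t then b t * pdf 1 t else 0.
    have BD t : `|B t| <= D * (expR `|t| * pdf 1 t).
      rewrite /B; case: ifPn => [xt|_].
        rewrite normrM ler_pM//; first exact: bD.
        rewrite ger0_norm ?normal_pdf_ge0// ler_peMl ?normal_pdf_ge0//.
        by apply: le_trans (expR_ge1Dx _); rewrite lerDl.
      rewrite normr0 mulr_ge0 ?mulr_ge0 ?expR_ge0 ?normal_pdf_ge0//.
      exact: le_trans (bD x0 (lexx _)).
    apply: cvg_trans (exp_gauss_cvg0p (oner_neq0 _) BD).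
    apply: near_eq_cvg; near=> n; rewrite /B ifT//.
    apply: le_trans (_ : n%:R <= _); last by rewrite ler_nat.
    near: n; exact: nbhs_infty_ger.
  have : 0 <= u x0.
    apply: (@cvgr_to_le _ _ _ _ _ _ _ u0).
    near=> n; apply: nu.
    apply: le_trans (_ : n%:R <= _); last by rewrite ler_nat.
    near: n; exact: nbhs_infty_ger.
  by rewrite /u pmulr_lge0// normal_pdf_gt0.
have [dl0|dl0] := leP dl 0.
  (* For [dl <= 0] the Mills ratio is replaced by its upper bound [1 / t]. *)
  exists (fun t => 1 - dl * t^-1), (fun t => dl * t^-1 ^+ 2), (1 - dl); split.
  - move=> t t0.
    have tn0 : t != 0 by rewrite gt_eqF.
    have dV := is_deriveV tn0 (is_derive_id t 1).
    apply: is_derive_eq; rewrite /GRing.scale/=.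
    by field.
  - move=> t xt; have t0 : 0 < t by exact: lt_le_trans xt.
    rewrite [leLHS](_ : _ = dl * t^-1 ^+ 2); last by field; rewrite gt_eqF.
    by rewrite mulr_le0_ge0// sqr_ge0.
  - move=> t xt; have t0 : 0 < t by exact: lt_le_trans xt.
    have ti : 0 < t^-1 <= 1.
      by rewrite invr_gt0 t0/= invf_le1// (le_trans x01).
    rewrite ger0_norm; nra.
  - rewrite mulrBr mulr1 mulrCA divff ?gt_eqF// mulr1 /dl.
    rewrite [leRHS](_ : _ = 0); last by ring.
    by rewrite oppr_le0 addr_ge0.
have dlc : dl <= 2 * x0 + c.
  rewrite /dl lerBlDr -lerBlDl.
  have := klip x0 0; rewrite subr0 (ger0_norm (ltW x00)) -/K.
  move=> /(le_trans (ler_norm _)).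
  have := klip 0 x0; rewrite sub0r normrN (ger0_norm (ltW x00)) -/K.
  move=> /(le_trans (ler_norm _)).
  have := ler_norm (- k 0); have := ler_norm (k 0); rewrite normrN; lra.
(* For [dl > 0] its lower bound [t / (1 + t^2)] is needed instead. The loss is [dl / (1 + x0^2)], at
   most [1 + c] because [dl <= 2 * x0 + c]. *)
pose r t : R := t / (1 + t ^+ 2).
have p1 t : 0 < 1 + t ^+ 2 :> R by rewrite ltr_pwDl// sqr_ge0.
exists (fun t => 1 - dl * r t), (fun t => - dl * ((1 - t ^+ 2) / (1 + t ^+ 2) ^+ 2)), (1 + dl).
split.
- move=> t t0.
  have tn0 : 1 + t * t != 0 by rewrite gt_eqF// -expr2.
  rewrite [X in is_derive _ _ X _](_ : _ = fun t => 1 - dl * (t * (1 + t * t)^-1)); last first.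
    by apply/funext => z; rewrite /r expr2.
  have dV := is_deriveV tn0 _.
  apply: is_derive_eq; rewrite /GRing.scale/=.
  rewrite -!expr2; field.
  by rewrite gt_eqF.
- move=> t xt.
  rewrite [leLHS](_ : _ = - dl * (2 / (1 + t ^+ 2) ^+ 2)); last first.
    by rewrite /r; field; rewrite gt_eqF.
  by rewrite mulNr oppr_le0 mulr_ge0 ?(ltW dl0)// divr_ge0// sqr_ge0.
- move=> t xt; have t0 : 0 < t by exact: lt_le_trans xt.
  have : 0 <= r t <= 1.
    rewrite /r divr_ge0 ?(ltW t0) ?(ltW (p1 t))//=.
    rewrite ler_pdivrMr// mul1r; nra.
  rewrite ler_norml; nra.
- rewrite [leRHS](_ : _ = - (dl / (1 + x0 ^+ 2))); last first.
    by rewrite /r /dl; field; rewrite gt_eqF.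
  rewrite lerN2 ler_pdivrMr//; nra.
Unshelve. all: end_near. Qed.

End stein.

(** * Solution of Stein's equation for the standard normal law *)

Section stein_solution.
Context (R : realType).
Notation leb := (@lebesgue_measure R).
Notation gamma s := (@normal_prob R 0 s).
Notation pdf s := (@normal_pdf R 0 s).

Lemma lip_continuous (L : R) (h : R -> R) :
  (forall x y, `|h x - h y| <= L * `|x - y|) -> continuous h.
Proof.
move=> hL x; apply/cvgrPdist_le => e e0.
have K0 : 0 < `|L| + 1 by rewrite ltr_wpDl.
near=> y; apply: le_trans (hL _ _) _.
apply: (@le_trans _ _ ((`|L| + 1) * `|x - y|)).
  by rewrite ler_wpM2r// (le_trans (ler_norm _))// lerDl.
rewrite mulrC -ler_pdivlMr//.
near: y.
have e1 : 0 < e / (`|L| + 1) by exact: divr_gt0.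
exists (e / (`|L| + 1)) => //= y; exact: ltW.
Unshelve. all: end_near. Qed.

Lemma integ_gauss_norm (s : R) : s != 0 -> integ (gamma s) (fun x : R => `|x|).
Proof.
move=> s0; have B (x : R) : Num.norm (Num.norm x) <= 1 * expR (1 * `|x|).
  by rewrite normr_id !mul1r; apply: le_trans (expR_ge1Dx _); rewrite lerDr.
by apply: (integ_gauss_growth s0 _ B); exact: normr_measurable.
Qed.

Lemma integ_gauss_lip (s L : R) (h : R -> R) : s != 0 ->
  (forall x y, `|h x - h y| <= L * `|x - y|) -> integ (gamma s) h.
Proof.
move=> s0 hL.
have L0 : 0 <= L by have := le_trans (normr_ge0 _) (hL 1 0); rewrite subr0 normr1 mulr1.
have B (x : R) : `|h x| <= (`|h 0| + L) * expR (1 * `|x|).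
  have := hL x 0; rewrite subr0 mul1r => hx.
  have e1 := expR_ge1Dx `|x|.
  have x0 := normr_ge0 x; have h0 := normr_ge0 (h 0).
  have : `|h x| <= `|h x - h 0| + `|h 0|.
    by apply: le_trans (ler_normD _ _); rewrite subrK.
  nra.
apply: (integ_gauss_growth s0 _ B).
by apply: continuous_measurable_fun; exact: lip_continuous hL.
Qed.

(** With [m1 = E|N|], the barrier gives [1 + m1] outside [[-1, 1]]. Inside, [|k|] is at most
    [1 + m1] and the numerator of the solution is at most [2 * m1], while the density is at least
    [pdf 1 1]. *)
Definition stein_cst : R :=
  1 + \int[gamma 1]_x `|x| + 2 * (\int[gamma 1]_x `|x|) / pdf 1 1.

(** The classical solution [f = H / pdf 1], with [H x] the integral of [k * pdf 1] over []-oo, x]].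
    Centering of [k] makes [H] vanish at [+oo] as well as at [-oo], as the barrier argument requires
    at both ends. *)
Lemma stein_ode (k : R -> R) :
  (forall x y, `|k x - k y| <= `|x - y|) -> \int[gamma 1]_x k x = 0 ->
  exists f : R -> R, (forall x : R, is_derive x 1 f (x * f x + k x)) /\
    forall x, `|x * f x + k x| <= stein_cst.
Proof.
move=> klip k0.
have o0 : (1 : R) != 0 := oner_neq0 R.
have klip1 x y : `|k x - k y| <= 1 * `|x - y| by rewrite mul1r.
have ck := lip_continuous klip1.
have ik := integ_gauss_lip o0 klip1.
pose g x := k x * pdf 1 x.
have ig : integ leb g := integ_normal_pdf ik.
have cg : continuous g.
  by move=> x; apply: cvgM; [exact: ck|exact: continuous_normal_pdf].
pose H x := \int[leb]_(t in [set` Interval -oo%O (BRight x)]) g t.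
have dH (x : R) : is_derive x 1 H (g x).
  have [|||d1 d2] := @continuous_FTC1 _ g -oo%O x (x + 1) _ _ _ (cg x).
  - by rewrite ltrDl.
  - by apply: integrableS ig.
  - by rewrite /= ltNyr.
  by rewrite -d2 derive1E; exact: derivableP d1.
pose m1 := \int[gamma 1]_x `|x|.
have in1 := integ_gauss_norm o0.
have m10 : 0 <= m1 by exact: Rintegral_ge0.
have p0 x : 0 < pdf 1 x :> R by exact: normal_pdf_gt0.
(* Centering controls [k] at the origin: [k 0] is the mean of [k 0 - k x]. *)
have k0m : `|k 0| <= m1.
  have -> : k 0 = \int[gamma 1]_x (k 0 - k x).
    by rewrite EB// ?E_cst ?k0 ?subr0//; exact: integ_cst.
  have i0 : integ (gamma 1) (fun x => k 0 - k x).
    by apply: integB => //; exact: integ_cst.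
  apply: le_trans (E_norm i0) _; apply: E_le => //; first exact: integ_norm.
  by move=> x; apply: le_trans (klip _ _) _; rewrite sub0r normrN.
have km x : `|k x| <= m1 + `|x|.
  have := klip x 0; rewrite subr0 => h.
  have : `|k x| <= `|k x - k 0| + `|k 0|.
    by apply: le_trans (ler_normD _ _); rewrite subrK.
  lra.
pose f x := H x / pdf 1 x.
have fE x : H x = f x * pdf 1 x by rewrite /f divfK// gt_eqF.
have df (x : R) : is_derive x 1 f (x * f x + k x).
  have dHx := dH x; have dp := @is_derive_normal_pdf R 1 x o0.
  have pn0 : pdf 1 x != 0 by rewrite gt_eqF.
  have dV := is_deriveV pn0 dp.
  apply: is_derive_eq; rewrite /GRing.scale/= expr1n fE /g.
  by field.
exists f; split => // x.
have Hcvg : H n.+1%:R @[n --> \oo] --> (0 : R).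
  have := @integral_cvg_restrict R g
    (fun n => [set` Interval -oo%O (BRight (n.+1%:R : R))]) setT ig _ _ _.
  rewrite -E_normal_prob// k0; apply => //.
  move=> y; near=> n; rewrite in_setT; apply/mem_set => /=.
  rewrite in_itv/=; apply: le_trans (ler_norm _) _.
  apply: le_trans (_ : n%:R <= _); last by rewrite ler_nat.
  by near: n; exact: nbhs_infty_ger.
have Hcvg' : H (- n.+1%:R) @[n --> \oo] --> (0 : R).
  have := @integral_cvg_restrict R g
    (fun n => [set` Interval -oo%O (BRight (- n.+1%:R : R))]) set0 ig _ _ _.
  rewrite Rintegral_set0; apply => //.
  move=> y; near=> n; rewrite in_set0; apply/negbTE/negP => /set_mem /=.
  rewrite in_itv/= => yn.
  have : n.+1%:R <= `|y|.
    by rewrite -normrN; apply: le_trans (ler_norm _); rewrite lerNr.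
  apply/negP; rewrite -ltNge.
  apply: le_lt_trans (_ : n%:R < _); last by rewrite ltr_nat.
  by near: n; exact: nbhs_infty_ger.
have fcvg : f n.+1%:R * pdf 1 n.+1%:R @[n --> \oo] --> (0 : R).
  by under eq_fun do rewrite -fE.
have pdfN y : pdf 1 (- y) = pdf 1 y :> R.
  by rewrite !normal_pdfE// /normal_fun !subr0 sqrrN.
have fcvg' : - f (- n.+1%:R) * pdf 1 n.+1%:R @[n --> \oo] --> (0 : R).
  rewrite -[X in _ --> X]oppr0; under eq_fun do rewrite mulNr -[pdf _ _]pdfN -fE.
  exact: cvgN.
have iag : integ leb (fun x => `|g x|) := integ_norm ig.
have Hbd y : `|H y| <= 2 * m1.
  pose A : set R := [set` Interval -oo%O (BRight y)].
  have iA : integ leb (g \_ A).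
    have B t : `|(g \_ A) t| <= `|g t|.
      by rewrite patchE; case: ifP => // _; rewrite normr0.
    have mA : measurable A by exact: measurable_itv.
    apply: integ_le; [|exact: iag|exact: B].
    by apply/(measurable_restrictT _ mA); apply: measurable_funTS; exact: integ_meas ig.
  rewrite /H Rintegral_mkcond.
  apply: le_trans (E_norm iA) _.
  have -> : 2 * m1 = \int[leb]_t ((m1 + `|t|) * pdf 1 t).
    have im : integ (gamma 1) (fun t : R => m1 + `|t|).
      by apply: integD => //; exact: integ_cst.
    rewrite -E_normal_prob// ED// ?E_cst//; last exact: integ_cst.
    by rewrite -/m1; ring.
  apply: E_le; first exact: integ_norm.
    by apply: integ_normal_pdf; apply: integD => //; exact: integ_cst.
  move=> t; rewrite patchE; case: ifP => _; last first.
    by rewrite normr0 mulr_ge0 ?addr_ge0 ?(ltW (p0 t)).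
  by rewrite /g normrM (gtr0_norm (p0 t)) ler_wpM2r// ltW.
have cst1 : 1 + m1 <= stein_cst.
  rewrite /stein_cst -/m1 lerDl divr_ge0 ?(ltW (p0 1))// mulr_ge0//.
have [x1|x1] := leP `|x| 1.
  rewrite /stein_cst -/m1.
  have px : pdf 1 1 <= pdf 1 x.
    rewrite !normal_pdfE//; apply: ler_wpM2l; first exact: normal_peak_ge0.
    rewrite /normal_fun ler_expR !subr0 ler_wpM2r// ?invr_ge0 ?mulrn_wge0 ?sqr_ge0//.
    by rewrite lerN2 expr1n -(real_normK (num_real x)) expr_le1// normr_ge0.
  apply: le_trans (ler_normD _ _) _; rewrite normrM.
  have fb : `|f x| <= 2 * m1 / pdf 1 1.
    rewrite /f normrM normfV (gtr0_norm (p0 x)).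
    by apply: ler_pM => //; rewrite ?invr_ge0 ?(ltW (p0 x))// lef_pV2// posrE.
  have : `|x| * `|f x| <= 1 * (2 * m1 / pdf 1 1) by apply: ler_pM.
  have := km x; lra.
(* Outside [[-1, 1]] the barrier is applied to [f], [- f] and their reflections, which solve the
   equation for correspondingly changed data. Each sign of [x] uses two of the four. *)
apply: le_trans cst1; rewrite ler_norml.
have kN0 : `|- k 0| <= m1 by rewrite normrN.
have klipN y z : `|- k y - - k z| <= `|y - z|.
  by rewrite opprK addrC distrC.
have klipR y z : `|k (- y) - k (- z)| <= `|y - z|.
  by apply: le_trans (klip _ _) _; rewrite opprK addrC distrC.
have klipRN y z : `|- k (- y) - - k (- z)| <= `|y - z|.
  by rewrite opprK addrC distrC.
have kR0 : `|k (- 0)| <= m1 by rewrite oppr0.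
have kRN0 : `|- k (- 0)| <= m1 by rewrite oppr0 normrN.
have dfN (y : R) : is_derive y 1 (fun t => - f t) (y * - f y + - k y).
  have d1 := df y; apply: is_derive_eq; ring.
have dRf (y : R) : is_derive y 1 (f \o (fun t : R => - t)) ((- y * f (- y) + k (- y)) * (-1)).
  have d2 := df (- y).
  have dn : is_derive y 1 (fun t : R => - t) (-1) by apply: is_derive_eq.
  exact: is_derive1_comp.
have dfRN (y : R) : is_derive y 1 (fun t => f (- t)) (y * f (- y) + - k (- y)).
  have -> : y * f (- y) + - k (- y) = (- y * f (- y) + k (- y)) * (-1) by ring.
  exact: dRf.
have dfR (y : R) : is_derive y 1 (fun t => - f (- t)) (y * - f (- y) + k (- y)).
  have d1 := dfRN y.
  by apply: is_derive_eq; ring.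
have fcvgN : - f n.+1%:R * pdf 1 n.+1%:R @[n --> \oo] --> (0 : R).
  by rewrite -[X in _ --> X]oppr0; under eq_fun do rewrite mulNr; exact: cvgN.
have fcvgRN : f (- n.+1%:R) * pdf 1 n.+1%:R @[n --> \oo] --> (0 : R).
  rewrite -[X in _ --> X]oppr0.
  by under eq_fun do rewrite -[f _]opprK mulNr; exact: cvgN.
have [x0|x0] := leP 0 x.
  have x1' : 1 <= x by rewrite -(ger0_norm x0) ltW.
  have := stein_barrier df klip k0m fcvg x1'.
  have := stein_barrier dfN klipN kN0 fcvgN x1'.
  by lra.
have x1' : 1 <= - x by rewrite -(ltr0_norm x0) ltW.
have := stein_barrier dfR klipR kR0 fcvg' x1'.
have := stein_barrier dfRN klipRN kRN0 fcvgRN x1'.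
rewrite !opprK.
by lra.
Unshelve. all: end_near. Qed.

End stein_solution.

(** * Stein's equation at scale [s]; Gaussian means of [quart_inv] *)

Section gaussian_functionals.
Context (R : realType).
Notation gamma s := (@normal_prob R 0 s).

Lemma derive_bounded_lip (K : R) (f f' : R -> R) :
  (forall x : R, is_derive x 1 f (f' x)) -> (forall x, `|f' x| <= K) ->
  forall x y, `|f x - f y| <= K * `|x - y|.
Proof.
move=> df fK x y; wlog xy : x y / x <= y.
  by move=> H; have [|/ltW] := leP x y; [exact: H|rewrite distrC (distrC x); exact: H].
have cf : {within `[x, y], continuous f}.
  by apply: derivable_within_continuous => z _; have [] := df z.
have [z _ fyx] := @MVT_segment R f f' x y xy (fun z _ => df z) cf.
by rewrite distrC fyx normrM (distrC x) ler_wpM2r.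
Qed.

(** Rescaling to the standard case: [h (s y) / (s L)] is 1-Lipschitz, and its solution [f1] gives
    [f x = L * f1 (x / s)]. *)
Lemma stein_solution (s L : R) (h : R -> R) : 0 < s -> 0 < L ->
  (forall x y, `|h x - h y| <= L * `|x - y|) ->
  exists f f' : R -> R, [/\ forall x : R, is_derive x 1 f (f' x),
    continuous f', forall x, `|f' x| <= stein_cst R * L / s &
    forall x, s ^+ 2 * f' x - x * f x = h x - \int[gamma s]_x h x].
Proof.
move=> s0 L0 hL.
have sn0 : s != 0 by rewrite gt_eqF.
have Ln0 : L != 0 by rewrite gt_eqF.
have o0 : (1 : R) != 0 := oner_neq0 R.
pose h1 y := h (s * y) / (s * L).
have h1lip x y : `|h1 x - h1 y| <= 1 * `|x - y|.
  rewrite /h1 -mulrBl normrM mul1r normfV ler_pdivrMr ?normr_gt0 ?mulf_neq0//.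
  apply: le_trans (hL _ _) _.
  rewrite -mulrBr !normrM (gtr0_norm s0) (gtr0_norm L0).
  by rewrite le_eqVlt; apply/orP; left; apply/eqP; ring.
pose m := \int[gamma 1]_y h1 y.
have ih1 := integ_gauss_lip o0 h1lip.
pose k y := h1 y - m.
have klip x y : `|k x - k y| <= `|x - y|.
  have := h1lip x y; rewrite mul1r; congr (_ <= _); congr (`| _ |).
  by rewrite /k; ring.
have k0 : \int[gamma 1]_y k y = 0.
  by rewrite /k EB// ?E_cst ?subrr//; exact: integ_cst.
have [f1 [df1 f1C]] := stein_ode klip k0.
pose f x := L * f1 (x / s).
pose f' x := L / s * (x / s * f1 (x / s) + k (x / s)).
have cf1 : continuous f1.
  move=> x; apply: differentiable_continuous; apply/derivable1_diffP.
  by have [] := df1 x.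
have klip1 x y : `|k x - k y| <= 1 * `|x - y| by rewrite mul1r.
have ck := lip_continuous klip1.
have df (x : R) : is_derive x 1 f (f' x).
  have d1 := df1 (x / s).
  have d2 : is_derive x 1 (fun t : R => t / s) (s^-1).
    by apply: is_derive_eq; rewrite /GRing.scale/= mulr0 add0r mulr1.
  have d3 : is_derive x 1 (f1 \o (fun t : R => t / s))
     ((x / s * f1 (x / s) + k (x / s)) * s^-1) by exact: is_derive1_comp.
  have -> : f = fun t => L * (f1 \o (fun t : R => t / s)) t by [].
  apply: is_derive_eq; rewrite /GRing.scale/= /f'.
  by ring.
have cdiv : continuous (fun t : R => t / s).
  by move=> x; apply: cvgM; [exact: cvg_id|exact: cvg_cst].
have cf' : continuous f'.
  move=> x; apply: cvgM; first exact: cvg_cst.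
  apply: cvgD.
    apply: cvgM; first exact: cdiv.
    by apply: (continuous_comp (cdiv x)); exact: cf1.
  by apply: (continuous_comp (cdiv x)); exact: ck.
have f'C x : `|f' x| <= stein_cst R * L / s.
  have -> : stein_cst R * L / s = L / s * stein_cst R by ring.
  by rewrite /f' normrM gtr0_norm ?divr_gt0// ler_wpM2l// ltW// divr_gt0.
have eqn x : s ^+ 2 * f' x - x * f x = h x - s * L * m.
  rewrite /f' /f /k /h1 [s * (x / s)]mulrC divfK//.
  by field; rewrite sn0 Ln0.
have flip := derive_bounded_lip df f'C.
(* No change of variables is needed: by [gauss_ibp] the left side of [eqn] has mean 0, which forces
   the constant on its right to be the mean of [h]. *)
have E0 : \int[gamma s]_x h x = s * L * m.
  have ih := integ_gauss_lip sn0 hL.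
  pose C := stein_cst R * L / s.
  have C0 : 0 <= C by exact: le_trans (f'C 0).
  have e1 (x : R) : 1 <= expR `|x|.
    by apply: le_trans (expR_ge1Dx _); rewrite lerDl.
  have e2 (x : R) : `|x| <= expR `|x|.
    by apply: le_trans (expR_ge1Dx _); rewrite lerDr.
  have fgr x : `|f x| <= (`|f 0| + C) * expR `|x|.
    have := flip x 0; rewrite subr0 -/C => fx.
    have : `|f x| <= `|f x - f 0| + `|f 0|.
      by apply: le_trans (ler_normD _ _); rewrite subrK.
    have := e1 x; have := e2 x; have := normr_ge0 (f 0); nra.
  have f'gr x : `|f' x| <= (`|f 0| + C) * expR `|x|.
    apply: le_trans (f'C x) _; rewrite -/C.
    have := e1 x; have := normr_ge0 (f 0); nra.
  have ibp := gauss_ibp sn0 df cf' fgr f'gr.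
  have if' : integ (gamma s) f'.
    have B x : `|f' x| <= (`|f 0| + C) * expR (1 * `|x|) by rewrite mul1r.
    by apply: (integ_gauss_growth sn0 _ B); exact: continuous_measurable_fun.
  have ixf : integ (gamma s) (fun x => x * f x).
    have -> : (fun x => x * f x) = fun x => s ^+ 2 * f' x - (h x - s * L * m).
      by apply/funext => x; rewrite -eqn; ring.
    by apply: integB; [exact: integZ|apply: integB => //; exact: integ_cst].
  apply/eqP; rewrite -subr_eq0; apply/eqP.
  transitivity (\int[gamma s]_x (h x - s * L * m)).
    by rewrite EB// ?E_cst//; exact: integ_cst.
  under eq_Rintegral do rewrite -eqn.
  rewrite EB; [|exact: integZ|exact: ixf].
  by rewrite EZ// ibp subrr.
by exists f, f'; split => // x; rewrite eqn E0.
Qed.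

Lemma gauss_sqr (s : R) : s != 0 -> \int[gamma s]_x (x ^+ 2) = s ^+ 2.
Proof.
move=> s0.
have d1 (x : R) : is_derive x 1 (fun t : R => t) ((fun=> 1) x) by exact: is_derive_id.
have c1 : continuous (fun _ : R => 1 : R) by move=> x; exact: cvg_cst.
have g1 (x : R) : `|x| <= 1 * expR `|x|.
  by rewrite mul1r; apply: le_trans (expR_ge1Dx _); rewrite lerDr.
have g2 (x : R) : `|1 : R| <= 1 * expR `|x|.
  by rewrite mul1r normr1; apply: le_trans (expR_ge1Dx _); rewrite lerDl.
have := gauss_ibp s0 d1 c1 g1 g2; rewrite E_cst mulr1 => <-.
by apply: eq_Rintegral => x _; rewrite expr2.
Qed.

Lemma gauss_norm_le (s : R) : s != 0 -> \int[gamma s]_x `|x| <= (1 + s ^+ 2) / 2.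
Proof.
move=> s0.
have B (x : R) : `|x ^+ 2| <= 2 * expR (1 * `|x|).
  rewrite mul1r normrX; have := @expR_ge1Dxn R `|x| 1 (normr_ge0 _).
  by rewrite (_ : 2`! = 2)%N//; lra.
have i2 : integ (gamma s) (fun x : R => x ^+ 2).
  by apply: (integ_gauss_growth s0 _ B); exact: exprn_measurable.
have ih : integ (gamma s) (fun x : R => 2^-1 * (1 + x ^+ 2)).
  by apply: integZ; apply: integD => //; exact: integ_cst.
have -> : (1 + s ^+ 2) / 2 = \int[gamma s]_x (2^-1 * (1 + x ^+ 2)).
  rewrite EZ ?ED// ?E_cst ?gauss_sqr// 1?mulrC//; first exact: integ_cst.
  by apply: integD => //; exact: integ_cst.
apply: E_le => //; first exact: integ_gauss_norm.
move=> x; have := sqr_ge0 (`|x| - 1); rewrite -(real_normK (num_real x)); nra.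
Qed.

(* |z|^(-1/2), smoothed: (z^2 + eta)^(-1/4). Unlike 1/|z|, it has a bounded
   Gaussian expectation as eta tends to 0. *)
Definition quart_inv (eta z : R) : R := expR (- (ln (z ^+ 2 + eta) / 4)).

Lemma quart_inv_gt0 eta z : 0 < quart_inv eta z.
Proof. exact: expR_gt0. Qed.

Lemma quart_invX4 eta z : 0 < eta -> quart_inv eta z ^+ 4 = (z ^+ 2 + eta)^-1.
Proof.
move=> e0; rewrite /quart_inv -expRM_natl.
have -> : 4%:R * - (ln (z ^+ 2 + eta) / 4) = - ln (z ^+ 2 + eta) :> R by field.
by rewrite expRN lnK// posrE ltr_wpDl// sqr_ge0.
Qed.

Lemma is_derive_quart_inv eta (z : R) : 0 < eta ->
  is_derive z 1 (quart_inv eta)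
    (- (z / (2 * (z ^+ 2 + eta))) * quart_inv eta z).
Proof.
move=> e0; have p0 : 0 < z * z + eta by rewrite ltr_wpDl// -expr2 sqr_ge0.
have -> : quart_inv eta = fun y => expR (- 4^-1 * ln (y * y + eta)).
  by apply/funext => y; rewrite /quart_inv expr2; congr expR; ring.
have d1 : is_derive z 1 (fun y : R => y * y + eta) (z + z).
  by apply: is_derive_eq; rewrite /GRing.scale/= addr0 mulr1.
have d2 : is_derive z 1 (@ln R \o (fun y : R => y * y + eta)) ((z * z + eta)^-1 * (z + z)).
  by have d3 := is_derive1_ln p0; exact: is_derive1_comp.
have d4 : is_derive z 1 (fun y => - 4^-1 * (@ln R \o (fun y : R => y * y + eta)) y)
   (- 4^-1 * ((z * z + eta)^-1 * (z + z))).
  by apply: is_derive_eq; rewrite /GRing.scale/=; ring.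
apply: is_derive_eq; rewrite /GRing.scale/= expr2; set q := expR _.
by field; rewrite gt_eqF.
Qed.

(** The bound does not depend on the center [y], so a factor can later be integrated out whatever
    the past is, nor on [eta]. The singularity is dominated by the derivative of a bounded function,
    and Gaussian integration by parts trades that derivative for a factor [x / s^2]. *)
Lemma quart_inv_gauss (s y eta : R) : s != 0 -> 0 < eta ->
  integ (gamma s) (fun x => quart_inv eta (y + x)) /\
  \int[gamma s]_x quart_inv eta (y + x) <= 16 + 2 * (1 + s ^+ 2) / s ^+ 2.
Proof.
move=> s0 e0.
have s2 : 0 < s ^+ 2 by rewrite exprn_even_gt0.
have p0 (z : R) : 0 < z ^+ 2 + eta by rewrite ltr_wpDl// sqr_ge0.
have o0 (z : R) : 0 < 1 + z ^+ 2 by rewrite ltr_pwDl// sqr_ge0.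
pose q := quart_inv eta.
have q0 z : 0 < q z by exact: quart_inv_gt0.
have cq : continuous q.
  move=> z; apply: differentiable_continuous; apply/derivable1_diffP.
  by have [] := is_derive_quart_inv z e0.
have qle z : q z <= q 0.
  rewrite -(@ler_pXn2r _ 4) ?nnegrE ?(ltW (q0 _))// !quart_invX4//.
  rewrite lef_pV2 ?posrE//.
  by rewrite lerD2r expr0n sqr_ge0.
(* For small [eta], [w] behaves near 0 like [sgn z * |z|^(1/2)], whose derivative is a multiple of
   [|z|^(-1/2)]; the factor [1 / (1 + z^2)] keeps [w] bounded at infinity. *)
pose w z := z * (q z * (1 + z ^+ 2)^-1).
pose w' z := q z * ((1 + z ^+ 2)^-1 - z ^+ 2 / (2 * (z ^+ 2 + eta) * (1 + z ^+ 2))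
   - 2 * z ^+ 2 / (1 + z ^+ 2) ^+ 2).
have dw (z : R) : is_derive z 1 w (w' z).
  have on0 : 1 + z * z != 0 by rewrite -expr2 gt_eqF.
  have d1 := is_derive_quart_inv z e0.
  have -> : w = fun z => z * (q z * (1 + z * z)^-1).
    by apply/funext => t; rewrite /w expr2.
  have dd : is_derive z 1 (fun z : R => 1 + z * z) (z + z).
    by apply: is_derive_eq; rewrite /GRing.scale/=; ring.
  have dV := @is_deriveV R (fun z : R => 1 + z * z) z _ 1 on0 dd.
  apply: is_derive_eq; rewrite /GRing.scale/= /w' /q -!expr2.
  by field; rewrite !gt_eqF.
have cw' : continuous w'.
  have c2 : continuous (fun z : R => z ^+ 2) by exact: exprn_continuous.
  have c3 : continuous (fun z : R => 1 + z ^+ 2).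
    by move=> z; apply: cvgD; [exact: cvg_cst|exact: c2].
  have c4 : continuous (fun z : R => z ^+ 2 + eta).
    by move=> z; apply: cvgD; [exact: c2|exact: cvg_cst].
  move=> z; apply: cvgM; first exact: cq.
  apply: cvgB; first apply: cvgB.
  - by apply: cvgV; [rewrite gt_eqF|exact: c3].
  - apply: cvgM; first exact: c2.
    apply: cvgV; first by rewrite !mulf_neq0// gt_eqF.
    apply: cvgM; last exact: c3.
    by apply: cvgM; [exact: cvg_cst|exact: c4].
  - apply: cvgM; first by apply: cvgM; [exact: cvg_cst|exact: c2].
    apply: cvgV; first by rewrite expf_neq0// gt_eqF.
    by rewrite expr2; apply: cvgM; exact: c3.
have q4 z : q z ^+ 4 = (z ^+ 2 + eta)^-1 by exact: quart_invX4.
have wle z : `|w z| <= 1.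
  rewrite /w mulrA normrM [X in _ * X]gtr0_norm ?invr_gt0// ler_pdivrMr// mul1r.
  rewrite normrM (gtr0_norm (q0 z)).
  have z2 : z ^+ 2 = `|z| ^+ 2 by rewrite real_normK ?num_real.
  have zq : (`|z| * q z) ^+ 4 <= `|z| ^+ 2.
    rewrite exprMn q4 ler_pdivrMr// z2.
    rewrite (_ : `|z| ^+ 4 = `|z| ^+ 2 * `|z| ^+ 2); last by ring.
    by rewrite ler_wpM2l ?sqr_ge0// lerDl ltW.
  rewrite z2; have [z1|z1] := leP (`|z|) 1.
    apply: (@le_trans _ _ 1); last by rewrite lerDl sqr_ge0.
    rewrite -(@expr_le1 _ 4)//; last by rewrite mulr_ge0// ltW.
    by apply: le_trans zq _; rewrite expr_le1.
  apply: (@le_trans _ _ (`|z| * `|z|)).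
    rewrite ler_wpM2l//; apply: le_trans (_ : 1 <= _); last exact: ltW.
    rewrite -(@expr_le1 _ 4)// ?(ltW (q0 z))// q4 invf_le1// z2.
    apply: (@le_trans _ _ (`|z| ^+ 2)); last by rewrite lerDl ltW.
    by rewrite expr_ge1// ltW.
  by rewrite -expr2 lerDr.
have b1 z : 0 <= z ^+ 2 / (2 * (z ^+ 2 + eta) * (1 + z ^+ 2)) <= (1 + z ^+ 2)^-1 / 2.
  rewrite divr_ge0 ?sqr_ge0 ?mulr_ge0 ?(ltW (p0 z)) ?(ltW (o0 z))//=.
  rewrite ler_pdivrMr; last by rewrite !mulr_gt0.
  rewrite [leRHS](_ : _ = z ^+ 2 + eta) ?lerDl ?(ltW e0)//.
  by field; rewrite gt_eqF.
have b2 (z : R) : 0 <= 2 * z ^+ 2 / (1 + z ^+ 2) ^+ 2 <= 2 * (1 + z ^+ 2)^-1.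
  apply/andP; split; first by rewrite divr_ge0 ?sqr_ge0// mulr_ge0// sqr_ge0.
  rewrite ler_pdivrMr; last by rewrite exprn_gt0.
  rewrite [leRHS](_ : _ = 2 * (1 + z ^+ 2)); last by field; rewrite gt_eqF.
  by rewrite ler_wpM2l// lerDr.
have b3 (z : R) : 0 < (1 + z ^+ 2)^-1 <= 1.
  by rewrite invr_gt0 o0/= invf_le1// lerDl sqr_ge0.
have w'b z : `|w' z| <= 3 * q 0.
  rewrite /w' normrM (gtr0_norm (q0 z)) mulrC.
  apply: ler_pM; [by []|exact: ltW| |exact: qle].
  by rewrite ler_norml; have := b1 z; have := b2 z; have := b3 z; lra.
(* For [z^2 <= 1/9] the bracket in [w'] is at least [(1 - 1/2 - 1/5) * 9/10 > 1/4]. Otherwise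
   [q z <= 2] and the bracket is at least [-3/2], so [q - 4 w' <= 7 q <= 14]. *)
have key z : q z <= 4 * w' z + 16.
  have [z1|z1] := leP (z ^+ 2) (1/9).
    have b4 : 2 * z ^+ 2 / (1 + z ^+ 2) ^+ 2 <= 1/5 * (1 + z ^+ 2)^-1.
      rewrite ler_pdivrMr ?exprn_gt0//.
      rewrite [leRHS](_ : _ = 1/5 * (1 + z ^+ 2)); last by field; rewrite gt_eqF.
      by have := sqr_ge0 z; lra.
    have b5 : 9/10 <= (1 + z ^+ 2)^-1.
      rewrite -[9/10]invrK lef_pV2 ?posrE ?invr_gt0//.
      have := sqr_ge0 z; lra.
    rewrite /w'.
    have b6 : 1/4 <= (1 + z ^+ 2)^-1 - z ^+ 2 / (2 * (z ^+ 2 + eta) * (1 + z ^+ 2))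
       - 2 * z ^+ 2 / (1 + z ^+ 2) ^+ 2 by have := b1 z; lra.
    have := q0 z; nra.
  have q2 : q z <= 2.
    rewrite -(@ler_pXn2r _ 4) ?nnegrE ?(ltW (q0 _))// q4.
    rewrite -[leRHS]invrK lef_pV2 ?posrE ?invr_gt0 ?exprn_gt0//.
    have := e0; rewrite (_ : (2 : R) ^+ 4 = 16); last by ring.
    lra.
  rewrite /w'; set B := (X in q z * X).
  have b6 : - (3/2) <= B by have := b1 z; have := b2 z; have := b3 z; rewrite /B; lra.
  have := q0 z; nra.
pose W x := w (y + x); pose W' x := w' (y + x).
have e1 (x : R) : 1 <= expR `|x|.
  by apply: le_trans (expR_ge1Dx _); rewrite lerDl.
have dW (x : R) : is_derive x 1 W (W' x).
  have d1 := dw (y + x).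
  have d2 : is_derive x 1 (fun t : R => y + t) 1.
    rewrite -[X in is_derive _ _ _ X]add0r.
    exact: (is_deriveD (is_derive_cst _ _ _) (is_derive_id _ _)).
  have d3 : is_derive x 1 (w \o (fun t : R => y + t)) (w' (y + x) * 1).
    exact: is_derive1_comp.
  by rewrite /W' -[w' _]mulr1.
have cshift (f : R -> R) : continuous f -> continuous (fun x => f (y + x)).
  move=> cf x; apply: (continuous_comp _ (cf _)).
  by apply: cvgD; [exact: cvg_cst|exact: cvg_id].
have cW' := cshift _ cw'.
have K0 : 1 <= 1 + 3 * q 0 by rewrite lerDl mulr_ge0// ltW.
have gW x : `|W x| <= (1 + 3 * q 0) * expR `|x|.
  apply: le_trans (wle _) _; have := e1 x; nra.
have gW' x : `|W' x| <= (1 + 3 * q 0) * expR `|x|.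
  apply: le_trans (w'b _) _; have := e1 x; nra.
have ibp := gauss_ibp s0 dW cW' gW gW'.
have iQ : integ (gamma s) (fun x => q (y + x)).
  have B x : `|q (y + x)| <= q 0 by rewrite gtr0_norm.
  apply: integ_bounded; last exact: B.
  by apply: continuous_measurable_fun; exact: cshift.
split => //.
have iW' : integ (gamma s) W'.
  have B x : `|W' x| <= 3 * q 0 by exact: w'b.
  apply: integ_bounded; last exact: B.
  exact: continuous_measurable_fun.
have cW : continuous W.
  move=> x; apply: differentiable_continuous; apply/derivable1_diffP.
  by have [] := dW x.
have BxW x : `|x * W x| <= `|x|.
  by rewrite normrM ler_piMr//; exact: wle.
have ixW : integ (gamma s) (fun x => x * W x).
  apply: integ_le; [|exact: (integ_gauss_norm s0)|exact: BxW].
  by apply: measurable_funM => //; exact: continuous_measurable_fun.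
have EW' : \int[gamma s]_x W' x <= (1 + s ^+ 2) / (2 * s ^+ 2).
  have -> : \int[gamma s]_x W' x = (s ^+ 2)^-1 * \int[gamma s]_x (x * W x).
    by rewrite ibp mulrA mulVf ?mul1r// gt_eqF.
  rewrite [leRHS](_ : _ = (s ^+ 2)^-1 * ((1 + s ^+ 2) / 2)); last first.
    by field.
  rewrite ler_wpM2l ?invr_ge0 ?(ltW s2)//.
  apply: le_trans (gauss_norm_le s0).
  apply: E_le => //; first exact: integ_gauss_norm.
  by move=> x; apply: le_trans (ler_norm _) (BxW x).
have i4 : integ (gamma s) (fun x => 4 * W' x) by exact: integZ.
apply: (@le_trans _ _ (\int[gamma s]_x (4 * W' x + 16))).
  apply: E_le => //; first by apply: integD => //; exact: integ_cst.
rewrite ED// ?EZ// ?E_cst; last exact: integ_cst.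
rewrite addrC lerD2l.
rewrite [leRHS](_ : _ = 4 * ((1 + s ^+ 2) / (2 * s ^+ 2))); last by field.
by rewrite ler_wpM2l.
Qed.

End gaussian_functionals.

(** * The space of real sequences and the redrawing of one coordinate *)

(** Lower orthants in finitely many coordinates form a pi-system, on which probability measures can
    be compared. *)
Definition cylinder_sets (R : realType) : set (set (nat -> R)) :=
  [set A | exists (m : nat) (x : nat -> R),
    A = [set e | forall l, (l < m)%N -> e l < x l]].

Definition seqR (R : realType) := g_sigma_algebraType (@cylinder_sets R).

Definition upd (R : realType) (e : seqR R) (i : nat) (x : R) : seqR R :=
  fun l => if l == i then x else e l.

Section sequence_space.
Context (R : realType).
Notation gamma s := (@normal_prob R 0 s).

(** A half-space in coordinate [l] is the union over [k] of the orthants that cap the earlier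
    coordinates at [k]. *)
Lemma measurable_coord (l : nat) : measurable_fun [set: seqR R] (fun e : seqR R => e l : R).
Proof.
apply: (measurability _ (RGenInftyO.measurableE R)) => _ [_ [x ->] <-].
rewrite setTI.
have -> : (fun e : seqR R => e l : R) @^-1` `]-oo, x[ =
  \bigcup_k [set e : seqR R | forall j, (j < l.+1)%N ->
     e j < (if j == l then x else k%:R)].
  apply/seteqP; split => [e /=|e [k _ /(_ l (ltnSn l))]]; last first.
    by rewrite eqxx /= in_itv.
  rewrite in_itv/= => ex.
  pose M := \sum_(j < l) `|e j|.
  have [k Mk] : exists k : nat, M < k%:R.
    by exists (Num.truncn M).+1; apply: truncnS_gt.
  exists k => //= j; rewrite ltnS leq_eqVlt => /predU1P[->|jl].
    by rewrite eqxx.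
  rewrite ltn_eqF//; apply: le_lt_trans Mk; apply: le_trans (ler_norm _) _.
  by rewrite /M (bigD1 (Ordinal jl))//= lerDl sumr_ge0.
apply: bigcupT_measurable => k; apply: sub_sigma_algebra.
by exists l.+1, (fun j => if j == l then x else k%:R).
Qed.

Lemma measurable_fun_seqR d (T : measurableType d) (f : T -> seqR R) :
  (forall l, measurable_fun setT (fun t => f t l : R)) -> measurable_fun setT f.
Proof.
move=> mf.
have gen : @measurable _ (seqR R) = <<s @cylinder_sets R >> by [].
apply: (measurability _ gen) => _ [_ [m [x ->]] <-]; rewrite setTI.
have -> : f @^-1` [set e : seqR R | forall l, (l < m)%N -> e l < x l] =
    \bigcap_(l in [set l | (l < m)%N]) ((fun t => f t l : R) @^-1` `]-oo, x l[).
  apply/seteqP; split => [t /= H l /= lm|t /= H l lm].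
    by rewrite in_itv/= H.
  by have := H l lm; rewrite /= in_itv.
apply: bigcap_measurableType => l _.
by rewrite -[X in measurable X]setTI; apply: mf.
Qed.

Definition upd_pair (i : nat) (p : measurableTypeR R * seqR R) : seqR R :=
  upd p.2 i p.1.

Lemma measurable_upd (i : nat) : measurable_fun setT (upd_pair i).
Proof.
apply: measurable_fun_seqR => l; rewrite /upd_pair /upd.
case: (l == i); first exact: measurable_fst.
exact: (measurableT_comp (measurable_coord l) measurable_snd).
Qed.

HB.instance Definition _ (i : nat) :=
  isMeasurableFun.Build _ _ _ _ (upd_pair i) (measurable_upd i).

Lemma upd_eq (e : seqR R) i x : upd e i x i = x.
Proof. by rewrite /upd eqxx. Qed.

Lemma upd_neq (e : seqR R) i x j : j != i -> upd e i x j = e j.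
Proof. by rewrite /upd => /negbTE ->. Qed.

(* Under mu, coordinate i is N(0, s_i^2) and independent of all the others. *)
Definition resampling (mu : probability (seqR R) R) (s : nat -> R) :=
  forall (i : nat) (A : set (seqR R)), measurable A ->
    mu A = ((gamma (s i) \x mu) (upd_pair i @^-1` A))%E.

(** Uniqueness of measures on the pi-system of orthants. If [m <= i], the orthant does not constrain
    coordinate [i] and redrawing it changes nothing. *)
Lemma resampling_cylinder (mu : probability (seqR R) R) (s : nat -> R) :
  (forall i m (x : nat -> R), (i < m)%N ->
    mu [set e | forall l, (l < m)%N -> e l < x l] =
    (gamma (s i) `]-oo, x i[%classic *
     mu [set e : seqR R | forall l, (l < m)%N -> l != i -> (e l < x l)%R])%E) ->
  resampling mu s.
Proof.
move=> H i.
pose nu0 : {measure set (seqR R) -> \bar R} :=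
  pushforward (gamma (s i) \x mu)%E (upd_pair i).
pose nu := nu0 (measurable_upd i).
move=> A mA; change (mu A = nu A).
apply: (@measure_unique _ R (seqR R) (@cylinder_sets R) (fun=> setT) _ _ _ _ mu nu _ _ A mA) => //.
- move=> B C [m [x ->]] [m' [x' ->]].
  exists (maxn m m'), (fun l => if (l < m)%N then
     (if (l < m')%N then Num.min (x l) (x' l) else x l) else x' l).
  apply/seteqP; split => [e [/= e1 e2] l|e /= e1].
    rewrite leq_max; case: ifP => [lm _|_ /= lm']; last exact: e2.
    by case: ifP => lm'; [rewrite lt_min e1// e2|exact: e1].
  split=> l lm; have := e1 l; rewrite leq_max lm ?orbT /=.
    by case: ifP => _ /(_ isT)//; rewrite lt_min => /andP[].
  by case: ifP => _ /(_ isT)//; rewrite lt_min => /andP[].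
- by move=> _; exists 0%N, (fun=> 0); apply/seteqP; split.
- by rewrite bigcup_const.
- move=> _ [m [x ->]].
  have mcyl (Q : pred nat) : measurable [set e : seqR R | forall l, (l < m)%N -> Q l -> e l < x l].
    have -> : [set e : seqR R | forall l, (l < m)%N -> Q l -> e l < x l] =
      \bigcap_(l in [set l | (l < m)%N && Q l]) ((fun e : seqR R => e l : R) @^-1` `]-oo, x l[).
      apply/seteqP; split => [t /= h l /= /andP[lm Ql]|t /= h l lm Ql].
        by rewrite in_itv/= h.
      by have := h l; rewrite /= in_itv/= lm Ql; apply.
    apply: bigcap_measurableType => l _.
    by rewrite -[X in measurable X]setTI; apply: measurable_coord.
  have [im|mi] := ltnP i m.
    transitivity (gamma (s i) `]-oo, x i[%classic *
      mu [set e : seqR R | forall l, (l < m)%N -> l != i -> (e l < x l)%R])%E.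
      exact: H.
    have mI : measurable (`]-oo, x i[%classic : set (measurableTypeR R)).
      exact: measurable_itv.
    have /esym pE := product_measure1E (gamma (s i)) mu mI (mcyl (fun l => l != i)).
    apply: (etrans pE).
    congr (_ _); apply/seteqP; split => [[z e] /= [h1 h2] l lm|[z e] /= h].
      have [->|li] := eqVneq l i; first by rewrite /upd_pair upd_eq; move: h1; rewrite /= in_itv.
      by rewrite /upd_pair upd_neq// h2.
    split => /=; first by have := h i im; rewrite /upd_pair upd_eq in_itv.
    by move=> l lm li; have := h l lm; rewrite /upd_pair upd_neq.
  transitivity ((gamma (s i) \x mu) (setT `*`
      [set e : seqR R | forall l, (l < m)%N -> (e l < x l)%R]))%E.
    rewrite product_measure1E//; last first.
      have := mcyl xpredT; congr (measurable _); apply/seteqP.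
      by split => e /= h l lm; [apply: h|move=> _; apply: h].
    by rewrite [X in _ = (X * _)%E](_ : _ = 1%E) ?mul1e//; exact: probability_setT.
  congr (_ _); apply/seteqP; split => [[z e] /= [_ h2] l lm|[z e] /= h].
    by rewrite /upd_pair upd_neq ?h2// neq_ltn (leq_trans lm mi).
  split => //= l lm; have := h l lm; rewrite /upd_pair upd_neq//.
  by rewrite neq_ltn (leq_trans lm mi).
- by move=> _; rewrite -[X in (X < _)%E]/(mu setT) probability_setT ltry.
Qed.

Lemma resampling_ge0 (mu : probability (seqR R) R) (s : nat -> R) (i : nat) (F : seqR R -> \bar R) :
  resampling mu s -> measurable_fun setT F -> (forall e, 0 <= F e)%E ->
  (\int[mu]_e F e = \int[mu]_e \int[gamma (s i)]_x F (upd e i x))%E.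
Proof.
move=> rs mF F0.
pose nu0 : {measure set (seqR R) -> \bar R} :=
  pushforward (gamma (s i) \x mu)%E (upd_pair i).
pose nu := nu0 (measurable_upd i).
transitivity (\int[nu]_e F e)%E.
  by apply: eq_measure_integral => A mA _; exact: rs.
rewrite ge0_integral_pushforward//.
rewrite (fubini_tonelli2 (F \o upd_pair i))//.
  exact: (measurableT_comp mF (measurable_upd i)).
by move=> p; apply: F0.
Qed.

(** Conditioning on all coordinates but [i], by Fubini. Integrability of every section makes the
    inner integral an honest real number everywhere. *)
Lemma resampling_E (mu : probability (seqR R) R) (s : nat -> R) (i : nat) (F : seqR R -> R) :
  resampling mu s -> integ mu F ->
  (forall e, integ (gamma (s i)) (fun x => F (upd e i x))) ->
  integ mu (fun e => \int[gamma (s i)]_x F (upd e i x)) /\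
  \int[mu]_e F e = \int[mu]_e (\int[gamma (s i)]_x F (upd e i x)).
Proof.
move=> rs iF iFx; have mF := integ_meas iF.
have mFP : measurable_fun setT (fun p : measurableTypeR R * seqR R => (F (upd p.2 i p.1))%:E).
  apply/measurable_EFinP; apply: (measurableT_comp mF); exact: measurable_upd.
have iFP : ((gamma (s i) \x mu)%E).-integrable setT
    (fun p : measurableTypeR R * seqR R => (F (upd p.2 i p.1))%:E).
  apply/(integrable21ltyP _ _ mFP) => /=.
  rewrite -(@resampling_ge0 mu s i (fun e => `|F e|%:E)%E)//.
    by case/integrableP : iF.
  by apply/measurable_EFinP; exact: measurableT_comp.
have innerE e : (\int[gamma (s i)]_x (F (upd e i x))%:E =
    (\int[gamma (s i)]_x F (upd e i x))%:E)%E by rewrite E_fine.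
have iG' : integ mu (fun e => \int[gamma (s i)]_x F (upd e i x)).
  have mG := measurable_fubini_G iFP.
  apply/integrableP; split.
    rewrite [X in measurable_fun _ X](_ : _ = fubini_G (gamma (s i))
      (fun p : measurableTypeR R * seqR R => (F (upd p.2 i p.1))%:E))//.
    by apply/funext => e /=; rewrite -innerE.
  apply: le_lt_trans ((integrable21ltyP _ _ mFP).1 iFP).
  apply: ge0_le_integral => //.
  - apply: measurableT_comp => //.
    rewrite [X in measurable_fun _ X](_ : _ = fubini_G (gamma (s i))
      (fun p : measurableTypeR R * seqR R => (F (upd p.2 i p.1))%:E))//.
    by apply/funext => e /=; rewrite -innerE.
  - have mabs : measurable_fun setT (fun p : measurableTypeR R * seqR R =>
      `|(F (upd p.2 i p.1))%:E|%E) by exact: measurableT_comp.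
    exact: (@measurable_fun_fubini_tonelli_G _ _ _ _ R (gamma (s i)) _ mabs
      (fun=> abse_ge0 _)).
  - move=> e _.
    change (`|(\int[gamma (s i)]_x F (upd e i x))%:E| <=
      \int[gamma (s i)]_x `|(F (upd e i x))%:E|)%E.
    rewrite -innerE; apply: le_abse_integral => //.
    by case/integrableP : (iFx e).
split => //; rewrite /Rintegral; congr fine.
transitivity (\int[mu]_e \int[gamma (s i)]_x (F (upd e i x))%:E)%E; last first.
  by apply: eq_integral => e _; rewrite innerE.
have := integral21_prod_meas1 iFP; rewrite /fubini_G /= => ->.
pose nu0 : {measure set (seqR R) -> \bar R} :=
  pushforward (gamma (s i) \x mu)%E (upd_pair i).
pose nu := nu0 (measurable_upd i).
transitivity (\int[nu]_e (F e)%:E)%E.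
  by apply: eq_measure_integral => A mA _; exact: rs.
by rewrite integral_pushforward//; exact/measurable_EFinP.
Qed.

Lemma resampling_ibp (mu : probability (seqR R) R) (s : nat -> R) (i : nat)
    (F F' : seqR R -> R) : resampling mu s -> s i != 0 ->
  (forall (e : seqR R) (x : R), is_derive x 1 (fun x => F (upd e i x)) (F' (upd e i x))) ->
  (forall e : seqR R, continuous (fun x : R => F' (upd e i x))) ->
  (forall e : seqR R, exists C : R, forall x,
     `|F (upd e i x)| <= C * expR `|x| /\ `|F' (upd e i x)| <= C * expR `|x|) ->
  integ mu (fun e => e i * F e) -> integ mu F' ->
  \int[mu]_e (e i * F e) = s i ^+ 2 * \int[mu]_e F' e.
Proof.
move=> rs si dF cF' growth iF iF'.
have cF e : continuous (fun x : R => F (upd e i x)).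
  move=> x; apply: differentiable_continuous; apply/derivable1_diffP.
  by have [] := dF e x.
have iF'x e : integ (gamma (s i)) (fun x => F' (upd e i x)).
  have [C HC] := growth e.
  have B x : `|F' (upd e i x)| <= C * expR (1 * `|x|) by rewrite mul1r; have [] := HC x.
  apply: (integ_gauss_growth si _ B).
  by apply: continuous_measurable_fun; exact: cF'.
have ixF e : integ (gamma (s i)) (fun x => upd e i x i * F (upd e i x)).
  have [C HC] := growth e.
  have B (x : R) : `|upd e i x i * F (upd e i x)| <= C * expR (2 * `|x|).
    rewrite upd_eq normrM (_ : 2 * `|x| = `|x| + `|x|) ?expRD; last by ring.
    rewrite mulrA [leRHS]mulrC; apply: ler_pM => //; last by have [] := HC x.
    by apply: le_trans (expR_ge1Dx _); rewrite lerDr.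
  apply: (integ_gauss_growth si _ B).
  apply: continuous_measurable_fun => x.
  have -> : (fun x => upd e i x i * F (upd e i x)) = (fun x => x * F (upd e i x)).
    by apply/funext => y; rewrite upd_eq.
  by apply: cvgM; [exact: cvg_id|exact: cF].
have [i1 ->] := resampling_E rs iF ixF.
have [i2 ->] := resampling_E rs iF' iF'x.
rewrite -EZ//; apply: eq_Rintegral => e _.
have [C HC] := growth e.
rewrite -(@gauss_ibp _ (s i) C (fun x => F (upd e i x)))//.
- by apply: eq_Rintegral => x _; rewrite upd_eq.
- by move=> x; have [] := HC x.
- by move=> x; have [] := HC x.
Qed.

End sequence_space.

(** * Random variables with moments of all orders *)

(** This class is closed under sums and products, so integrability of any polynomial in the noise
    becomes structural. *)
Definition allmom d (T : measurableType d) (R : realType) (P : probability T R)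
    (Y : T -> R) :=
  measurable_fun setT Y /\ forall k, integ P (fun x => `|Y x| ^+ k).

Section all_moments.
Context d (T : measurableType d) (R : realType) (P : probability T R).
Implicit Types Y Z : T -> R.

Lemma allmom_meas Y : allmom P Y -> measurable_fun setT Y.
Proof. by case. Qed.

Lemma allmom_integ Y : allmom P Y -> integ P Y.
Proof. by case=> mY /(_ 1%N) iY; apply: (integ_le mY iY) => x; rewrite expr1. Qed.

Lemma allmom_cst (k : R) : allmom P (fun=> k).
Proof. by split; [exact: measurable_cst|move=> n; exact: integ_cst]. Qed.

Lemma allmom_le Y Z : measurable_fun setT Z -> allmom P Y ->
  (forall x, `|Z x| <= `|Y x|) -> allmom P Z.
Proof.
move=> mZ [mY iY] ZY; split => // k.
apply: (integ_le _ (iY k)); last first.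
  by move=> x; rewrite ger0_norm ?exprn_ge0// lerXn2r ?nnegrE.
by apply: measurable_funX; exact: measurableT_comp.
Qed.

Lemma allmom_norm Y : allmom P Y -> allmom P (fun x => `|Y x|).
Proof.
move=> aY; apply: (allmom_le _ aY) => [|x]; last by rewrite normr_id.
by apply: measurableT_comp => //; case: aY.
Qed.

Lemma allmomM Y Z : allmom P Y -> allmom P Z -> allmom P (fun x => Y x * Z x).
Proof.
move=> [mY iY] [mZ iZ]; split; first exact: measurable_funM.
move=> k; apply: (integ_le _ (integD (iY (k * 2)%N) (iZ (k * 2)%N))).
  by apply: measurable_funX; apply: measurableT_comp => //; exact: measurable_funM.
move=> x; rewrite ger0_norm ?exprn_ge0// normrM exprMn !exprM.
have := sqr_ge0 (`|Y x| ^+ k - `|Z x| ^+ k).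
have := sqr_ge0 (`|Y x| ^+ k); have := sqr_ge0 (`|Z x| ^+ k).
set a := `|Y x| ^+ k; set b := `|Z x| ^+ k; nra.
Qed.

Lemma allmomD Y Z : allmom P Y -> allmom P Z -> allmom P (fun x => Y x + Z x).
Proof.
move=> [mY iY] [mZ iZ]; split; first exact: measurable_funD.
move=> k; apply: (integ_le _ (integZ (2 ^+ k) (integD (iY k) (iZ k)))).
  by apply: measurable_funX; apply: measurableT_comp => //; exact: measurable_funD.
move=> x; rewrite ger0_norm ?exprn_ge0//.
wlog YZ : Y Z {mY iY mZ iZ} / `|Y x| <= `|Z x|.
  move=> H; have [|/ltW] := leP `|Y x| `|Z x|; first exact: H.
  by rewrite addrC [X in _ * X]addrC; exact: H.
apply: (@le_trans _ _ ((2 * `|Z x|) ^+ k)).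
  rewrite lerXn2r ?nnegrE ?mulr_ge0//.
  by apply: le_trans (ler_normD _ _) _; lra.
by rewrite exprMn ler_wpM2l ?exprn_ge0// lerDr exprn_ge0.
Qed.

Lemma allmomZ (k : R) Y : allmom P Y -> allmom P (fun x => k * Y x).
Proof. by move=> aY; apply: allmomM => //; exact: allmom_cst. Qed.

Lemma allmomB Y Z : allmom P Y -> allmom P Z -> allmom P (fun x => Y x - Z x).
Proof.
move=> aY aZ; apply: allmomD => //.
rewrite [X in allmom _ X](_ : _ = fun x => -1 * Z x); first exact: allmomZ.
by apply/funext => x; rewrite mulN1r.
Qed.

Lemma allmomX n Y : allmom P Y -> allmom P (fun x => Y x ^+ n).
Proof.
move=> aY; elim: n => [|n ih].
  by under eq_fun do rewrite expr0; exact: allmom_cst.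
by under eq_fun do rewrite exprS; exact: allmomM.
Qed.

Lemma allmom_sum n (F : nat -> T -> R) : (forall i, (i < n)%N -> allmom P (F i)) ->
  allmom P (fun x => \sum_(i < n) F i x).
Proof.
elim: n => [|n ih] aF.
  by under eq_fun do rewrite big_ord0; exact: allmom_cst.
under eq_fun do rewrite big_ord_recr /=.
by apply: allmomD; [apply: ih => i /ltnW; exact: aF|exact: aF].
Qed.

Lemma allmom_bounded (k : R) Y : measurable_fun setT Y -> (forall x, `|Y x| <= k) ->
  allmom P Y.
Proof.
move=> mY Yk; apply: (allmom_le mY (allmom_cst k)) => x.
exact: le_trans (Yk x) (ler_norm _).
Qed.

Lemma allmom_growth (f : R -> R) (C : R) n Y : measurable_fun setT f ->
  (forall y, `|f y| <= C * (1 + `|y| ^+ n)) -> allmom P Y ->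
  allmom P (fun x => f (Y x)).
Proof.
move=> mf fC aY.
apply: (@allmom_le (fun x => C * (1 + `|Y x| ^+ n))).
- by apply: measurableT_comp => //; exact: allmom_meas.
- apply: allmomZ; apply: allmomD; first exact: allmom_cst.
  exact/allmomX/allmom_norm.
- by move=> x; apply: le_trans (fC _) (ler_norm _).
Qed.

End all_moments.

(** * Gaussian moments and linear combinations under [resampling] *)

Section resampling_moments.
Context (R : realType) (mu : probability (seqR R) R) (s : nat -> R).
Hypotheses (rs : resampling mu s) (s0 : forall i, s i != 0).
Notation gamma s := (@normal_prob R 0 s).

Lemma powr_le_exp (k : nat) (x : R) : `|x| ^+ k <= k`!%:R * expR `|x|.
Proof.
case: k => [|k]; first by rewrite expr0 mul1r; apply: le_trans (expR_ge1Dx _); rewrite lerDl.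
have := @expR_ge1Dxn R `|x| k (normr_ge0 _).
set q := `|x| ^+ k.+1 / _ => h.
have -> : `|x| ^+ k.+1 = (k.+1)`!%:R * q.
  by rewrite /q mulrC divfK// pnatr_eq0 -lt0n fact_gt0.
by rewrite ler_wpM2l//; lra.
Qed.

Lemma allmom_coord i : allmom mu (fun e : seqR R => e i : R).
Proof.
split; first exact: measurable_coord.
move=> k.
have mk : measurable_fun setT (fun e : seqR R => `|e i : R| ^+ k).
  by apply: measurable_funX; apply: measurableT_comp => //; exact: measurable_coord.
apply/integrableP; split; first exact/measurable_EFinP.
rewrite (resampling_ge0 i rs)//; last first.
  by apply: measurableT_comp => //; exact/measurable_EFinP.
have ik : integ (gamma (s i)) (fun x : R => `|x| ^+ k).
  have B (x : R) : Num.norm (Num.norm x ^+ k) <= (k`!%:R) * expR (1 * `|x|).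
    by rewrite mul1r ger0_norm ?exprn_ge0// powr_le_exp.
  apply: (integ_gauss_growth (s0 i) _ B).
  by apply: measurable_funX; exact: normr_measurable.
have /integrableP[_ h] := ik.
under eq_integral do under eq_integral do rewrite /= upd_eq.
by rewrite integral_cst//= probability_setT mule1.
Qed.

Lemma is_derive_pow (k : nat) (x : R) :
  is_derive x 1 (fun y : R => y ^+ k) (k%:R * x ^+ k.-1).
Proof.
elim: k => [|k ih].
  rewrite mul0r [X in is_derive _ _ X _](_ : _ = cst 1); first exact: is_derive_cst.
  by apply/funext => y; rewrite expr0.
rewrite [X in is_derive _ _ X _](_ : _ = fun y : R => y * y ^+ k); last first.
  by apply/funext => y; rewrite exprS.
apply: is_derive_eq; rewrite /GRing.scale/=.
by case: k {ih} => [|k] /=; rewrite ?exprS; ring.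
Qed.

(** The moment recursion of the normal law, by parts on [e i ^+ k * Y e], where [Y] is constant in
    coordinate [i]. At [k = 0] the truncated predecessor is multiplied by 0. *)
Lemma resampling_pow i k (Y : seqR R -> R) : allmom mu Y ->
  (forall e x, Y (upd e i x) = Y e) ->
  \int[mu]_e (e i ^+ k.+1 * Y e) = s i ^+ 2 * (k%:R * \int[mu]_e (e i ^+ k.-1 * Y e)).
Proof.
move=> aY Yi.
have ac := allmom_coord i.
have iF' : integ mu (fun e : seqR R => e i ^+ k.-1 * Y e).
  by apply: allmom_integ; apply: allmomM => //; exact: allmomX.
rewrite -EZ//.
transitivity (\int[mu]_e (e i * (e i ^+ k * Y e))).
  by apply: eq_Rintegral => e _; rewrite mulrA exprS.
apply: (@resampling_ibp R mu s i (fun e => e i ^+ k * Y e)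
  (fun e => k%:R * (e i ^+ k.-1 * Y e))) => //.
- move=> e x.
  rewrite [X in is_derive _ _ X _](_ : _ = fun x : R => x ^+ k * Y e); last first.
    by apply/funext => y; rewrite upd_eq Yi.
  have d1 := is_derive_pow k x.
  by rewrite upd_eq Yi; apply: is_derive_eq; rewrite /GRing.scale/=; ring.
- move=> e x.
  rewrite [X in continuous_at _ X](_ : _ = fun x : R => k%:R * (x ^+ k.-1 * Y e)); last first.
    by apply/funext => y; rewrite upd_eq Yi.
  apply: cvgM; first exact: cvg_cst.
  by apply: cvgM; [exact: exprn_continuous|exact: cvg_cst].
- move=> e; exists ((k`!%:R + k%:R * (k.-1)`!%:R) * `|Y e|) => x.
  rewrite !upd_eq !Yi !normrM normr_nat !normrX.
  have h1 := powr_le_exp k x; have h2 := powr_le_exp k.-1 x.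
  have f1 : 0 <= k`!%:R :> R by rewrite ler0n.
  have f2 : 0 <= k.-1`!%:R :> R by rewrite ler0n.
  have k0 : 0 <= k%:R :> R by rewrite ler0n.
  have Y0 := normr_ge0 (Y e); have e0 := expR_ge0 `|x|.
  split.
    rewrite mulrAC ler_wpM2r// mulrDl; apply: le_trans h1 _.
    by rewrite lerDl !mulr_ge0.
  rewrite mulrA [leRHS]mulrAC ler_wpM2r// mulrDl -mulrA.
  apply: le_trans (_ : k%:R * (k.-1`!%:R * expR `|x|) <= _).
    by rewrite ler_wpM2l.
  by rewrite mulrA lerDr mulr_ge0.
- by apply: allmom_integ; apply: allmomM => //; apply: allmomM => //; exact: allmomX.
- exact: integZ.
Qed.

Lemma resampling_E1 i (Y : seqR R -> R) : allmom mu Y ->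
  (forall e x, Y (upd e i x) = Y e) -> \int[mu]_e (e i * Y e) = 0.
Proof.
move=> aY Yi; have := resampling_pow 0 aY Yi; rewrite mul0r mulr0 => <-.
by apply: eq_Rintegral => e _; rewrite expr1.
Qed.

Lemma resampling_E2 i (Y : seqR R -> R) : allmom mu Y ->
  (forall e x, Y (upd e i x) = Y e) ->
  \int[mu]_e (e i ^+ 2 * Y e) = s i ^+ 2 * \int[mu]_e Y e.
Proof.
move=> aY Yi; rewrite (resampling_pow 1 aY Yi) mul1r; congr (_ * _).
by apply: eq_Rintegral => e _; rewrite expr0 mul1r.
Qed.

Lemma resampling_E3 i (Y : seqR R -> R) : allmom mu Y ->
  (forall e x, Y (upd e i x) = Y e) -> \int[mu]_e (e i ^+ 3 * Y e) = 0.
Proof.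
move=> aY Yi; rewrite (resampling_pow 2 aY Yi) /=.
rewrite [X in _ * (_ * X)](_ : _ = 0) ?mulr0//.
by rewrite -[RHS](resampling_E1 aY Yi); apply: eq_Rintegral => e _; rewrite expr1.
Qed.

Lemma resampling_E4 i (Y : seqR R -> R) : allmom mu Y ->
  (forall e x, Y (upd e i x) = Y e) ->
  \int[mu]_e (e i ^+ 4 * Y e) = 3 * s i ^+ 4 * \int[mu]_e Y e.
Proof.
move=> aY Yi; rewrite (resampling_pow 3 aY Yi) /= resampling_E2//.
by ring.
Qed.

(** Stein's equation replaces a convolution of densities. Summing integration by parts over the
    coordinates of [U] gives [E[U f(U) Psi] = v^2 E[f'(U) Psi]]; for the solution [f] attached to
    [h] this says that [h(U)] minus its Gaussian mean is orthogonal to [Psi]. *)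
Lemma resampling_sum_law (c : nat -> R) (a K : nat) (v L : R) (h : R -> R)
    (Psi : seqR R -> R) :
  0 < v -> v ^+ 2 = \sum_(j < K) (c j * s (a + j)%N) ^+ 2 -> 0 < L ->
  (forall x y, `|h x - h y| <= L * `|x - y|) ->
  measurable_fun setT Psi -> (forall e, `|Psi e| <= 1) ->
  (forall j e x, (j < K)%N -> Psi (upd e (a + j)%N x) = Psi e) ->
  \int[mu]_e (h (\sum_(j < K) c j * e (a + j)%N) * Psi e) =
  (\int[gamma v]_x h x) * \int[mu]_e Psi e.
Proof.
move=> v0 vE L0 hL mPsi Psi1 PsiJ.
have vn0 : v != 0 by rewrite gt_eqF.
pose U (e : seqR R) := \sum_(j < K) c j * e (a + j)%N.
have aU : allmom mu U.
  apply: (@allmom_sum _ _ _ _ _ (fun j (e : seqR R) => c j * e (a + j)%N)) => j _.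
  by apply: allmomZ; exact: allmom_coord.
have aPsi : allmom mu Psi by exact: allmom_bounded Psi1.
have [f [f' [df cf' f'C eqn]]] := stein_solution v0 L0 hL.
pose C := stein_cst R * L / v.
have C0 : 0 <= C by exact: le_trans (f'C 0).
have flip := derive_bounded_lip df f'C.
have cf : continuous f.
  move=> x; apply: differentiable_continuous; apply/derivable1_diffP.
  by have [] := df x.
have fgr x : `|f x| <= (`|f 0| + C) * (1 + `|x| ^+ 1).
  have := flip x 0; rewrite subr0 -/C => fx.
  have : `|f x| <= `|f x - f 0| + `|f 0|.
    by apply: le_trans (ler_normD _ _); rewrite subrK.
  by rewrite expr1; have := normr_ge0 x; have := normr_ge0 (f 0); nra.
have f'gr x : `|f' x| <= C * (1 + `|x| ^+ 0).
  by rewrite expr0; apply: le_trans (f'C x) _; rewrite -/C; lra.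
have afU : allmom mu (fun e => f (U e)).
  by apply: (allmom_growth _ fgr aU); exact: continuous_measurable_fun.
have af'U : allmom mu (fun e => f' (U e)).
  by apply: (allmom_growth _ f'gr aU); exact: continuous_measurable_fun.
have Uupd (j : 'I_K) (e : seqR R) (x : R) : U (upd e (a + j)%N x) = U (upd e (a + j)%N 0) + c j * x.
  rewrite /U (bigD1 j)//= [in RHS](bigD1 j)//= !upd_eq mulr0 add0r addrC.
  congr (_ + _); apply: eq_bigr => l lj.
  by rewrite !upd_neq// eqn_add2l.
have ibp (j : 'I_K) : \int[mu]_e (e (a + j)%N * (f (U e) * Psi e)) =
    s (a + j)%N ^+ 2 * \int[mu]_e (c j * (f' (U e) * Psi e)).
  apply: (@resampling_ibp R mu s (a + j)%N (fun e => f (U e) * Psi e)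
    (fun e => c j * (f' (U e) * Psi e))) => //.
  - move=> e x.
    rewrite [X in is_derive _ _ X _](_ : _ =
      fun x : R => (f \o (fun x => U (upd e (a + j)%N 0) + c j * x)) x * Psi e); last first.
      by apply/funext => y /=; rewrite PsiJ// -Uupd.
    have d1 : is_derive x 1 (fun x : R => U (upd e (a + j)%N 0) + c j * x) (c j).
      by apply: is_derive_eq; rewrite /GRing.scale/=; ring.
    have d2 := df (U (upd e (a + j)%N 0) + c j * x).
    have d3 : is_derive x 1 (f \o (fun x => U (upd e (a + j)%N 0) + c j * x))
      (f' (U (upd e (a + j)%N 0) + c j * x) * c j) by exact: is_derive1_comp.
    apply: is_derive_eq; rewrite PsiJ// -Uupd /GRing.scale/=; ring.
  - move=> e.
    rewrite [X in continuous X](_ : _ =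
      fun x : R => c j * (f' (U (upd e (a + j)%N 0) + c j * x) * Psi e)); last first.
      by apply/funext => y /=; rewrite PsiJ// -Uupd.
    move=> x; apply: cvgM; first exact: cvg_cst.
    apply: cvgM; last exact: cvg_cst.
    apply: (@continuous_comp _ _ _ (fun x : R => U (upd e (a + j)%N 0) + c j * x) f').
      by apply: cvgD; [exact: cvg_cst|apply: cvgM; [exact: cvg_cst|exact: cvg_id]].
    exact: cf'.
  - move=> e; set B := U (upd e (a + j)%N 0).
    exists ((`|f 0| + C) * (1 + `|B| + `|c j|) + `|c j| * C) => x.
    have e1 : 1 <= expR `|x| by apply: le_trans (expR_ge1Dx _); rewrite lerDl.
    have e2 : `|x| <= expR `|x| by apply: le_trans (expR_ge1Dx _); rewrite lerDr.
    have F0 : 0 <= `|f 0| + C by rewrite addr_ge0.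
    have B0 := normr_ge0 B; have c0 := normr_ge0 (c j); have x0 := normr_ge0 x.
    have BC : `|B + c j * x| <= `|B| + `|c j| * `|x|.
      by apply: le_trans (ler_normD _ _) _; rewrite normrM.
    have fB : `|f (B + c j * x)| <= (`|f 0| + C) * (1 + `|B| + `|c j|) * expR `|x|.
      apply: le_trans (fgr _) _; rewrite -mulrA ler_wpM2l// expr1.
      by nra.
    have P1 (y : R) : `|y * Psi (upd e (a + j)%N x)| <= `|y|.
      by rewrite normrM ler_piMr.
    have T1 : 0 <= (`|f 0| + C) * (1 + `|B| + `|c j|) by rewrite mulr_ge0// !addr_ge0.
    have T2 : 0 <= `|c j| * C by rewrite mulr_ge0.
    rewrite Uupd -/B; split.
      apply: le_trans (P1 _) _; apply: le_trans fB _.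
      by rewrite ler_wpM2r ?expR_ge0// lerDl.
    rewrite normrM; apply: le_trans (ler_wpM2l _ (P1 _)) _ => //.
    have : `|c j| * `|f' (B + c j * x)| <= `|c j| * C by rewrite ler_wpM2l.
    move=> /le_trans; apply.
    apply: (@le_trans _ _ (`|c j| * C * expR `|x|)); first by rewrite ler_peMr.
    by rewrite ler_wpM2r ?expR_ge0// lerDr.
  - by apply: allmom_integ; apply: allmomM; [exact: allmom_coord|exact: allmomM].
  - by apply: allmom_integ; apply: allmomZ; exact: allmomM.
have iUf : allmom mu (fun e => U e * f (U e) * Psi e) by apply: allmomM => //; exact: allmomM.
have ivf' : allmom mu (fun e => v ^+ 2 * (f' (U e) * Psi e)) by apply: allmomZ; exact: allmomM.
have E1 : \int[mu]_e (U e * f (U e) * Psi e) = \int[mu]_e (v ^+ 2 * (f' (U e) * Psi e)).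
  transitivity (\sum_(j < K) \int[mu]_e (c j * (e (a + j)%N * (f (U e) * Psi e)))).
    rewrite -E_sum.
      by apply: eq_Rintegral => e _; rewrite /U -mulrA big_distrl/=; apply: eq_bigr => j _; rewrite -mulrA.
    move=> j; apply: allmom_integ; apply: allmomZ; apply: allmomM; first exact: allmom_coord.
    exact: allmomM.
  rewrite EZ; last by apply: allmom_integ; exact: allmomM.
  rewrite vE big_distrl/=; apply: eq_bigr => j _.
  rewrite EZ; last first.
    by apply: allmom_integ; apply: allmomM; [exact: allmom_coord|exact: allmomM].
  rewrite ibp EZ; last by apply: allmom_integ; exact: allmomM.
  by ring.
set m := \int[gamma v]_x h x.
have ihU : integ mu (fun e => h (U e) * Psi e).
  apply: allmom_integ.
  rewrite [X in allmom _ X](_ : _ = fun e => v ^+ 2 * (f' (U e) * Psi e) - U e * f (U e) * Psi e + m * Psi e).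
    by apply: allmomD; [exact: allmomB|exact: allmomZ].
  apply/funext => e; have := eqn (U e); rewrite -/m => eqU.
  by rewrite (_ : h (U e) = v ^+ 2 * f' (U e) - U e * f (U e) + m); [ring|lra].
apply/eqP; rewrite -subr_eq0 -EZ; last exact: allmom_integ.
rewrite -EB//; last by apply: integZ; exact: allmom_integ.
apply/eqP.
transitivity (\int[mu]_e (v ^+ 2 * (f' (U e) * Psi e) - U e * f (U e) * Psi e)).
  apply: eq_Rintegral => e _; have := eqn (U e); rewrite -/m => eqU.
  by rewrite -mulrBl -eqU; ring.
by rewrite EB ?E1 ?subrr//; exact: allmom_integ.
Qed.

End resampling_moments.

(** * Riemann sums along a path *)

Section paths.
Context (R : realType).
Notation leb := (@lebesgue_measure R).

Lemma segment_unif_continuous (f : R -> R) (a b e : R) :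
  {within `[a, b], continuous f} -> 0 < e ->
  exists2 dl : R, 0 < dl & forall u v, a <= u <= b -> a <= v <= b ->
    `|u - v| < dl -> `|f u - f v| < e.
Proof.
move=> cf e0.
pose Q (dl : R) (x : R) := a <= x <= b -> forall y, a <= y <= b ->
  `|x - y| < dl -> `|f x - f y| < e.
have /compact_near_coveringP ncov := @segment_compact R a b.
have : \forall dl \near (0 : R)^'+, forall x, `[a, b]%classic x -> Q dl x.
  apply: ncov => x abx.
  have /subspace_continuousP /(_ x abx) := cf.
  move=> /cvgrPdist_lt /(_ (e / 2)); rewrite divr_gt0// => /(_ isT).
  rewrite near_withinE => -[d /= d0 Hd].
  have d2 : 0 < d / 2 by rewrite divr_gt0.
  near=> x' dl => abx' y aby xy.
  have xx' : `|x - x'| < d / 2.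
    by near: x'; exists (d / 2).
  have dld : dl < d / 2.
    by near: dl; exact: nbhs_right_lt.
  have h1 : `|f x - f x'| < e / 2.
    apply: (Hd x'); last by rewrite /= in_itv.
    by rewrite /=; apply: lt_trans xx' _; rewrite ltr_pdivrMr// ltr_pMr// ltr1n.
  have h2 : `|f x - f y| < e / 2.
    apply: (Hd y); last by rewrite /= in_itv.
    rewrite /=; have -> : x - y = (x - x') + (x' - y) by ring.
    apply: le_lt_trans (ler_normD _ _) _.
    have := lt_trans xy dld; lra.
  have -> : f x' - f y = (f x - f y) - (f x - f x') by ring.
  apply: le_lt_trans (ler_normB _ _) _; lra.
move=> [dl /= dl0 Hdl].
have d2 : 0 < dl / 2 by rewrite divr_gt0.
have d3 : ball_ [eta Num.norm] 0 dl (dl / 2).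
  by rewrite /= sub0r normrN gtr0_norm// ltr_pdivrMr// ltr_pMr// ltr1n.
exists (dl / 2) => // u v abu abv uv.
by apply: (Hdl _ d3 d2 u) => //=; rewrite in_itv.
Unshelve. all: end_near. Qed.

Lemma Rintegral_osc (f : R -> R) (r r' m ep : R) : r <= r' ->
  {within `[r, r'], continuous f} ->
  (forall u, r <= u <= r' -> `|f u - m| <= ep) ->
  `|\int[leb]_(u in `[r, r']) f u - (r' - r) * m| <= ep * (r' - r).
Proof.
move=> rr' cf fm.
have mI : measurable (`[r, r']%classic : set (measurableTypeR R)) by exact: measurable_itv.
have iff : leb.-integrable `[r, r'] (EFin \o f).
  by apply: continuous_compact_integrable => //; exact: segment_compact.
have ic (k : R) : leb.-integrable `[r, r'] (EFin \o cst k).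
  apply: continuous_compact_integrable; first exact: segment_compact.
  by apply: continuous_subspaceT => x; exact: cvg_cst.
have len : fine (leb `[r, r']%classic) = r' - r.
  rewrite lebesgue_measure_itv/= lte_fin.
  by case: ltgtP rr' => //= rr' _; rewrite rr' subrr.
have cstE (k : R) : \int[leb]_(u in `[r, r']) k = k * (r' - r).
  by rewrite Rintegral_cst// len.
have -> : (r' - r) * m = \int[leb]_(u in `[r, r']) m by rewrite cstE mulrC.
rewrite -RintegralB//; last exact: ic.
have ifm : leb.-integrable `[r, r'] (EFin \o (fun u => f u - m)).
  exact: (integrableB mI iff (ic m)).
apply: le_trans (le_normr_Rintegral mI ifm) _.
rewrite -cstE; apply: le_Rintegral => //.
- exact: (integrable_norm ifm).
- exact: ic.
Qed.

Lemma expR_increment (theta r r' : R) : 0 < theta -> r <= r' ->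
  theta * (r' - r) * expR (theta * r) <= expR (theta * r') - expR (theta * r)
    <= theta * (r' - r) * expR (theta * r').
Proof.
move=> th0 rr'.
have d0 : 0 <= theta * (r' - r) by rewrite mulr_ge0 ?subr_ge0// ltW.
have e1 : expR (theta * r') = expR (theta * (r' - r)) * expR (theta * r).
  by rewrite -expRD; congr expR; ring.
have e2 : expR (theta * r) = expR (- (theta * (r' - r))) * expR (theta * r').
  by rewrite -expRD; congr expR; ring.
apply/andP; split.
  rewrite e1 -[X in _ <= _ - X]mul1r -mulrBl ler_wpM2r ?expR_ge0//.
  by rewrite lerBrDl; exact: expR_ge1Dx.
rewrite e2 -[X in X - _ <= _]mul1r -mulrBl ler_wpM2r ?expR_ge0//.
rewrite lerBlDr -lerBlDl; exact: expR_ge1Dx.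
Qed.

(** Along a path of the equation, [exp (theta u) dW_u] is the differential of [exp (theta u) X_u].
    The error on one piece is its length times a quantity that vanishes with the mesh, so it stays
    negligible after summation. *)
Lemma path_step (theta r r' T ep M cc : R) (x w : R -> R) :
  0 < theta -> 0 <= r -> r <= r' -> r' <= T ->
  {within `[r, r'], continuous x} ->
  x r' - x r = - theta * (\int[leb]_(u in `[r, r']) x u) + (w r' - w r) ->
  (forall u, r <= u <= r' -> `|x u - x r'| <= ep) -> `|x r'| <= M ->
  expR (theta * r) <= cc <= expR (theta * r') ->
  `|cc * (w r' - w r) - (expR (theta * r') * x r' - expR (theta * r) * x r)| <=
  (r' - r) * (theta * expR (theta * T) * (2 * ep + theta * (r' - r) * M)).
Proof.
move=> th0 r0 rr' r'T cx eqn osc xM /andP[c1 c2].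
have d0 : 0 <= r' - r by rewrite subr_ge0.
have /andP[i1 i2] := expR_increment th0 rr'.
have := Rintegral_osc rr' cx osc.
set I := \int[leb]_(u in `[r, r']) x u in eqn *; move=> hI.
set E := expR (theta * r) in c1 i1 i2 *; set E' := expR (theta * r') in c2 i1 i2 *.
set ET := expR (theta * T).
have E0 : 0 < E by exact: expR_gt0.
have ET0 : 0 < ET by exact: expR_gt0.
have E'T : E' <= ET by rewrite ler_expR ler_wpM2l// ltW.
have wE : w r' - w r = x r' - x r + theta * I by rewrite eqn; ring.
have -> : cc * (w r' - w r) - (E' * x r' - E * x r) =
    (cc - E) * (x r' - x r) + cc * theta * (I - (r' - r) * x r') +
    (cc * theta * (r' - r) - (E' - E)) * x r' by rewrite wE; ring.
have ep0 : 0 <= ep by apply: le_trans (osc r' _); rewrite ?rr' ?lexx.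
have M0 : 0 <= M by exact: le_trans xM.
have thd : 0 <= theta * (r' - r) by rewrite mulr_ge0// ltW.
have EE' : E' - E <= theta * (r' - r) * ET.
  by apply: le_trans i2 _; rewrite ler_wpM2l.
have b1 : `|(cc - E) * (x r' - x r)| <= theta * (r' - r) * ET * ep.
  rewrite normrM; apply: ler_pM => //.
    by rewrite ger0_norm ?subr_ge0//; apply: le_trans EE'; rewrite lerD2r.
  by rewrite distrC; apply: osc; rewrite lexx.
have b2 : `|cc * theta * (I - (r' - r) * x r')| <= ET * theta * (ep * (r' - r)).
  rewrite normrM; apply: ler_pM => //.
  rewrite ger0_norm; last by rewrite mulr_ge0 ?(ltW th0)// (le_trans (ltW E0)).
  by rewrite ler_wpM2r ?(ltW th0)// (le_trans c2).
have b3 : `|(cc * theta * (r' - r) - (E' - E)) * x r'| <=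
    theta * (r' - r) * (theta * (r' - r) * ET) * M.
  rewrite normrM; apply: ler_pM => //.
  have : `|cc * theta * (r' - r) - (E' - E)| <= theta * (r' - r) * (E' - E).
    rewrite ler_norml; apply/andP; split; nra.
  move=> /le_trans; apply; by rewrite ler_wpM2l.
apply: le_trans (ler_normD _ _) _.
apply: le_trans (lerD (le_trans (ler_normD _ _) (lerD b1 b2)) b3) _.
rewrite le_eqVlt; apply/orP; left; apply/eqP; ring.
Qed.

(** The weights are free between the endpoint values of the exponential: left endpoints serve for
    [zeta], quadratic means for the law of the noise. *)
Lemma path_limit (theta s t : R) (x w : R -> R) (c : nat -> nat -> R) :
  0 < theta -> 0 <= s -> s <= t ->
  {within `[0, +oo[, continuous x} ->
  (forall r r', 0 <= r -> r <= r' ->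
    x r' - x r = - theta * (\int[leb]_(u in `[r, r']) x u) + (w r' - w r)) ->
  (forall K j, (j < K.+1)%N ->
    expR (theta * (s + j%:R * ((t - s) / K.+1%:R))) <= c K j <=
    expR (theta * (s + j.+1%:R * ((t - s) / K.+1%:R)))) ->
  (\sum_(j < K.+1) c K j * (w (s + j.+1%:R * ((t - s) / K.+1%:R)) -
     w (s + j%:R * ((t - s) / K.+1%:R)))) @[K --> \oo] -->
  expR (theta * t) * x t - expR (theta * s) * x s.
Proof.
move=> th0 s0 st cx eqn cb.
have cst : {within `[s, t], continuous x}.
  apply: continuous_subspaceW cx => u /=; rewrite !in_itv/= => /andP[su _].
  by rewrite (le_trans s0 su).
have [M [M0 HM]] : exists M : R, 0 <= M /\ forall u, s <= u <= t -> `|x u| <= M.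
  have cn : {within `[s, t], continuous (fun u => `|x u|)}.
    by move=> u; apply: cvg_norm; exact: cst.
  have [m mst Hm] := EVT_max st cn.
  by exists `|x m|; split => // u su; apply: Hm; rewrite in_itv.
pose A := theta * expR (theta * t).
have A0 : 0 < A by rewrite mulr_gt0// expR_gt0.
have ts0 : 0 <= t - s by rewrite subr_ge0.
apply/cvgrPdist_le => e e0.
(* Makes [2 * ep] half of [e / (A * (t - s + 1))]; [theta * h * M] accounts for the other half. The
   [+ 1] covers [s = t]. *)
pose ep := e / (4 * A * (t - s + 1)).
have D0 : 0 < t - s + 1 by rewrite ltr_wpDl.
have ep0 : 0 < ep by apply: divr_gt0 => //; apply: mulr_gt0 => //; apply: mulr_gt0.
have [dl dl0 Hdl] := segment_unif_continuous cst ep0.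
near=> K.
pose h := (t - s) / K.+1%:R.
have h0 : 0 <= h by rewrite divr_ge0.
have hdl : h < dl.
  rewrite /h ltr_pdivrMr ?ltr0n// mulrC -ltr_pdivrMr//.
  apply: lt_le_trans (_ : K%:R <= _); last by rewrite ler_nat.
  by near: K; exact: nbhs_infty_gtr.
have hM : theta * h * M <= e / (2 * A * (t - s + 1)).
  have B0 : 0 < e / (2 * A * (t - s + 1)).
    by apply: divr_gt0 => //; apply: mulr_gt0 => //; apply: mulr_gt0.
  have -> : theta * h * M = theta * (t - s) * M / K.+1%:R by rewrite /h; ring.
  rewrite ler_pdivrMr ?ltr0n// [leRHS]mulrC -ler_pdivrMr//.
  apply: le_trans (_ : K%:R <= _); last by rewrite ler_nat.
  by near: K; exact: nbhs_infty_ger.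
pose p (j : nat) := s + j%:R * h.
have ptel : expR (theta * t) * x t - expR (theta * s) * x s =
   \sum_(j < K.+1) (expR (theta * p j.+1) * x (p j.+1) - expR (theta * p j) * x (p j)).
  rewrite -(big_mkord xpredT (fun j =>
    expR (theta * p j.+1) * x (p j.+1) - expR (theta * p j) * x (p j))).
  rewrite (telescope_sumr (fun j => expR (theta * p j) * x (p j)))//.
  have -> : p K.+1 = t by rewrite /p /h mulrCA divff ?pnatr_eq0// mulr1 subrKC.
  by have -> : p 0%N = s by rewrite /p mul0r addr0.
rewrite distrC ptel -sumrB.
apply: le_trans (ler_norm_sum _ _ _) _.
apply: (@le_trans _ _ (\sum_(j < K.+1) h * (A * (2 * ep + theta * h * M)))).
  apply: ler_sum => j _.
  have pj : p j.+1 - p j = h by rewrite /p -natr1; ring.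
  have pjj : p j <= p j.+1 by rewrite -subr_ge0 pj.
  have sp k : s <= p k by rewrite lerDl mulr_ge0.
  have pt k : (k <= K.+1)%N -> p k <= t.
    move=> kK; rewrite /p -lerBrDl /h mulrA ler_pdivrMr ?ltr0n//.
    by rewrite mulrC ler_wpM2l// ler_nat.
  rewrite -pj -/A -/h -/(p j) -/(p j.+1).
  apply: path_step => //.
  - exact: le_trans (sp j).
  - exact: pt.
  - apply: continuous_subspaceW cst => u /=; rewrite !in_itv/= => /andP[u1 u2].
    by rewrite (le_trans (sp _) u1) (le_trans u2)// pt.
  - by apply: eqn => //; exact: le_trans (sp j).
  - move=> u /andP[u1 u2]; apply: ltW; apply: Hdl.
    + by rewrite (le_trans (sp _) u1) (le_trans u2)// pt.
    + by rewrite sp pt.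
    + rewrite distrC ger0_norm ?subr_ge0//; apply: le_lt_trans hdl.
      by rewrite -pj lerD2l lerN2.
  - by apply: HM; rewrite sp pt.
  - exact: cb.
rewrite sumr_const card_ord -[X in X <= _]mulr_natl mulrA.
have -> : K.+1%:R * h = t - s by rewrite /h mulrCA divff ?mulr1 ?pnatr_eq0.
have t1 : 2 * ep + theta * h * M <= e / (A * (t - s + 1)).
  apply: le_trans (lerD (lexx _) hM) _.
  rewrite le_eqVlt; apply/orP; left; apply/eqP; rewrite /ep; field.
  by rewrite !gt_eqF.
apply: (@le_trans _ _ ((t - s) * (A * (e / (A * (t - s + 1)))))).
  by rewrite ler_wpM2l// ler_wpM2l// ltW.
have -> : (t - s) * (A * (e / (A * (t - s + 1)))) = (t - s) / (t - s + 1) * e.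
  by field; rewrite !gt_eqF.
by rewrite ler_piMl ?(ltW e0)// ler_pdivrMr// mul1r lerDl.
Unshelve. all: end_near. Qed.

End paths.

(** * Laws of random sequences; Brownian increments *)

Section laws_of_sequences.
Context d (Omega : measurableType d) (R : realType) (P : probability Omega R).

Lemma seq_law (Y : nat -> Omega -> R) :
  (forall l, measurable_fun setT (Y l)) ->
  exists mu : probability (seqR R) R,
  [/\ forall A : set (seqR R), measurable A -> mu A = P [set w | A (Y ^~ w)],
      forall F : seqR R -> R, measurable_fun setT F ->
        integ P (fun w => F (Y ^~ w)) -> integ mu F &
      forall F : seqR R -> R, integ mu F ->
        integ P (fun w => F (Y ^~ w)) /\
        \int[mu]_e F e = \int[P]_w F (Y ^~ w)].
Proof.
move=> mY.
pose f (w : Omega) : seqR R := Y ^~ w.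
have mf : measurable_fun setT f by exact: measurable_fun_seqR.
pose fmix := isMeasurableFun.Build _ _ _ _ f mf.
pose Z : {RV P >-> seqR R} := HB.pack f fmix.
exists (distribution P Z); split => //.
- move=> F mF iF; apply: (integrable_pushforward mf) => //.
  exact/measurable_EFinP.
- move=> F iF; have mF := integ_meas iF.
  have iP : integ P (fun w => F (f w)).
    apply/integrableP; split.
      by apply/measurable_EFinP; exact: measurableT_comp mF mf.
    move/integrableP : iF => [_]; rewrite (ge0_integral_pushforward mf)//.
    by apply: measurableT_comp => //; exact/measurable_EFinP.
  split; first exact: iP.
  rewrite /Rintegral; congr fine.
  by apply: (integral_pushforward mf) => //; exact/measurable_EFinP.
Qed.

(** Independence turns the probability of an orthant into a product. Coordinate [i] is released by
    putting [setT] in its place; [muC] does this for an arbitrary set [Q] of constrained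
    coordinates. *)
Lemma brownian_resampling (W : R -> {RV P >-> R}) (tau : nat -> R)
    (mu : probability (seqR R) R) :
  brownian_motion W -> 0 <= tau 0%N -> (forall l, tau l < tau l.+1) ->
  (forall A : set (seqR R), measurable A ->
    mu A = P [set w | A (fun l => increment W (tau l) (tau l.+1) w)]) ->
  resampling mu (fun l => Num.sqrt (tau l.+1 - tau l)).
Proof.
move=> [_ ind law _] tau0 tauS muE.
have tauh : {homo tau : i j / (i <= j)%N >-> i <= j}.
  by apply: homo_leq => [//|//|l]; [exact: le_trans|exact: ltW].
have tau_ge0 l : 0 <= tau l by apply: le_trans tau0 (tauh _ _ _).
apply: resampling_cylinder => i m x im.
pose Y (l : nat) : Omega -> R := increment W (tau l) (tau l.+1).
have muC (Q : pred nat) :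
   mu [set e | forall l, (l < m)%N -> Q l -> e l < x l] =
   (\prod_(l < m) P (Y l @^-1` (if Q l then `]-oo, x l[%classic else setT)))%E.
  have mcyl : measurable [set e : seqR R | forall l, (l < m)%N -> Q l -> e l < x l].
    have -> : [set e : seqR R | forall l, (l < m)%N -> Q l -> e l < x l] =
      \bigcap_(l in [set l | (l < m)%N && Q l]) ((fun e : seqR R => e l : R) @^-1` `]-oo, x l[).
      apply/seteqP; split => [t /= h l /= /andP[lm Ql]|t /= h l lm Ql].
        by rewrite in_itv/= h.
      by have := h l; rewrite /= in_itv/= lm Ql; apply.
    apply: bigcap_measurableType => l _.
    by rewrite -[X in measurable X]setTI; apply: measurable_coord.
  rewrite muE// -(ind tau m tau0 tauh (fun l => if Q l then `]-oo, x l[%classic else setT)); last first.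
    by move=> l; case: ifP => _; [exact: measurable_itv|exact: measurableT].
  congr (P _); apply/seteqP; split => [w /= h l _ /=|w /= h l lm Ql].
    case: ifP => // Ql; rewrite /= in_itv/=; exact: h.
  by have := h (Ordinal lm) I; rewrite /= Ql /= in_itv.
have -> : mu [set e | forall l, (l < m)%N -> e l < x l] =
          mu [set e | forall l, (l < m)%N -> xpredT l -> e l < x l].
  by congr (mu _); apply/seteqP; split => e /= h l lm; [move=> _|]; apply: h.
rewrite (muC xpredT) (muC (fun l => l != i)).
rewrite (bigD1 (Ordinal im))//= [in RHS](bigD1 (Ordinal im))//= eqxx /=.
rewrite preimage_setT probability_setT mul1e; congr (_ * _)%E.
  by rewrite law//; exact: measurable_itv.
by apply: eq_bigr => l; rewrite -val_eqE /= => ->.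
Qed.

End laws_of_sequences.

(** * Testing [resampling] on Lipschitz functions *)

Section resampling_criterion.
Context (R : realType).
Notation gamma s := (@normal_prob R 0 s).

(** Lipschitz functions of [y] that increase with [p] to the indicator of []-oo, x[]. *)
Definition ramp (x y : R) (p : nat) : R := Num.max 0 (Num.min 1 (p.+1%:R * (x - y))).

Lemma ramp_ge0 x y p : 0 <= ramp x y p.
Proof. by rewrite /ramp le_max lexx. Qed.

Lemma ramp_le1 x y p : ramp x y p <= 1.
Proof. by rewrite /ramp ge_max ler01 ge_min lexx. Qed.

Lemma ramp_lip x p y z : `|ramp x y p - ramp x z p| <= p.+1%:R * `|y - z|.
Proof.
have p0 : 0 < p.+1%:R :> R by rewrite ltr0n.
rewrite /ramp; move: (p.+1%:R : R) p0 => k k0.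
wlog yz : y z / y <= z.
  move=> H; have [|/ltW] := leP y z; first exact: H.
  by move=> /H; rewrite distrC [X in _ <= _ * X]distrC.
have kyz : k * y <= k * z by rewrite ler_wpM2l// ltW.
rewrite [X in _ <= _ * X]distrC [X in _ <= _ * X]ger0_norm ?subr_ge0//.
rewrite !mulrBr ler_norml.
have -> : k * z - k * y = (k * x - k * y) - (k * x - k * z) by ring.
have : k * x - k * z <= k * x - k * y by rewrite lerD2l lerN2.
move: (k * x - k * y) (k * x - k * z) => a b ba.
have [a1|a1] := leP 1 a; have [b1|b1] := leP 1 b;
  have [a0|a0] := leP 0 a; have [b0|b0] := leP 0 b;
  rewrite ?(max_r ler01) ?(max_r a0) ?(max_r b0) ?(max_l (ltW a0)) ?(max_l (ltW b0));
  apply/andP; split; lra.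
Qed.

Lemma ramp_cvg (x y : R) : ramp x y p @[p --> \oo] --> (\1_(`]-oo, x[%classic) y : R).
Proof.
rewrite indicE; have [yx|xy] := ltP y x.
  rewrite mem_set/=; last by rewrite in_itv.
  apply: cvg_near_cst; near=> p; rewrite /ramp.
  have h : 1 <= p.+1%:R * (x - y).
    rewrite -ler_pdivrMr ?subr_gt0//; apply: le_trans (_ : p%:R <= _); last by rewrite ler_nat.
    by near: p; exact: nbhs_infty_ger.
  by rewrite (min_idPl h); apply/max_idPr.
rewrite memNset/=; last by rewrite in_itv/= ltNge xy.
apply: cvg_near_cst; near=> p; rewrite /ramp.
have h : p.+1%:R * (x - y) <= 0 by rewrite mulr_ge0_le0// subr_le0.
by apply/max_idPl; rewrite ge_min h orbT.
Unshelve. all: end_near. Qed.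

Lemma measurable_ramp x p : measurable_fun setT (fun y => ramp x y p).
Proof.
apply: continuous_measurable_fun; apply: (@lip_continuous _ p.+1%:R).
exact: ramp_lip.
Qed.

Lemma cvg_prod_ord (m : nat) (Q : pred nat) (f : nat -> nat -> R) (g : nat -> R) :
  (forall l, f l p @[p --> \oo] --> g l) ->
  \prod_(l < m | Q l) f l p @[p --> \oo] --> \prod_(l < m | Q l) g l.
Proof.
move=> fg; elim: m => [|m ih].
  by rewrite big_ord0; under eq_fun do rewrite big_ord0; exact: cvg_cst.
rewrite big_mkcond big_ord_recr/= -big_mkcond/=.
under eq_fun do rewrite big_mkcond big_ord_recr/= -big_mkcond/=.
by apply: cvgM ih _; case: (Q m); [exact: fg|exact: cvg_cst].
Qed.

Lemma prod_ord_bound (m : nat) (Q : pred nat) (f : nat -> R) :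
  (forall l, 0 <= f l <= 1) -> `|\prod_(l < m | Q l) f l| <= 1.
Proof.
move=> f01; rewrite ger0_norm; first by apply: prodr_ile1 => l _; exact: f01.
by apply: prodr_ge0 => l _; case/andP: (f01 l).
Qed.

Lemma measurable_prod_ord d (T : measurableType d) (m : nat) (Q : pred nat) (f : nat -> T -> R) :
  (forall l, measurable_fun setT (f l)) ->
  measurable_fun setT (fun w => \prod_(l < m | Q l) f l w).
Proof.
move=> mf; elim: m => [|m ih].
  by under eq_fun do rewrite big_ord0; exact: measurable_cst.
under eq_fun do rewrite big_mkcond big_ord_recr/= -big_mkcond/=.
by apply: measurable_funM => //; case: (Q m); [exact: mf|exact: measurable_cst].
Qed.

(** The noise is reached only as an almost sure limit, which passes through continuous test
    functions but not through indicators of orthants. Ramps bring the orthants back by bounded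
    convergence. *)
Lemma resampling_lip (mu : probability (seqR R) R) (s : nat -> R) :
  (forall i m (h : nat -> R -> R), (i < m)%N ->
    (forall l, exists2 L : R, 0 < L & forall y z, `|h l y - h l z| <= L * `|y - z|) ->
    (forall l y, 0 <= h l y <= 1) ->
    \int[mu]_e (\prod_(l < m) h l (e l)) =
    (\int[gamma (s i)]_y h i y) * \int[mu]_e (\prod_(l < m | (l : nat) != i) h l (e l))) ->
  resampling mu s.
Proof.
move=> H; apply: resampling_cylinder => i m x im.
pose h (p l : nat) (y : R) := ramp (x l) y p.
have hcvg (Q : pred nat) : (\int[mu]_e (\prod_(l < m | Q l) h p l (e l))) @[p --> \oo] -->
    \int[mu]_e (\prod_(l < m | Q l) \1_(`]-oo, x l[%classic) (e l)).
  apply: (@E_bounded_cvg _ _ _ mu (fun p e => \prod_(l < m | Q l) h p l (e l)) _ 1).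
  - move=> p; apply: (measurable_prod_ord m Q (f := fun l (e : seqR R) => h p l (e l))) => l.
    exact: measurableT_comp (measurable_ramp (x l) p) (measurable_coord l).
  - apply: (measurable_prod_ord m Q (f := fun l (e : seqR R) => \1_(`]-oo, x l[%classic) (e l))) => l.
    apply: measurableT_comp (measurable_coord l).
    by apply: measurable_indic; exact: measurable_itv.
  - apply: aeW => e.
    apply: (@cvg_prod_ord m Q (fun l p => h p l (e l)) (fun l => \1_(`]-oo, x l[%classic) (e l))).
    by move=> l; exact: ramp_cvg.
  - move=> p e; apply: (@prod_ord_bound m Q (fun l => h p l (e l))) => l.
    by rewrite ramp_ge0 ramp_le1.
have gcvg : (\int[gamma (s i)]_y h p i y) @[p --> \oo] -->
    \int[gamma (s i)]_y \1_(`]-oo, x i[%classic) y.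
  apply: (@E_bounded_cvg _ (measurableTypeR R) _ (gamma (s i)) (fun p y => h p i y) _ 1).
  - by move=> p; exact: measurable_ramp.
  - by apply: measurable_indic; exact: measurable_itv.
  - by apply: aeW => y; exact: ramp_cvg.
  - by move=> p y; rewrite ger0_norm ?ramp_ge0// ramp_le1.
have lim : \int[mu]_e (\prod_(l < m) \1_(`]-oo, x l[%classic) (e l)) =
    (\int[gamma (s i)]_y \1_(`]-oo, x i[%classic) y) *
    \int[mu]_e (\prod_(l < m | (l : nat) != i) \1_(`]-oo, x l[%classic) (e l)) :> R.
  have c1 := cvgM gcvg (hcvg (fun l => l != i)).
  have c2 := hcvg xpredT.
  have E p : \int[mu]_e (\prod_(l < m) h p l (e l)) =
      (\int[gamma (s i)]_y h p i y) * \int[mu]_e (\prod_(l < m | (l : nat) != i) h p l (e l)).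
    apply: H => //.
      by move=> l; exists (p.+1%:R) => [|y z]; [rewrite ltr0n|exact: ramp_lip].
    by move=> l y; rewrite ramp_ge0 ramp_le1.
  rewrite -(cvg_lim (@Rhausdorff R) c2); apply: cvg_lim; first exact: Rhausdorff.
  by under eq_fun do rewrite E; exact: c1.
have mcyl (Q : pred nat) : measurable [set e : seqR R | forall l, (l < m)%N -> Q l -> e l < x l].
  have -> : [set e : seqR R | forall l, (l < m)%N -> Q l -> e l < x l] =
    \bigcap_(l in [set l | (l < m)%N && Q l]) ((fun e : seqR R => e l : R) @^-1` `]-oo, x l[).
    apply/seteqP; split => [t /= h0 l /= /andP[lm Ql]|t /= h0 l lm Ql].
      by rewrite in_itv/= h0.
    by have := h0 l; rewrite /= in_itv/= lm Ql; apply.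
  apply: bigcap_measurableType => l _.
  by rewrite -[X in measurable X]setTI; apply: measurable_coord.
have muE (Q : pred nat) : mu [set e | forall l, (l < m)%N -> Q l -> e l < x l] =
    (\int[mu]_e (\prod_(l < m | Q l) \1_(`]-oo, x l[%classic) (e l)))%:E.
  rewrite -[LHS]fineK; last exact: fin_num_measure.
  congr EFin.
  rewrite -[X in mu X]setIT -integral_indic//; congr fine.
  apply: eq_integral => e _; congr EFin.
  rewrite indicE; case: (boolP [forall l : 'I_m, Q l ==> (e l < x l)]) => [/forallP he|].
    rewrite mem_set/=; last by move=> l lm; move/implyP: (he (Ordinal lm)).
    rewrite big1// => l Ql; rewrite indicE mem_set//= in_itv/=.
    by move/implyP: (he l); apply.
  rewrite negb_forall => /existsP[l]; rewrite negb_imply => /andP[Ql el].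
  rewrite memNset/=; last by move=> he; move: el; rewrite he.
  rewrite (bigD1 l)//= indicE memNset ?mul0r//=; rewrite in_itv/=.
  exact/negP.
have -> : mu [set e | forall l, (l < m)%N -> e l < x l] =
          mu [set e | forall l, (l < m)%N -> xpredT l -> e l < x l].
  by congr (mu _); apply/seteqP; split => e /= h0 l lm; [move=> _|]; apply: h0.
rewrite (muE xpredT) (muE (fun l => l != i)) lim EFinM; congr (_ * _)%E.
have mI : measurable (`]-oo, x i[%classic : set (measurableTypeR R)) by exact: measurable_itv.
rewrite -[RHS]fineK; last exact: fin_num_measure.
congr EFin.
by rewrite -[X in gamma (s i) X]setIT -integral_indic.
Qed.

End resampling_criterion.

(** * Law of the noise of the process on a grid *)

Section OU_grid.
Context d (Omega : measurableType d) (R : realType) (P : probability Omega R).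
Variables (theta : R) (W X : R -> {RV P >-> R}).
Hypotheses (theta_gt0 : 0 < theta) (BM : brownian_motion W) (OU : OU_process theta W X).
Notation gamma s := (@normal_prob R 0 s).
Notation leb := (@lebesgue_measure R).

Lemma OU_path : {ae P, forall w,
  [/\ {within `[0, +oo[, continuous (fun t : R => X t w)}, X 0 w = 0 &
    forall r r', 0 <= r -> r <= r' ->
    X r' w - X r w = - theta * (\int[leb]_(u in `[r, r']) X u w) + (W r' w - W r w)]}.
Proof.
apply: filterS OU => w [cX X0 eqn]; split => // r r' r0 rr'.
have r'0 := le_trans r0 rr'.
have e1 := eqn _ r0; have e2 := eqn _ r'0.
have iX : leb.-integrable `[0, r'] (EFin \o (fun u => X u w)).
  apply: continuous_compact_integrable; first exact: segment_compact.
  by apply: continuous_subspaceW cX => u /=; rewrite !in_itv/= => /andP[->].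
have := @Rintegral_itvB R (fun u => X u w) (BLeft 0) (BRight r') r iX.
rewrite !bnd_simp => /(_ r0 rr').
rewrite Rintegral_itv_obnd_cbnd; last first.
  by apply: integrableS iX => //; apply: subset_itvr; rewrite bnd_simp.
move=> <-.
have -> : X r' w - X r w = (X r' w - X 0 w) - (X r w - X 0 w) by ring.
by rewrite e1 e2; ring.
Qed.

(* The quadratic mean of u |-> exp (theta u) over [r, r']. With these values, a
   Riemann sum of the Wiener integral has exactly the variance of its limit, so
   that its law does not depend on the mesh. *)
Definition wiener_coef (r r' : R) : R :=
  Num.sqrt ((expR (2 * theta * r') - expR (2 * theta * r)) / (2 * theta * (r' - r))).

Lemma wiener_coef_arg_ge0 r r' : r < r' ->
  0 <= (expR (2 * theta * r') - expR (2 * theta * r)) / (2 * theta * (r' - r)).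
Proof.
move=> rr'; apply: divr_ge0.
  by rewrite subr_ge0 ler_expR ler_wpM2l ?(ltW rr')// mulr_ge0// ltW.
by rewrite !mulr_ge0 ?subr_ge0// ltW.
Qed.

Lemma wiener_coef_bounds r r' : r < r' ->
  expR (theta * r) <= wiener_coef r r' <= expR (theta * r').
Proof.
move=> rr'; have t2 : 0 < 2 * theta by rewrite mulr_gt0.
have D0 : 0 < 2 * theta * (r' - r) by rewrite mulr_gt0// subr_gt0.
have /andP[h1 h2] := expR_increment t2 (ltW rr').
have sq y : expR (theta * y) ^+ 2 = expR (2 * theta * y).
  by rewrite -expRM_natl; congr expR; ring.
have w0 := sqrtr_ge0 ((expR (2 * theta * r') - expR (2 * theta * r)) / (2 * theta * (r' - r))).
rewrite -(@ler_pXn2r _ 2)// ?nnegrE ?expR_ge0// -[X in _ && X](@ler_pXn2r _ 2)// ?nnegrE ?expR_ge0//.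
rewrite /wiener_coef sqr_sqrtr ?wiener_coef_arg_ge0// !sq.
by rewrite ler_pdivlMr// ler_pdivrMr// ![expR _ * _]mulrC h1.
Qed.

Variable t : nat -> R.
Hypotheses (t0 : 0 <= t 0%N) (tS : forall l, t l < t l.+1).

(** This is the Wiener integral of [exp (- theta (t l.+1 - u))] over [[t l, t l.+1]]; the Ito
    isometry predicts the variance in [OU_noise_sd]. *)
Definition OU_noise (l : nat) (w : Omega) : R :=
  X (t l.+1) w - expR (- (theta * (t l.+1 - t l))) * X (t l) w.

Definition OU_noise_sd (l : nat) : R :=
  Num.sqrt ((1 - expR (- (2 * theta * (t l.+1 - t l)))) / (2 * theta)).

Lemma OU_noise_sd_gt0 l : 0 < OU_noise_sd l.
Proof.
rewrite sqrtr_gt0 divr_gt0 ?mulr_gt0// subr_gt0 -expR0 ltr_expR oppr_lt0.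
by rewrite !mulr_gt0// subr_gt0.
Qed.

Lemma measurable_OU_noise l : measurable_fun setT (OU_noise l).
Proof.
apply: measurable_funB; first exact: measurable_funP.
by apply: measurable_funM; [exact: measurable_cst|exact: measurable_funP].
Qed.

Definition mesh (K l : nat) : R := (t l.+1 - t l) / K.+1%:R.

(* Each [t l, t l.+1] is cut into K.+1 equal pieces; q enumerates all knots. *)
Definition refined (K q : nat) : R :=
  t (q %/ K.+1) + (q %% K.+1)%:R * mesh K (q %/ K.+1).

Lemma mesh_gt0 K l : 0 < mesh K l.
Proof. by rewrite divr_gt0// subr_gt0. Qed.

Lemma mesh_end K l : t l + K.+1%:R * mesh K l = t l.+1.
Proof. by rewrite /mesh mulrCA divff ?pnatr_eq0// mulr1 subrKC. Qed.

Lemma refinedE K l j : (j <= K.+1)%N ->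
  refined K (l * K.+1 + j) = t l + j%:R * mesh K l.
Proof.
rewrite leq_eqVlt => /predU1P[->|jK]; last first.
  by rewrite /refined divnMDl// modnMDl (divn_small jK) (modn_small jK) addn0.
rewrite mesh_end -mulSnr /refined mulnK// modnMl mul0r addr0.
by [].
Qed.

Lemma refined_lt K q : refined K q < refined K q.+1.
Proof.
rewrite (divn_eq q K.+1) -addnS; have := ltn_pmod q (ltn0Sn K).
move: (q %/ K.+1)%N (q %% K.+1)%N => l j jK.
rewrite !refinedE//; last exact: ltnW.
by rewrite ltrD2l ltr_pM2r ?mesh_gt0// ltr_nat.
Qed.

Definition noise_coef (K l j : nat) : R :=
  expR (- (theta * t l.+1)) *
  wiener_coef (t l + j%:R * mesh K l) (t l + j.+1%:R * mesh K l).

Definition noise_approx (K l : nat) (e : seqR R) : R :=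
  \sum_(j < K.+1) noise_coef K l j * e (l * K.+1 + j)%N.

(** By the choice of [wiener_coef], each summand is a constant times an increment of
    [exp (2 theta u)], so the sum telescopes. *)
Lemma noise_approx_var K l :
  OU_noise_sd l ^+ 2 = \sum_(j < K.+1)
   (noise_coef K l j * Num.sqrt (refined K (l * K.+1 + j).+1 - refined K (l * K.+1 + j))) ^+ 2.
Proof.
have th2 : 2 * theta != 0 by rewrite mulf_neq0// gt_eqF.
pose E (j : nat) := expR (2 * theta * (t l + j%:R * mesh K l)).
have -> : \sum_(j < K.+1)
   (noise_coef K l j * Num.sqrt (refined K (l * K.+1 + j).+1 - refined K (l * K.+1 + j))) ^+ 2
   = \sum_(j < K.+1) (expR (- (2 * theta * t l.+1)) / (2 * theta)) * (E j.+1 - E j).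
  apply: eq_bigr => j _.
  have jj : t l + j%:R * mesh K l < t l + j.+1%:R * mesh K l.
    by rewrite ltrD2l ltr_pM2r ?mesh_gt0// ltr_nat.
  rewrite -addnS !refinedE// ?(ltnW (ltn_ord j))//.
  rewrite !exprMn !sqr_sqrtr ?wiener_coef_arg_ge0 ?subr_ge0 ?(ltW jj)//.
  rewrite -expRM_natl -/(E j) -/(E j.+1).
  have -> : 2%:R * - (theta * t l.+1) = - (2 * theta * t l.+1) :> R by ring.
  have : t l + j.+1%:R * mesh K l - (t l + j%:R * mesh K l) != 0 by rewrite gt_eqF// subr_gt0.
  move: (t l + j.+1%:R * mesh K l - _) => D D0.
  by field; rewrite D0 gt_eqF.
rewrite -mulr_sumr -(big_mkord xpredT (fun j => E j.+1 - E j)) telescope_sumr//.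
rewrite /E mesh_end mul0r addr0 sqr_sqrtr; last first.
  apply: divr_ge0; last by rewrite mulr_ge0// ltW.
  rewrite subr_ge0 -expR0 ler_expR oppr_le0 !mulr_ge0 ?subr_ge0 ?(ltW (tS l))//.
  exact: ltW.
rewrite [RHS]mulrAC [in RHS]mulrBr -!expRD addNr expR0.
by congr ((_ - expR _) / _); ring.
Qed.

Lemma noise_approx_law K m i (h : nat -> R -> R) : (i < m)%N ->
  (forall l, exists2 L : R, 0 < L & forall y z, `|h l y - h l z| <= L * `|y - z|) ->
  (forall l y, 0 <= h l y <= 1) ->
  let Y l w := noise_approx K l
     (fun q => increment W (refined K q) (refined K q.+1) w) in
  \int[P]_w (\prod_(l < m) h l (Y l w)) =
  (\int[gamma (OU_noise_sd i)]_y h i y) *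
  \int[P]_w (\prod_(l < m | (l : nat) != i) h l (Y l w)).
Proof.
move=> im hL h01 Y.
have mInc q : measurable_fun setT (increment W (refined K q) (refined K q.+1)).
  by apply: measurable_funB; exact: measurable_funP.
have [mu [muE _ muI]] := seq_law P mInc.
have ref0 : 0 <= refined K 0 by rewrite /refined div0n mod0n mul0r addr0.
have rs := brownian_resampling BM ref0 (refined_lt K) muE.
have s0 q : Num.sqrt (refined K q.+1 - refined K q) != 0.
  by rewrite gt_eqF// sqrtr_gt0 subr_gt0 refined_lt.
have mh l : measurable_fun setT (h l).
  have [L _ hl] := hL l.
  by apply: continuous_measurable_fun; exact: lip_continuous hl.
have mU l : measurable_fun setT (noise_approx K l).
  apply: measurable_sum => j; apply: measurable_funM; first exact: measurable_cst.
  exact: measurable_coord.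
have mPsi (Q : pred nat) : measurable_fun setT (fun e => \prod_(l < m | Q l) h l (noise_approx K l e)).
  apply: (measurable_prod_ord m Q (f := fun l e => h l (noise_approx K l e))) => l.
  exact: measurableT_comp (mh l) (mU l).
have bPsi (Q : pred nat) e : `|\prod_(l < m | Q l) h l (noise_approx K l e)| <= 1.
  exact: (@prod_ord_bound _ m Q (fun l => h l (noise_approx K l e))).
have iPsi (Q : pred nat) : integ mu (fun e => \prod_(l < m | Q l) h l (noise_approx K l e)).
  by apply: (@integ_bounded _ _ _ _ _ 1); [exact: mPsi|exact: bPsi].
have [_ E1] := muI _ (iPsi xpredT).
have [_ E2] := muI _ (iPsi (fun l => l != i)).
rewrite -[LHS]E1 -[X in _ = _ * X]E2.
have [L L0 hl] := hL i.
have := @resampling_sum_law R mu _ rs s0 (noise_coef K i) (i * K.+1)%N K.+1 _ L (h i)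
  (fun e => \prod_(l < m | (l : nat) != i) h l (noise_approx K l e)) (OU_noise_sd_gt0 i)
  (noise_approx_var K i) L0 hl (mPsi (fun l => l != i)) (bPsi (fun l => l != i)).
move=> <-; last first.
  move=> j e x jK; apply: eq_bigr => l li; congr (h l _).
  apply: eq_bigr => j' _; congr (_ * _); rewrite upd_neq//.
  apply: contra li => /eqP E; apply/eqP.
  (* Division by [K.+1] recovers the block index: different noises use disjoint blocks of
     increments. *)
  have := congr1 (fun q => q %/ K.+1)%N E.
  by rewrite /= !divnMDl// !divn_small// !addn0.
by apply: eq_Rintegral => e _; rewrite (bigD1 (Ordinal im)).
Qed.

Lemma noise_approx_cvg : {ae P, forall w, forall l,
  noise_approx K l (fun q => increment W (refined K q) (refined K q.+1) w)
    @[K --> \oo] --> OU_noise l w}.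
Proof.
apply: filterS OU_path => w [cX _ eqn] l.
have tl0 : 0 <= t l by elim: l => // l ih; apply: le_trans ih (ltW (tS l)).
have cb K j : (j < K.+1)%N ->
    expR (theta * (t l + j%:R * mesh K l)) <=
    wiener_coef (t l + j%:R * mesh K l) (t l + j.+1%:R * mesh K l) <=
    expR (theta * (t l + j.+1%:R * mesh K l)).
  move=> jK; apply: wiener_coef_bounds.
  by rewrite ltrD2l ltr_pM2r ?mesh_gt0// ltr_nat.
have := @cvgMl_tmp R nat \oo _ _ (expR (- (theta * t l.+1))) _
  (path_limit theta_gt0 tl0 (ltW (tS l)) cX eqn cb).
move=> /(_ eventually_filter).
rewrite mulrBr !mulrA -!expRD addNr expR0 mul1r.
have -> : - (theta * t l.+1) + theta * t l = - (theta * (t l.+1 - t l)) by ring.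
apply: cvg_trans; apply: near_eq_cvg; near=> K.
rewrite /noise_approx mulr_sumr; apply: eq_bigr => j _.
rewrite /increment -addnS (refinedE l (ltn_ord j)) (refinedE l (ltnW (ltn_ord j))).
by rewrite /noise_coef /mesh -[RHS]mulrA.
Unshelve. all: end_near. Qed.

(** The product formula holds exactly at every [K] by [noise_approx_law], and survives the limit
    because the test functions are continuous and bounded. *)
Lemma OU_grid_law : exists mu : probability (seqR R) R,
  [/\ resampling mu OU_noise_sd,
      forall F : seqR R -> R, measurable_fun setT F ->
        integ P (fun w => F (OU_noise ^~ w)) -> integ mu F &
      forall F : seqR R -> R, integ mu F ->
        integ P (fun w => F (OU_noise ^~ w)) /\
        \int[mu]_e F e = \int[P]_w F (OU_noise ^~ w)].
Proof.
have [mu [muE mu1 mu2]] := seq_law P measurable_OU_noise.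
exists mu; split => //; apply: resampling_lip => i m h im hL h01.
have mh l : measurable_fun setT (h l).
  have [L _ hl] := hL l.
  by apply: continuous_measurable_fun; exact: lip_continuous hl.
have ch l : continuous (h l) by have [L _ hl] := hL l; exact: lip_continuous hl.
have iPsi (Q : pred nat) : integ mu (fun e => \prod_(l < m | Q l) h l (e l)).
  apply: (@integ_bounded _ _ _ _ _ 1).
    apply: (measurable_prod_ord m Q (f := fun l (e : seqR R) => h l (e l))) => l.
    exact: measurableT_comp (mh l) (measurable_coord l).
  by move=> e; exact: (@prod_ord_bound _ m Q (fun l => h l (e l))).
have lim (Q : pred nat) :
    (\int[P]_w (\prod_(l < m | Q l) h l (noise_approx K l
       (fun q => increment W (refined K q) (refined K q.+1) w)))) @[K --> \oo] -->
    \int[mu]_e (\prod_(l < m | Q l) h l (e l)).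
  rewrite (mu2 _ (iPsi Q)).2.
  apply: (@E_bounded_cvg _ _ _ P (fun K w => \prod_(l < m | Q l) h l (noise_approx K l
       (fun q => increment W (refined K q) (refined K q.+1) w))) _ 1).
  - move=> K; apply: (measurable_prod_ord m Q (f := fun l w => h l (noise_approx K l
       (fun q => increment W (refined K q) (refined K q.+1) w)))) => l.
    apply: measurableT_comp (mh l) _.
    apply: measurable_sum => j; apply: measurable_funM; first exact: measurable_cst.
    by apply: measurable_funB; exact: measurable_funP.
  - apply: (measurable_prod_ord m Q (f := fun l w => h l (OU_noise l w))) => l.
    exact: measurableT_comp (mh l) (measurable_OU_noise l).
  - apply: filterS noise_approx_cvg => w wl.
    apply: (@cvg_prod_ord _ m Q (fun l K => h l (noise_approx K l
       (fun q => increment W (refined K q) (refined K q.+1) w))) (fun l => h l (OU_noise l w))) => l.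
    exact: (continuous_cvg _ (ch l _) (wl l)).
  - move=> K w; exact: (@prod_ord_bound _ m Q (fun l => h l (noise_approx K l
       (fun q => increment W (refined K q) (refined K q.+1) w)))).
rewrite -(cvg_lim (@Rhausdorff R) (lim xpredT)); apply: cvg_lim; first exact: Rhausdorff.
under eq_fun do rewrite (noise_approx_law _ im hL h01).
apply: cvgMl_tmp; exact: (lim (fun l => l != i)).
Qed.

End OU_grid.

(** * Fatou's lemma for almost sure limits *)

Section fatou.
Context d (T : measurableType d) (R : realType).
Variable mu : {measure set T -> \bar R}.

Lemma E_fatou (f_ : nat -> T -> R) (f : T -> R) (C : \bar R) :
  (forall n, measurable_fun setT (f_ n)) -> measurable_fun setT f ->
  (forall n x, 0 <= f_ n x) ->
  {ae mu, forall x, f_ n x @[n --> \oo] --> f x} ->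
  (\forall n \near \oo, (\int[mu]_x (f_ n x)%:E <= C)%E) ->
  (\int[mu]_x (f x)%:E <= C)%E.
Proof.
move=> mf_ mf f0 fcvg [N _ HN].
pose g n x := (f_ (n + N)%N x)%:E.
have mg n : measurable_fun setT (g n) by exact/measurable_EFinP.
have lim x : f_ n x @[n --> \oo] --> f x -> limn_einf (g ^~ x) = (f x)%:E.
  move=> fx; have gx : g n x @[n --> \oo] --> (f x)%:E.
    have : EFin (f_ n x) @[n --> \oo] --> (f x)%:E by apply: cvg_EFin fx; exact: nearW.
    by rewrite -(cvg_shiftn N).
  rewrite is_cvg_limn_einfE; first exact/cvg_lim.
  by apply/cvg_ex; exists (f x)%:E.
have mlim : measurable_fun setT (fun x => limn_einf (g ^~ x)).
  rewrite [X in measurable_fun _ X](_ : _ =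
      fun x => (- limn_esup (-%E \o (g ^~ x)))%E); last first.
    by apply/funext => x; rewrite limn_esupN oppeK.
  apply: measurableT_comp => //.
  by apply: measurable_fun_limn_esup => n; exact: measurableT_comp.
have -> : (\int[mu]_x (f x)%:E = \int[mu]_x (limn_einf (g ^~ x)))%E.
  apply: ae_eq_integral => //; first exact/measurable_EFinP.
  by apply: filterS fcvg => x /lim ->.
apply: (@le_trans _ _ (limn_einf (fun n => \int[mu]_x g n x)%E)).
  by apply: fatou => // n x _; rewrite /g lee_fin.
rewrite limn_einf_lim; apply: lime_le.
  exact: is_cvg_einfs.
near=> n; apply: le_trans (_ : (\int[mu]_x g n x)%E <= _)%E.
  by apply: ereal_inf_lbound; exists n => //=.
by apply: HN => /=; exact: leq_addl.
Unshelve. all: end_near. Qed.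

End fatou.

(** * Identification of [zeta] with [exp (theta t) X_t] *)

Section OU_zeta.
Context d (Omega : measurableType d) (R : realType) (P : probability Omega R).
Variables (theta : R) (W X zeta : R -> {RV P >-> R}).
Hypotheses (theta_gt0 : 0 < theta) (OU : OU_process theta W X).
Notation leb := (@lebesgue_measure R).

Definition exp_step (t : R) (K : nat) : step_function R :=
  StepFunction K.+1 (fun i => i%:R * (t / K.+1%:R))
    (fun i => expR (theta * (i%:R * (t / K.+1%:R)))).

Lemma exp_step_partition t K : 0 <= t -> step_partition t (exp_step t K).
Proof.
move=> t0; split => /=; first by rewrite mul0r.
  by rewrite mulrCA divff ?mulr1// pnatr_eq0.
by move=> i _; rewrite ler_wpM2r ?divr_ge0// ler_nat.
Qed.

Lemma exp_step_error t K x : 0 < x -> x <= t ->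
  `|step_eval (exp_step t K) x - expR (theta * x)| <=
  theta * (t / K.+1%:R) * expR (theta * t).
Proof.
move=> x0 xt; have t0 := lt_le_trans x0 xt.
set h := t / K.+1%:R.
have h0 : 0 < h by rewrite divr_gt0.
pose S (N : nat) : R := \sum_(i < N) expR (theta * (i%:R * h)) *
   \1_(`]i%:R * h, i.+1%:R * h]%classic) x.
(* Induction on the number of pieces: those to the left of [x] contribute 0, and exactly one piece
   contains [x]. *)
suff /(_ K.+1) [] : forall N, (N%:R * h < x -> S N = 0) /\
   (x <= N%:R * h -> `|S N - expR (theta * x)| <= theta * h * expR (theta * x)).
- move=> _; rewrite /h mulrCA divff ?mulr1 ?pnatr_eq0// -/h => /(_ xt) /le_trans; apply.
  by rewrite ler_wpM2l ?mulr_ge0 ?(ltW theta_gt0) ?(ltW h0)// ?ler_expR ?ler_wpM2l// ltW.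
elim=> [|N [ih1 ih2]].
  by split=> [_|]; [rewrite /S big_ord0|rewrite mul0r leNgt x0].
have NS : N%:R * h < N.+1%:R * h by rewrite ltr_pM2r// ltr_nat.
split=> xN; rewrite /S big_ord_recr/= -/(S N).
  rewrite ih1 ?(lt_trans NS)// add0r indicE memNset ?mulr0//=.
  by rewrite in_itv/= (leNgt x) xN andbF.
have [xN'|xN'] := leP x (N%:R * h).
  rewrite indicE memNset ?mulr0 ?addr0; first exact: ih2.
  by rewrite /= in_itv/= ltNge xN'.
rewrite ih1// add0r indicE mem_set ?mulr1; last by rewrite /= in_itv/= xN' xN.
have /andP[_ e2] := expR_increment theta_gt0 (ltW xN').
rewrite distrC ger0_norm; last by rewrite subr_ge0 ler_expR ler_wpM2l// ltW.
apply: le_trans e2 _; rewrite ler_wpM2r ?expR_ge0// ler_wpM2l ?(ltW theta_gt0)//.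
by rewrite lerBlDl (le_trans xN)// -natr1 mulrDl mul1r.
Qed.

Lemma exp_step_L2 t : 0 <= t ->
  (\int[leb]_(x in `[0%R, t])
    ((step_eval (exp_step t K) x - expR (theta * x)) ^+ 2)%:E)%E @[K --> \oo] --> 0%E.
Proof.
move=> t0.
have mI : measurable (`]0, t]%classic : set (measurableTypeR R)) by exact: measurable_itv.
have mexp : measurable_fun setT (fun x : R => expR (theta * x)).
  by apply: continuous_measurable_fun => x; apply: continuous_comp; [exact: mulrl_continuous|exact: continuous_expR].
have mstep K : measurable_fun setT (step_eval (exp_step t K)).
  apply: measurable_sum => i; apply: measurable_funM; first exact: measurable_cst.
  by apply: measurable_indic; exact: measurable_itv.
have merr K : measurable_fun setT (fun x : measurableTypeR R =>
    (step_eval (exp_step t K) x - expR (theta * x)) ^+ 2).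
  apply: measurable_funX; exact: (measurable_funB (mstep K) mexp).
have len : (leb `]0%R, t]%classic <= t%:E)%E.
  by rewrite lebesgue_measure_itv/= lte_fin; case: ifP => // _; rewrite oppr0 ?adde0 ?addr0.
pose b (K : nat) : R := (theta * (t / K.+1%:R) * expR (theta * t)) ^+ 2 * t.
have bnd K : (\int[leb]_(x in `[0%R, t])
    ((step_eval (exp_step t K) x - expR (theta * x)) ^+ 2)%:E <= (b K)%:E)%E.
  (* The pieces are open on the left, so the step function vanishes at 0 and the uniform error bound
     holds only on []0, t]]; the point 0 is dropped from the integral. *)
  rewrite -integral_itv_obnd_cbnd; last first.
    by apply/measurable_EFinP; apply: measurable_funTS; exact: merr.
  apply: (@le_trans _ _ (\int[leb]_(x in `]0%R, t]) ((theta * (t / K.+1%:R) * expR (theta * t)) ^+ 2)%:E)%E).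
    apply: ge0_le_integral => //.
    - by move=> x _; rewrite lee_fin sqr_ge0.
    - by apply/measurable_EFinP; apply: measurable_funTS; exact: merr.
    - move=> x /=; rewrite in_itv/= => /andP[x0 xt]; rewrite lee_fin -[leLHS]real_normK ?num_real//.
      by rewrite ler_pXn2r ?nnegrE//; [exact: exp_step_error|rewrite !mulr_ge0 ?expR_ge0 ?divr_ge0// ltW].
  rewrite (@integral_cst _ _ _ leb _ mI) /b [X in (_ <= X)%E]EFinM.
  apply: lee_wpmul2l; first by rewrite lee_fin sqr_ge0.
  exact: len.
have b0 : b K @[K --> \oo] --> (0 : R).
  have -> : b = fun K => (theta * t * expR (theta * t)) ^+ 2 * t * (K.+1%:R^-1 * K.+1%:R^-1).
    by apply/funext => K; rewrite /b; field; rewrite nat1r pnatr_eq0.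
  rewrite -[X in _ --> X](mulr0 ((theta * t * expR (theta * t)) ^+ 2 * t)).
  apply: cvgMl_tmp; rewrite -[X in _ --> X](mulr0 0).
  by apply: cvgM; exact: cvg_harmonic.
have b0E : EFin (b K) @[K --> \oo] --> 0%E by apply: cvg_EFin b0; exact: nearW.
apply: (squeeze_cvge _ (cvg_cst 0%E) b0E).
apply: nearW => K; rewrite bnd andbT.
by apply: integral_ge0 => x _; rewrite lee_fin sqr_ge0.
Qed.

(** The integrals of the left-endpoint step functions tend to [zeta t] in L^2 by [wiener_integral],
    and to [exp (theta t) X_t] along almost every path by [path_limit]. Fatou's lemma identifies the
    two limits. *)
Lemma OU_zeta t : 0 <= t -> wiener_integral W (fun s => expR (theta * s)) t (zeta t) ->
  {ae P, forall w, zeta t w = expR (theta * t) * X t w}.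
Proof.
move=> t0 [_ _ wi].
have lim := wi (exp_step t) (fun K => exp_step_partition K t0) (exp_step_L2 t0).
pose Y w := expR (theta * t) * X t w.
have mY : measurable_fun setT Y.
  by apply: measurable_funM; [exact: measurable_cst|exact: measurable_funP].
have mS K : measurable_fun setT (step_integral W (exp_step t K)).
  apply: measurable_sum => i; apply: measurable_funM; first exact: measurable_cst.
  by apply: measurable_funB; exact: measurable_funP.
have Scvg : {ae P, forall w, step_integral W (exp_step t K) w @[K --> \oo] --> Y w}.
  apply: filterS (OU_path OU) => w [cX X0 eqn].
  have cb K j : (j < K.+1)%N ->
      expR (theta * (0 + j%:R * ((t - 0) / K.+1%:R))) <= expR (theta * (0 + j%:R * ((t - 0) / K.+1%:R)))
      <= expR (theta * (0 + j.+1%:R * ((t - 0) / K.+1%:R))).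
    move=> _; rewrite lexx ler_expR ler_wpM2l ?(ltW theta_gt0)// !add0r subr0.
    by rewrite ler_wpM2r ?divr_ge0// ler_nat.
  have := path_limit theta_gt0 (lexx 0) t0 cX eqn cb.
  rewrite X0 mulr0 !subr0 -/(Y w).
  apply: cvg_trans; apply: near_eq_cvg; near=> K.
  by apply: eq_bigr => j _; rewrite /increment/= !add0r.
have E0 : (\int[P]_w ((Y w - zeta t w) ^+ 2)%:E = 0)%E.
  apply/eqP; rewrite eq_le integral_ge0 ?andbT; last by move=> w _; rewrite lee_fin sqr_ge0.
  apply/lee_addgt0Pr => e e0; rewrite add0e.
  apply: (E_fatou (f_ := fun K w => (step_integral W (exp_step t K) w - zeta t w) ^+ 2)).
  - by move=> K; apply: measurable_funX; apply: measurable_funB => //; exact: measurable_funP.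
  - by apply: measurable_funX; apply: measurable_funB => //; exact: measurable_funP.
  - by move=> K w; exact: sqr_ge0.
  - apply: filterS Scvg => w Sw; under eq_fun do rewrite expr2; rewrite expr2.
    by apply: cvgM; apply: cvgB => //; exact: cvg_cst.
  - rewrite unlock in lim.
    have /lim : nbhs (0%E : \bar R) [set y | (y < e%:E)%E].
      by apply: open_nbhs_nbhs; split; [exact: open_ereal_lt_ereal|rewrite /= lte_fin].
    by move=> [N _ HN]; exists N => // K NK; apply: ltW; exact: HN.
have mD : measurable_fun setT (fun w => ((Y w - zeta t w) ^+ 2)%:E).
  by apply/measurable_EFinP/measurable_funX; apply: measurable_funB => //; exact: measurable_funP.
have /(ae_eq_integral_abs P measurableT mD) : (\int[P]_w `|((Y w - zeta t w) ^+ 2)%:E| = 0)%E.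
  by rewrite -[RHS]E0; apply: eq_integral => w _; rewrite gee0_abs// lee_fin sqr_ge0.
apply: filterS => w /(_ I) [] /eqP; rewrite sqrf_eq0 subr_eq0 => /eqP.
by rewrite /Y => ->.
Unshelve. all: end_near. Qed.

End OU_zeta.

(** * Moments of the autoregression and of its quadratic functionals *)

Section autoregression.
Context (R : realType) (a sg : R).

Fixpoint ar (n : nat) (e : seqR R) : R :=
  if n is k.+1 then a * ar k e + e k else 0.

Definition arM n (e : seqR R) : R := \sum_(i < n) ar i e * e i.
Definition arS n (e : seqR R) : R := \sum_(i < n) ar i e ^+ 2.
Definition arQ n (e : seqR R) : R := \sum_(i < n) (e i ^+ 2 - sg ^+ 2).
(** The autoregression driven by [ar] itself, see [arBS]. The weight [a ^+ (n.-1 - i)] is the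
    sensitivity of [ar n] to the noise [e i]. *)
Definition arB n (e : seqR R) : R := \sum_(i < n) a ^+ (n.-1 - i) * ar i e.
Definition arR n (e : seqR R) : R := \sum_(i < n) arB i e * e i.

Lemma arMS n e : arM n.+1 e = arM n e + ar n e * e n.
Proof. by rewrite /arM big_ord_recr. Qed.

Lemma arSS n e : arS n.+1 e = arS n e + ar n e ^+ 2.
Proof. by rewrite /arS big_ord_recr. Qed.

Lemma arQS n e : arQ n.+1 e = arQ n e + (e n ^+ 2 - sg ^+ 2).
Proof. by rewrite /arQ big_ord_recr. Qed.

Lemma arRS n e : arR n.+1 e = arR n e + arB n e * e n.
Proof. by rewrite /arR big_ord_recr. Qed.

Lemma arBS n e : arB n.+1 e = a * arB n e + ar n e.
Proof.
rewrite /arB big_ord_recr /= subnn expr0 mul1r; congr (_ + _).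
rewrite mulr_sumr; apply: eq_bigr => i _.
rewrite mulrA -exprS; congr (a ^+ _ * _).
by case: n i => [[]//|n i] /=; rewrite subSn// -ltnS.
Qed.

Lemma ar_upd n e i x : (n <= i)%N -> ar n (upd e i x) = ar n e.
Proof.
elim: n => //= n ih ni; rewrite ih ?(ltnW ni)// upd_neq//.
by rewrite neq_ltn ni.
Qed.

Lemma arB_upd n e i x : (n <= i)%N -> arB n (upd e i x) = arB n e.
Proof.
move=> ni; apply: eq_bigr => j _; rewrite ar_upd//.
by rewrite ltnW// (leq_trans (ltn_ord j)).
Qed.

Lemma arM_upd n e i x : (n <= i)%N -> arM n (upd e i x) = arM n e.
Proof.
move=> ni; apply: eq_bigr => j _.
have ji : (j < i)%N by rewrite (leq_trans (ltn_ord j)).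
by rewrite ar_upd ?(ltnW ji)// upd_neq// neq_ltn ji.
Qed.

Lemma arR_upd n e i x : (n <= i)%N -> arR n (upd e i x) = arR n e.
Proof.
move=> ni; apply: eq_bigr => j _.
have ji : (j < i)%N by rewrite (leq_trans (ltn_ord j)).
by rewrite arB_upd ?(ltnW ji)// upd_neq// neq_ltn ji.
Qed.

Lemma arQ_upd n e i x : (n <= i)%N -> arQ n (upd e i x) = arQ n e.
Proof.
move=> ni; apply: eq_bigr => j _; rewrite upd_neq//.
by rewrite neq_ltn (leq_trans (ltn_ord j)).
Qed.

Variables (mu : probability (seqR R) R) (c : R).
Hypotheses (rs : resampling mu (fun=> sg)) (sg0 : 0 < sg).
Hypotheses (a0 : 0 < a) (a1 : a < 1) (c0 : 0 < c) (sgE : sg ^+ 2 = c * (1 - a ^+ 2)).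

Let sgn0 (i : nat) : (fun=> sg) i != 0.
Proof. by rewrite gt_eqF. Qed.

Let ce i : allmom mu (fun e : seqR R => e i : R).
Proof. exact: (allmom_coord rs sgn0). Qed.

Lemma allmom_ar n : allmom mu (ar n).
Proof.
elim: n => [|n ih]; first exact: allmom_cst.
by apply: allmomD => //; exact: allmomZ.
Qed.

Lemma allmom_arM n : allmom mu (arM n).
Proof.
by apply: (@allmom_sum _ _ _ _ _ (fun i e => ar i e * e i)) => i _; apply: allmomM => //; exact: allmom_ar.
Qed.

Lemma allmom_arS n : allmom mu (arS n).
Proof.
by apply: (@allmom_sum _ _ _ _ _ (fun i e => ar i e ^+ 2)) => i _; apply: allmomX => //; exact: allmom_ar.
Qed.

Lemma allmom_arQ n : allmom mu (arQ n).
Proof.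
apply: (@allmom_sum _ _ _ _ _ (fun i (e : seqR R) => e i ^+ 2 - sg ^+ 2)) => i _.
by apply: allmomB; [exact: allmomX|exact: allmom_cst].
Qed.

Lemma allmom_arB n : allmom mu (arB n).
Proof.
apply: (@allmom_sum _ _ _ _ _ (fun i e => a ^+ (n.-1 - i) * ar i e)) => i _.
by apply: allmomZ; exact: allmom_ar.
Qed.

Lemma allmom_arR n : allmom mu (arR n).
Proof.
by apply: (@allmom_sum _ _ _ _ _ (fun i e => arB i e * e i)) => i _; apply: allmomM => //; exact: allmom_arB.
Qed.

(* A martingale transform: the increments are orthogonal. *)
Lemma E_sqr_step (Y Z : seqR R -> R) i : allmom mu Y -> allmom mu Z ->
  (forall e x, Y (upd e i x) = Y e) -> (forall e x, Z (upd e i x) = Z e) ->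
  \int[mu]_e ((Y e + Z e * e i) ^+ 2) =
  \int[mu]_e (Y e ^+ 2) + sg ^+ 2 * \int[mu]_e (Z e ^+ 2).
Proof.
move=> aY aZ Yi Zi.
have aYZ : allmom mu (fun e => 2 * (Y e * Z e)) by apply: allmomZ; exact: allmomM.
have E e : (Y e + Z e * e i) ^+ 2 =
    Y e ^+ 2 + (e i * (2 * (Y e * Z e)) + e i ^+ 2 * Z e ^+ 2) by ring.
under eq_Rintegral do rewrite E.
have i1 : integ mu (fun e => Y e ^+ 2) by apply: allmom_integ; exact: allmomX.
have i2 : integ mu (fun e : seqR R => e i * (2 * (Y e * Z e))).
  by apply: allmom_integ; apply: allmomM.
have i3 : integ mu (fun e : seqR R => e i ^+ 2 * Z e ^+ 2).
  by apply: allmom_integ; apply: allmomM; exact: allmomX.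
rewrite (ED i1 (integD i2 i3)) (ED i2 i3).
rewrite (resampling_E1 rs sgn0 aYZ) ?add0r; last by move=> e x; rewrite Yi Zi.
by rewrite (resampling_E2 rs sgn0 (allmomX 2 aZ))// => e x; rewrite Zi.
Qed.

(** Here [c] is the stationary variance; started from 0, the distance to it contracts by [a ^+ 2] at
    each step. *)
Lemma E_ar2 n : \int[mu]_e (ar n e ^+ 2) = c * (1 - a ^+ 2 ^+ n).
Proof.
elim: n => [|n ih].
  by under eq_Rintegral do rewrite /= expr0n; rewrite E_cst expr0 subrr mulr0.
have := @E_sqr_step (fun e => a * ar n e) (fun=> 1) n (allmomZ a (allmom_ar n)) (allmom_cst _ 1).
have -> : \int[mu]_e ((a * ar n e + 1 * e n) ^+ 2) = \int[mu]_e (ar n.+1 e ^+ 2).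
  by apply: eq_Rintegral => e _; rewrite mul1r.
move=> ->; [|by move=> e x; rewrite ar_upd|by []].
under eq_Rintegral do rewrite exprMn.
rewrite EZ; last by apply: allmom_integ; apply: allmomX; exact: allmom_ar.
by rewrite ih E_cst expr1n mulr1 sgE (exprS _ n); ring.
Qed.

Lemma E_ar2_le n : \int[mu]_e (ar n e ^+ 2) <= c.
Proof.
by rewrite E_ar2 ler_piMr ?(ltW c0)// gerBl exprn_ge0// sqr_ge0.
Qed.

(** The bound is the stationary fourth moment, a fixed point of the recursion:
    [3 c^2 (a^2 + (1 - a^2))^2 = 3 c^2]. *)
Lemma E_ar4_le n : \int[mu]_e (ar n e ^+ 4) <= 3 * c ^+ 2.
Proof.
elim: n => [|n ih].
  by under eq_Rintegral do rewrite /= expr0n; rewrite E_cst mulr_ge0// sqr_ge0.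
have ax := allmom_ar n.
have E e : ar n.+1 e ^+ 4 = a ^+ 4 * ar n e ^+ 4 + (e n * (4 * a ^+ 3 * ar n e ^+ 3) +
   (e n ^+ 2 * (6 * a ^+ 2 * ar n e ^+ 2) + (e n ^+ 3 * (4 * a * ar n e) + e n ^+ 4 * 1))).
  by rewrite /=; ring.
under eq_Rintegral do rewrite E.
have b3 : allmom mu (fun e => 4 * a ^+ 3 * ar n e ^+ 3) by apply: allmomZ; exact: allmomX.
have b2 : allmom mu (fun e => 6 * a ^+ 2 * ar n e ^+ 2) by apply: allmomZ; exact: allmomX.
have b1 : allmom mu (fun e => 4 * a * ar n e) by apply: allmomZ.
have b0 : allmom mu (fun=> 1) by exact: allmom_cst.
have i4 : integ mu (fun e => a ^+ 4 * ar n e ^+ 4).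
  by apply: allmom_integ; apply: allmomZ; exact: allmomX.
have i3 : integ mu (fun e : seqR R => e n * (4 * a ^+ 3 * ar n e ^+ 3)).
  by apply: allmom_integ; apply: allmomM.
have i2 : integ mu (fun e : seqR R => e n ^+ 2 * (6 * a ^+ 2 * ar n e ^+ 2)).
  by apply: allmom_integ; apply: allmomM => //; exact: allmomX.
have i1 : integ mu (fun e : seqR R => e n ^+ 3 * (4 * a * ar n e)).
  by apply: allmom_integ; apply: allmomM => //; exact: allmomX.
have i0 : integ mu (fun e : seqR R => e n ^+ 4 * 1).
  by apply: allmom_integ; apply: allmomM => //; exact: allmomX.
rewrite (ED i4 (integD i3 (integD i2 (integD i1 i0)))) (ED i3 (integD i2 (integD i1 i0))).
rewrite (ED i2 (integD i1 i0)) (ED i1 i0).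
rewrite (resampling_E1 rs sgn0 b3); last by move=> e x; rewrite ar_upd.
rewrite (resampling_E2 rs sgn0 b2); last by move=> e x; rewrite ar_upd.
rewrite (resampling_E3 rs sgn0 b1); last by move=> e x; rewrite ar_upd.
rewrite (resampling_E4 rs sgn0 b0)// E_cst mulr1 !add0r.
rewrite EZ; last by apply: allmom_integ; exact: allmomX.
rewrite EZ; last by apply: allmom_integ; exact: allmomX.
have := E_ar2_le n; set m := \int[mu]_e _ => hm.
have a40 : 0 <= a ^+ 4 by rewrite exprn_ge0// ltW.
have sgg : sg ^+ 4 = (sg ^+ 2) ^+ 2 by ring.
have sg20 : 0 <= sg ^+ 2 * (6 * a ^+ 2) by rewrite mulr_ge0 ?sqr_ge0// (mulr_ge0 _ (sqr_ge0 _)).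
have h1 := ler_wpM2l a40 ih; have h2 := ler_wpM2l sg20 hm.
have -> : 3 * c ^+ 2 = a ^+ 4 * (3 * c ^+ 2) + (sg ^+ 2 * (6 * a ^+ 2) * c + 3 * sg ^+ 4).
  by rewrite sgg sgE; ring.
by apply: lerD => //; rewrite mulrA lerD2r.
Qed.

Lemma E_arM2 n : \int[mu]_e (arM n e ^+ 2) = sg ^+ 2 * \sum_(i < n) c * (1 - a ^+ 2 ^+ i).
Proof.
elim: n => [|n ih].
  rewrite big_ord0 mulr0; under eq_Rintegral do rewrite /arM big_ord0 expr0n.
  exact: E_cst.
under eq_Rintegral do rewrite arMS.
rewrite (E_sqr_step (allmom_arM n) (allmom_ar n)); last 2 first.
- by move=> e x; rewrite arM_upd.
- by move=> e x; rewrite ar_upd.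
by rewrite ih E_ar2 [in RHS]big_ord_recr/= [in RHS]mulrDr.
Qed.

Lemma E_arM2_le n : \int[mu]_e (arM n e ^+ 2) <= sg ^+ 2 * (n%:R * c).
Proof.
rewrite E_arM2 ler_wpM2l ?sqr_ge0// mulr_natl -[X in _ *+ X]card_ord -sumr_const.
by apply: ler_sum => i _; rewrite -E_ar2 E_ar2_le.
Qed.

(** Convexity of the square with weights [a] and [1 - a] gives
    [(a B + x)^2 <= a B^2 + x^2 / (1 - a)], and the stated bound is a fixed point of the resulting
    recursion. *)
Lemma E_arB2_le n : \int[mu]_e (arB n e ^+ 2) <= c / (1 - a) ^+ 2.
Proof.
have d0 : 0 < 1 - a by rewrite subr_gt0.
elim: n => [|n ih].
  under eq_Rintegral do rewrite /arB big_ord0 expr0n.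
  by rewrite E_cst divr_ge0 ?sqr_ge0// ltW.
have iB : integ mu (fun e => arB n e ^+ 2) by apply: allmom_integ; apply: allmomX; exact: allmom_arB.
have ix : integ mu (fun e => ar n e ^+ 2) by apply: allmom_integ; apply: allmomX; exact: allmom_ar.
apply: (@le_trans _ _ (\int[mu]_e (a * arB n e ^+ 2 + (1 - a)^-1 * ar n e ^+ 2))).
  apply: E_le.
  - by apply: allmom_integ; apply: allmomX; exact: allmom_arB.
  - by apply: integD; exact: integZ.
  move=> e; rewrite arBS -subr_ge0.
  have -> : a * arB n e ^+ 2 + (1 - a)^-1 * ar n e ^+ 2 - (a * arB n e + ar n e) ^+ 2 =
     a / (1 - a) * ((1 - a) * arB n e - ar n e) ^+ 2 by field; rewrite gt_eqF.
  by rewrite mulr_ge0 ?sqr_ge0// divr_ge0// ltW.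
rewrite ED ?EZ//; [|exact: integZ|exact: integZ].
have -> : c / (1 - a) ^+ 2 = a * (c / (1 - a) ^+ 2) + (1 - a)^-1 * c by field; rewrite gt_eqF.
apply: lerD; first by rewrite ler_wpM2l// ltW.
by rewrite ler_wpM2l ?E_ar2_le// invr_ge0 ltW.
Qed.

Lemma E_arR2_le n : \int[mu]_e (arR n e ^+ 2) <= sg ^+ 2 * (n%:R * (c / (1 - a) ^+ 2)).
Proof.
elim: n => [|n ih].
  under eq_Rintegral do rewrite /arR big_ord0 expr0n.
  by rewrite E_cst mul0r mulr0.
under eq_Rintegral do rewrite arRS.
rewrite (E_sqr_step (allmom_arR n) (allmom_arB n)); last 2 first.
- by move=> e x; rewrite arR_upd.
- by move=> e x; rewrite arB_upd.
rewrite -natr1 mulrDl mul1r mulrDr lerD// ler_wpM2l ?sqr_ge0//.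
exact: E_arB2_le.
Qed.

Lemma E_arQ2 n : \int[mu]_e (arQ n e ^+ 2) = n%:R * (2 * sg ^+ 4).
Proof.
elim: n => [|n ih].
  under eq_Rintegral do rewrite /arQ big_ord0 expr0n.
  by rewrite E_cst mul0r.
have aQ := allmom_arQ n.
have b1 : allmom mu (fun e => 2 * arQ n e - 2 * sg ^+ 2).
  by apply: allmomB; [exact: allmomZ|exact: allmom_cst].
have E e : arQ n.+1 e ^+ 2 = arQ n e ^+ 2 + (e n ^+ 2 * (2 * arQ n e - 2 * sg ^+ 2) + (e n ^+ 4 * 1
   + (sg ^+ 4 - 2 * sg ^+ 2 * arQ n e))).
  by rewrite arQS; ring.
under eq_Rintegral do rewrite E.
have i1 : integ mu (fun e => arQ n e ^+ 2) by apply: allmom_integ; exact: allmomX.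
have i2 : integ mu (fun e : seqR R => e n ^+ 2 * (2 * arQ n e - 2 * sg ^+ 2)).
  by apply: allmom_integ; apply: allmomM => //; exact: allmomX.
have i3 : integ mu (fun e : seqR R => e n ^+ 4 * 1).
  by apply: allmom_integ; apply: allmomM; [exact: allmomX|exact: allmom_cst].
have i4 : integ mu (fun=> sg ^+ 4) by exact: integ_cst.
have iQ : integ mu (arQ n) by exact: allmom_integ.
have i5 : integ mu (fun e => 2 * sg ^+ 2 * arQ n e) by exact: integZ.
rewrite (ED i1 (integD i2 (integD i3 (integB i4 i5)))) (ED i2 (integD i3 (integB i4 i5))).
rewrite (ED i3 (integB i4 i5)) (EB i4 i5) E_cst EZ//.
rewrite (resampling_E2 rs sgn0 b1); last by move=> e x; rewrite arQ_upd.
rewrite (resampling_E4 rs sgn0 (allmom_cst mu 1))// !E_cst.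
rewrite EB; [|exact: integZ|exact: integ_cst].
rewrite EZ// E_cst ih -natr1; ring.
Qed.

(** Squaring the recursion and summing over the steps; the shift of index in the sum of squares
    leaves the last square [ar n e ^+ 2]. *)
Lemma ar_energy n e :
  (1 - a ^+ 2) * (arS n e - n%:R * c) = arQ n e + 2 * a * arM n e - ar n e ^+ 2.
Proof.
rewrite mulrBr mulrCA -[X in n%:R * X]mulrC -sgE.
elim: n => [|n ih].
  by rewrite /arS /arQ /arM !big_ord0 /= expr0n /=; ring.
by rewrite arSS arQS arMS /= -natr1; move: ih; nra.
Qed.

(** With [r = 1 - a^2], the squares of the three terms of [ar_energy] have means at most [c^2] times
    [2 n r^2], [4 n r] and [3]. As [r <= 1 <= n r], all are of order [n r], and
    [27 = 3 * (2 + 4 + 3)]. *)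
Lemma E_arS_dev n : 1 <= n%:R * (1 - a ^+ 2) ->
  \int[mu]_e ((arS n e - n%:R * c) ^+ 2) <= 27 * c ^+ 2 * n%:R / (1 - a ^+ 2).
Proof.
set r := 1 - a ^+ 2 => nr.
have r0 : 0 < r by rewrite subr_gt0 expr_lt1// ltW.
have r1 : r <= 1 by rewrite gerBl sqr_ge0.
have iQ : integ mu (fun e => arQ n e ^+ 2) by apply: allmom_integ; apply: allmomX; exact: allmom_arQ.
have iM : integ mu (fun e => 4 * arM n e ^+ 2).
  by apply: allmom_integ; apply: allmomZ; apply: allmomX; exact: allmom_arM.
have ix : integ mu (fun e => ar n e ^+ 4) by apply: allmom_integ; apply: allmomX; exact: allmom_ar.
have key : \int[mu]_e (r ^+ 2 * (arS n e - n%:R * c) ^+ 2) <=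
    3 * (n%:R * (2 * sg ^+ 4) + (4 * (sg ^+ 2 * (n%:R * c)) + 3 * c ^+ 2)).
  apply: (@le_trans _ _ (\int[mu]_e (3 * (arQ n e ^+ 2 + (4 * arM n e ^+ 2 + ar n e ^+ 4))))).
    apply: E_le.
    - apply: allmom_integ; apply: allmomZ; apply: allmomX; apply: allmomB; last exact: allmom_cst.
      exact: allmom_arS.
    - by apply: integZ; apply: integD => //; exact: integD.
    move=> e; rewrite -exprMn ar_energy.
    set q := arQ n e; set m := arM n e; set x := ar n e.
    have -> : x ^+ 4 = (x ^+ 2) ^+ 2 by ring.
    have : (2 * a * m) ^+ 2 <= 4 * m ^+ 2.
      have -> : (2 * a * m) ^+ 2 = a ^+ 2 * (4 * m ^+ 2) by ring.
      by rewrite ler_piMl ?(mulr_ge0 _ (sqr_ge0 _))// -subr_ge0 ltW.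
    move: (2 * a * m) (x ^+ 2) (4 * m ^+ 2) => y z u yu.
    by have := sqr_ge0 (q - y); have := sqr_ge0 (q + z); have := sqr_ge0 (y + z); lra.
  rewrite EZ; last by apply: integD => //; exact: integD.
  rewrite ED//; last exact: integD.
  rewrite ED// ler_wpM2l// E_arQ2 lerD2l lerD ?E_ar4_le//.
  rewrite EZ; last by apply: allmom_integ; apply: allmomX; exact: allmom_arM.
  by rewrite ler_wpM2l// E_arM2_le.
rewrite EZ in key; last first.
  by apply: allmom_integ; apply: allmomX; apply: allmomB; [exact: allmom_arS|exact: allmom_cst].
have r20 : 0 < r ^+ 2 by rewrite exprn_gt0.
rewrite -(ler_pM2l r20); apply: le_trans key _.
have -> : sg ^+ 4 = (sg ^+ 2) ^+ 2 by ring.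
rewrite sgE -/r.
have -> : r ^+ 2 * (27 * c ^+ 2 * n%:R / r) = 3 * c ^+ 2 * (9 * (n%:R * r)) by field; rewrite gt_eqF.
have -> : 3 * (n%:R * (2 * (c * r) ^+ 2) + (4 * (c * r * (n%:R * c)) + 3 * c ^+ 2)) =
  3 * c ^+ 2 * (2 * (n%:R * r * r) + 4 * (n%:R * r) + 3) by ring.
rewrite ler_wpM2l ?(mulr_ge0 _ (sqr_ge0 _))//.
have : n%:R * r * r <= n%:R * r by rewrite ler_piMr// mulr_ge0// ltW.
lra.
Qed.

End autoregression.

(** Cauchy-Schwarz through [|y| <= w / 2 + y^2 / (2 w)]; taking [w > 0] slightly above [v] includes
    [v = 0]. *)
Lemma E_norm_le_sqr d (T : measurableType d) (R : realType) (P : probability T R)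
    (Y : T -> R) (v : R) : 0 <= v -> allmom P Y ->
  \int[P]_x (Y x ^+ 2) <= v ^+ 2 -> \int[P]_x `|Y x| <= v.
Proof.
move=> v0 aY Yv.
have iY : integ P (fun x => `|Y x|) by apply: integ_norm; exact: allmom_integ.
have iY2 : integ P (fun x => Y x ^+ 2) by apply: allmom_integ; exact: allmomX.
have key (w : R) : 0 < w -> v <= w -> \int[P]_x `|Y x| <= w.
  move=> w0 vw; apply: (@le_trans _ _ (\int[P]_x (w / 2 + (2 * w)^-1 * Y x ^+ 2))).
    apply: E_le => //; first by apply: integD; [exact: integ_cst|exact: integZ].
    move=> x; rewrite -[Y x ^+ 2]real_normK ?num_real//; move: `|Y x| => y.
    have -> : w / 2 + (2 * w)^-1 * y ^+ 2 = y + (2 * w)^-1 * (y - w) ^+ 2 by field; rewrite gt_eqF.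
    by rewrite lerDl mulr_ge0 ?sqr_ge0// invr_ge0 mulr_ge0// ltW.
  rewrite ED; [|exact: integ_cst|exact: integZ].
  rewrite E_cst EZ//.
  have : \int[P]_x (Y x ^+ 2) <= w ^+ 2.
    by apply: le_trans Yv _; rewrite ler_pXn2r ?nnegrE// ltW.
  move=> /(ler_wpM2l (_ : 0 <= (2 * w)^-1)) => H.
  apply: (@le_trans _ _ (w / 2 + (2 * w)^-1 * w ^+ 2)).
    by rewrite lerD2l H// invr_ge0 mulr_ge0// ltW.
  by rewrite le_eqVlt; apply/orP; left; apply/eqP; field; rewrite gt_eqF.
apply/ler_addgt0Pr => e e0; apply: key; last by rewrite lerDl ltW.
exact: ltr_wpDl.
Qed.

(** * Stein's method for [arM] *)

Section martingale_clt.
Context (R : realType) (a sg c : R) (mu : probability (seqR R) R).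
Hypotheses (rs : resampling mu (fun=> sg)) (sg0 : 0 < sg).
Hypotheses (a0 : 0 < a) (a1 : a < 1) (c0 : 0 < c) (sgE : sg ^+ 2 = c * (1 - a ^+ 2)).
Notation gamma s := (@normal_prob R 0 s).

Let sgn0 (i : nat) : (fun=> sg) i != 0.
Proof. by rewrite gt_eqF. Qed.

Let ce i : allmom mu (fun e : seqR R => e i : R).
Proof. exact: (allmom_coord rs sgn0). Qed.

(** The partial derivative of [ar n] in coordinate [i], zero as long as the noise [e i] has not yet
    entered. *)
Definition ar_slope (n i : nat) : R := if (i < n)%N then a ^+ (n.-1 - i) else 0.

Lemma ar_slopeS n i : ar_slope n.+1 i = a * ar_slope n i + (n == i)%:R.
Proof.
rewrite /ar_slope ltnS; have [ni|ni|->] := ltngtP n i.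
- by rewrite mulr0 add0r.
- rewrite addr0 -exprS; congr (a ^+ _).
  by case: n ni => // n; rewrite ltnS => ni /=; rewrite subSn.
- by rewrite mulr0 add0r /= subnn.
Qed.

Lemma ar_affine n e i (x : R) : ar a n (upd e i x) = ar a n e + ar_slope n i * (x - e i).
Proof.
elim: n => [|n ih]; first by rewrite /ar_slope mul0r addr0.
rewrite /= ih ar_slopeS; have [->|ni] := eqVneq n i.
  by rewrite upd_eq /=; ring.
by rewrite upd_neq//=; ring.
Qed.

(* The partial derivative of [arM n] in the coordinate [i]. *)
Definition arD (n i : nat) (e : seqR R) : R :=
  \sum_(j < n) (ar_slope j i * e j + ((j : nat) == i)%:R * ar a j e).

Lemma arDS n i e :
  arD n.+1 i e = arD n i e + (ar_slope n i * e n + (n == i)%:R * ar a n e).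
Proof. by rewrite /arD big_ord_recr. Qed.

(** [M] is quadratic in the noise but affine in each coordinate: no square [e i ^+ 2] occurs, since
    [ar i] involves only earlier noises. *)
Lemma arM_affine n e i x : arM a n (upd e i x) = arM a n e + arD n i e * (x - e i).
Proof.
elim: n => [|n ih]; first by rewrite /arM /arD !big_ord0 mul0r addr0.
rewrite !arMS arDS ih ar_affine; have [->|ni] := eqVneq n i.
  by rewrite upd_eq /ar_slope ltnn /=; ring.
by rewrite upd_neq//=; ring.
Qed.

Lemma arD_upd n e i x : arD n i (upd e i x) = arD n i e.
Proof.
apply: eq_bigr => j _; have [ji|ji] := eqVneq (j : nat) i.
  by rewrite ji ar_upd// /ar_slope ltnn !mul0r.
by rewrite upd_neq// !mul0r.
Qed.

(* Hence R is what Stein's identity for M adds to the quadratic variation S. *)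
Lemma arD_sum n e : \sum_(i < n) ar a i e * arD n i e = arS a n e + arR a n e.
Proof.
elim: n => [|n ih]; first by rewrite /arS /arR !big_ord0 addr0.
rewrite big_ord_recr /= arSS arRS.
have -> : arD n.+1 n e = ar a n e.
  rewrite arDS eqxx mul1r /ar_slope ltnn mul0r add0r /arD big1 ?add0r// => j _.
  by have jn := ltn_ord j; rewrite /ar_slope ltnNge (ltnW jn) /= (ltn_eqF jn) !mul0r addr0.
have -> : \sum_(i < n) ar a i e * arD n.+1 i e =
    \sum_(i < n) ar a i e * arD n i e + arB a n e * e n.
  rewrite /arB big_distrl -big_split /=; apply: eq_bigr => i _.
  rewrite arDS /ar_slope ltn_ord (gtn_eqF (ltn_ord i)) mul0r addr0.
  by ring.
by rewrite ih; ring.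
Qed.

Lemma allmom_arD n i : allmom mu (arD n i).
Proof.
apply: (@allmom_sum _ _ _ _ _ (fun (j : nat) (e : seqR R) =>
  ar_slope j i * e j + (j == i)%:R * ar a j e)) => j _.
by apply: allmomD; apply: allmomZ; [exact: ce|exact: (allmom_ar a rs sg0)].
Qed.

(** In [M f(K M) = sum_i e_i (x_i f(K M))], integration by parts in [e_i] leaves [x_i] alone and
    produces [K * arD n i]; [arD_sum] adds the terms up. Cubic growth covers both Stein solutions
    and the function [y^3]. *)
Lemma arM_ibp n (f f' : R -> R) (K C : R) :
  (forall x : R, is_derive x 1 f (f' x)) -> continuous f' ->
  (forall y, `|f y| <= C * (1 + `|y| ^+ 3)) -> (forall y, `|f' y| <= C * (1 + `|y| ^+ 3)) ->
  \int[mu]_e (arM a n e * f (K * arM a n e)) =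
  K * sg ^+ 2 * \int[mu]_e ((arS a n e + arR a n e) * f' (K * arM a n e)).
Proof.
move=> df cf' fC f'C.
have cf : continuous f.
  by move=> x; apply: differentiable_continuous; apply/derivable1_diffP; have [] := df x.
have C0 : 0 <= C by have := le_trans (normr_ge0 _) (fC 0); rewrite normr0 expr0n addr0 mulr1.
have aKM : allmom mu (fun e => K * arM a n e) by apply: allmomZ; exact: (allmom_arM a rs sg0).
have af : allmom mu (fun e => f (K * arM a n e)).
  by apply: (allmom_growth _ fC aKM); exact: continuous_measurable_fun.
have af' : allmom mu (fun e => f' (K * arM a n e)).
  by apply: (allmom_growth _ f'C aKM); exact: continuous_measurable_fun.
have ax i : allmom mu (ar a i) by exact: (allmom_ar a rs sg0).
have aF i : allmom mu (fun e => ar a i e * f (K * arM a n e)) by exact: allmomM.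
have aF' i : allmom mu (fun e => ar a i e * (K * arD n i e * f' (K * arM a n e))).
  by apply: allmomM => //; apply: allmomM => //; apply: allmomZ; exact: allmom_arD.
have ibp i : \int[mu]_e (e i * (ar a i e * f (K * arM a n e))) =
    sg ^+ 2 * \int[mu]_e (ar a i e * (K * arD n i e * f' (K * arM a n e))).
  apply: (@resampling_ibp R mu (fun=> sg) i (fun e => ar a i e * f (K * arM a n e))
    (fun e => ar a i e * (K * arD n i e * f' (K * arM a n e))) rs (sgn0 i)).
  - move=> e x; set b := K * (arM a n e - arD n i e * e i); set g := K * arD n i e.
    have ME (y : R) : K * arM a n (upd e i y) = b + g * y by rewrite arM_affine /b /g; ring.
    rewrite [X in is_derive _ _ X _](_ : _ =
      fun y : R => ar a i e * (f \o (fun y => b + g * y)) y); last first.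
      by apply/funext => y /=; rewrite ar_upd// ME.
    have d1 : is_derive x 1 (fun y : R => b + g * y) g.
      by apply: is_derive_eq; rewrite /GRing.scale/=; ring.
    have d2 := df (b + g * x).
    have d3 : is_derive x 1 (f \o (fun y => b + g * y)) (f' (b + g * x) * g) by exact: is_derive1_comp.
    by apply: is_derive_eq; rewrite ar_upd// ME arD_upd -/g /GRing.scale/=; ring.
  - move=> e; set b := K * (arM a n e - arD n i e * e i); set g := K * arD n i e.
    have ME (y : R) : K * arM a n (upd e i y) = b + g * y by rewrite arM_affine /b /g; ring.
    rewrite [X in continuous X](_ : _ = fun y : R => ar a i e * (g * f' (b + g * y))); last first.
      by apply/funext => y; rewrite ar_upd// ME arD_upd.
    move=> x; apply: cvgM; first exact: cvg_cst.
    apply: cvgM; first exact: cvg_cst.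
    apply: (@continuous_comp _ _ _ (fun y : R => b + g * y) f').
      by apply: cvgD; [exact: cvg_cst|apply: cvgM; [exact: cvg_cst|exact: cvg_id]].
    exact: cf'.
  - move=> e; set b := K * (arM a n e - arD n i e * e i); set g := K * arD n i e.
    have ME (y : R) : K * arM a n (upd e i y) = b + g * y by rewrite arM_affine /b /g; ring.
    pose B := 1 + `|b| + `|g|.
    have B1 : 1 <= B by rewrite /B -addrA lerDl addr_ge0.
    (* The affine argument is at most [B (1 + |x|)], and [6 * expR 1] comes from
       [(1 + |x|)^3 <= 3! e^(1 + |x|)]. *)
    pose D := C * (2 * (B ^+ 3 * (6 * expR 1))).
    have D0 : 0 <= D.
      by rewrite /D mulr_ge0// mulr_ge0// mulr_ge0 ?exprn_ge0 ?(le_trans ler01 B1)// mulr_ge0// expR_ge0.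
    have bnd (x : R) : C * (1 + `|b + g * x| ^+ 3) <= D * expR `|x|.
      rewrite /D -mulrA ler_wpM2l//.
      have y1 : 1 <= 1 + `|x| by rewrite lerDl.
      have p := @powr_le_exp R 3 (1 + `|x|); rewrite ger0_norm ?(le_trans ler01 y1)// expRD in p.
      have q : `|b + g * x| <= B * (1 + `|x|).
        apply: le_trans (ler_normD _ _) _; rewrite (normrM g x) /B.
        by have := normr_ge0 b; have := normr_ge0 g; have := normr_ge0 x; nra.
      have q1 : 1 <= B * (1 + `|x|) by apply: le_trans (ler_peMl _ _) => //; exact: le_trans ler01 _.
      have q3 : `|b + g * x| ^+ 3 <= (B * (1 + `|x|)) ^+ 3.
        by rewrite ler_pXn2r ?nnegrE// (le_trans ler01).
      have q13 : 1 <= (B * (1 + `|x|)) ^+ 3 by rewrite exprn_ege1.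
      apply: (@le_trans _ _ (2 * (B * (1 + `|x|)) ^+ 3)); first by lra.
      rewrite -[leRHS]mulrA ler_wpM2l// exprMn -[leRHS]mulrA ler_wpM2l ?exprn_ge0 ?(le_trans ler01 B1)//.
      by apply: le_trans p _; rewrite -mulrA.
    exists (`|ar a i e| * ((1 + `|g|) * D)) => x.
    rewrite ar_upd// ME arD_upd -/g; clearbody D g b; split.
      rewrite normrM -[leRHS]mulrA; apply: ler_wpM2l => //.
      apply: le_trans (fC _) _; apply: le_trans (bnd x) _.
      by rewrite -mulrA ler_peMl ?mulr_ge0 ?expR_ge0// lerDl.
    rewrite normrM -[leRHS]mulrA; apply: ler_wpM2l => //.
    rewrite normrM -mulrA; apply: (@le_trans _ _ (`|g| * (D * expR `|x|))).
      by rewrite ler_wpM2l// (le_trans (f'C _)).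
    by rewrite ler_wpM2r ?mulr_ge0 ?expR_ge0// lerDr.
  - by apply: allmom_integ; apply: allmomM.
  - exact: allmom_integ.
transitivity (\sum_(i < n) \int[mu]_e (e i * (ar a i e * f (K * arM a n e)))).
  rewrite -E_sum; last by move=> i; apply: allmom_integ; exact: allmomM.
  by apply: eq_Rintegral => e _; rewrite [in LHS]/arM big_distrl/=; apply: eq_bigr => i _; ring.
under eq_bigr do rewrite ibp.
rewrite -mulr_sumr -E_sum; last by move=> i; exact: allmom_integ.
rewrite [K * sg ^+ 2]mulrC -[RHS]mulrA; congr (_ * _).
rewrite -EZ; last first.
  by apply: allmom_integ; apply: allmomM => //; apply: allmomD; [exact: (allmom_arS a rs sg0)|exact: (allmom_arR a rs sg0)].
apply: eq_Rintegral => e _; rewrite -arD_sum [in RHS]big_distrl [in RHS]mulr_sumr/=; apply: eq_bigr => i _; ring.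
Qed.

(* [1 - l (S + R)] is the defect in Stein's identity for [K M], with [l] equal
   to [K^2 sg^2]. *)
Lemma stein_defect n (l : R) : 1 <= n%:R * (1 - a ^+ 2) ->
  \int[mu]_e ((1 - l * (arS a n e + arR a n e)) ^+ 2) <=
  3 * ((1 - l * n%:R * c) ^+ 2 + l ^+ 2 * (31 * c ^+ 2 * n%:R / (1 - a ^+ 2))).
Proof.
set r := 1 - a ^+ 2 => nr.
have r0 : 0 < r by rewrite subr_gt0 expr_lt1// ltW.
have aS := allmom_arS a rs sg0 n; have aR := allmom_arR a rs sg0 n.
have aSc : allmom mu (fun e => arS a n e - n%:R * c) by apply: allmomB => //; exact: allmom_cst.
have i1 : integ mu (fun e => (arS a n e - n%:R * c) ^+ 2) by apply: allmom_integ; exact: allmomX.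
have i2 : integ mu (fun e => arR a n e ^+ 2) by apply: allmom_integ; exact: allmomX.
have i0 : integ mu (fun=> (1 - l * n%:R * c) ^+ 2) by exact: integ_cst.
apply: (@le_trans _ _ (\int[mu]_e (3 * ((1 - l * n%:R * c) ^+ 2 +
    l ^+ 2 * ((arS a n e - n%:R * c) ^+ 2 + arR a n e ^+ 2))))).
  apply: E_le.
  - apply: allmom_integ; apply: allmomX; apply: allmomB; first exact: allmom_cst.
    by apply: allmomZ; exact: allmomD.
  - by apply: integZ; apply: integD => //; apply: integZ; exact: integD.
  move=> e; have -> : 1 - l * (arS a n e + arR a n e) =
    (1 - l * n%:R * c) - l * (arS a n e - n%:R * c) - l * arR a n e by ring.
  have -> : l ^+ 2 * ((arS a n e - n%:R * c) ^+ 2 + arR a n e ^+ 2) =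
    (l * (arS a n e - n%:R * c)) ^+ 2 + (l * arR a n e) ^+ 2 by ring.
  move: (1 - _) (l * (_ - _)) (l * arR a n e) => x y z.
  by have := sqr_ge0 (x + y); have := sqr_ge0 (x + z); have := sqr_ge0 (y - z); lra.
rewrite EZ; last by apply: integD => //; apply: integZ; exact: integD.
rewrite ler_wpM2l// ED//; last by apply: integZ; exact: integD.
rewrite E_cst lerD2l EZ; last exact: integD.
rewrite ler_wpM2l ?sqr_ge0// ED//.
apply: le_trans (lerD (E_arS_dev rs sg0 a0 a1 c0 sgE nr) (E_arR2_le rs sg0 a0 a1 c0 sgE n)) _.
rewrite -/r sgE -/r.
have ar0 : 0 < 1 - a by rewrite subr_gt0.
have rE : r = (1 - a) * (1 + a) by rewrite /r; ring.
(* The factorization of [r] trades [(1 - a)^-2] for [r^-1], at the price of [(1 + a)^2 <= 4]; whence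
   [31 = 27 + 4]. *)
have -> : c * r * (n%:R * (c / (1 - a) ^+ 2)) = c ^+ 2 * n%:R / r * (1 + a) ^+ 2.
  by rewrite rE; field; rewrite !gt_eqF// addr_gt0.
have -> : 31 * c ^+ 2 * n%:R / r = 27 * c ^+ 2 * n%:R / r + c ^+ 2 * n%:R / r * 4 by field; rewrite gt_eqF.
rewrite lerD2l ler_wpM2l//.
  by rewrite divr_ge0 ?(ltW r0)// mulr_ge0// sqr_ge0.
nra.
Qed.

Lemma stein_ibp n (K : R) (f f' : R -> R) (C : R) :
  (forall x : R, is_derive x 1 f (f' x)) -> continuous f' ->
  (forall y, `|f y| <= C * (1 + `|y| ^+ 3)) -> (forall y, `|f' y| <= C * (1 + `|y| ^+ 3)) ->
  let t e := K ^+ 2 * sg ^+ 2 * (arS a n e + arR a n e) in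
  \int[mu]_e (K * arM a n e * f (K * arM a n e)) =
  \int[mu]_e (t e * f' (K * arM a n e)).
Proof.
move=> df cf' fC f'C t.
have cf : continuous f.
  by move=> x; apply: differentiable_continuous; apply/derivable1_diffP; have [] := df x.
have aKM : allmom mu (fun e => K * arM a n e) by apply: allmomZ; exact: (allmom_arM a rs sg0).
have af : allmom mu (fun e => f (K * arM a n e)).
  by apply: (allmom_growth _ fC aKM); exact: continuous_measurable_fun.
have af' : allmom mu (fun e => f' (K * arM a n e)).
  by apply: (allmom_growth _ f'C aKM); exact: continuous_measurable_fun.
have := arM_ibp n K df cf' fC f'C => /(congr1 (fun x => K * x)).
rewrite -EZ; last by apply: allmom_integ; apply: allmomM => //; exact: (allmom_arM a rs sg0).
rewrite mulrA -EZ; last first.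
  apply: allmom_integ; apply: allmomM => //; apply: allmomD.
    exact: (allmom_arS a rs sg0).
  exact: (allmom_arR a rs sg0).
move=> E; transitivity (\int[mu]_x (K * (arM a n x * f (K * arM a n x)))).
  by apply: eq_Rintegral => e _; rewrite mulrA.
by rewrite E; apply: eq_Rintegral => e _; rewrite /t; ring.
Qed.

(** Stein's identity for [f y = y^3] reads [E[g^4] = 3 E[t g^2]] with [g = K M]. Then
    [3 t g^2 <= g^4 / 2 + 9 t^2 / 2] and [t^2 <= 2 + 2 (1 - t)^2], and half of [E[g^4]] is
    absorbed. *)
Lemma E_arM4_le n (K v : R) :
  \int[mu]_e ((1 - K ^+ 2 * sg ^+ 2 * (arS a n e + arR a n e)) ^+ 2) <= v ->
  \int[mu]_e ((K * arM a n e) ^+ 4) <= 18 * (1 + v).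
Proof.
pose t e := K ^+ 2 * sg ^+ 2 * (arS a n e + arR a n e); move=> tv.
have d3 (x : R) : is_derive x 1 (fun y : R => y ^+ 3) ((fun x => 3%:R * x ^+ 2) x) by exact: is_derive_pow.
have c3 : continuous (fun x : R => 3%:R * x ^+ 2).
  move=> x; apply: cvgM; first exact: cvg_cst.
  by apply: exprn_continuous.
have b1 (y : R) : `|y ^+ 3| <= 9 * (1 + `|y| ^+ 3).
  by rewrite normrX; have := exprn_ge0 3 (normr_ge0 y); lra.
have b2 (y : R) : `|3%:R * y ^+ 2| <= 9 * (1 + `|y| ^+ 3).
  rewrite normrM normrX ger0_norm//; have := normr_ge0 y; move: `|y| => z z0.
  by have [z1|z1] := leP z 1; have := sqr_ge0 z; nra.
have := stein_ibp n K d3 c3 b1 b2; rewrite -/t.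
have aM : allmom mu (fun e => K * arM a n e) by apply: allmomZ; exact: (allmom_arM a rs sg0).
have at_ : allmom mu t.
  by apply: allmomZ; apply: allmomD; [exact: (allmom_arS a rs sg0)|exact: (allmom_arR a rs sg0)].
have i4 : integ mu (fun e => (K * arM a n e) ^+ 4) by apply: allmom_integ; exact: allmomX.
have i1 : integ mu (fun e => (1 - t e) ^+ 2).
  by apply: allmom_integ; apply: allmomX; apply: allmomB => //; exact: allmom_cst.
have -> : \int[mu]_e (K * arM a n e * (K * arM a n e) ^+ 3) = \int[mu]_e ((K * arM a n e) ^+ 4).
  by apply: eq_Rintegral => e _; rewrite -exprS.
move=> E.
have : \int[mu]_e ((K * arM a n e) ^+ 4) <=
    \int[mu]_e (2^-1 * (K * arM a n e) ^+ 4 + 9 * (1 + (1 - t e) ^+ 2)).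
  rewrite E; apply: E_le.
  - by apply: allmom_integ; apply: allmomM => //; apply: allmomZ; exact: allmomX.
  - apply: integD; first exact: integZ.
    by apply: integZ; apply: integD => //; exact: integ_cst.
  move=> e; have -> : (K * arM a n e) ^+ 4 = ((K * arM a n e) ^+ 2) ^+ 2 by ring.
  move: ((K * arM a n e) ^+ 2) (t e) => g u.
  by have := sqr_ge0 (g - 3 * u); have := sqr_ge0 (u - 2); lra.
rewrite ED; [|exact: integZ|by apply: integZ; apply: integD => //; exact: integ_cst].
rewrite EZ// EZ; last by apply: integD => //; exact: integ_cst.
rewrite ED//; last exact: integ_cst.
rewrite E_cst; move: tv; rewrite -/t.
by move: (\int[mu]_e ((1 - t e) ^+ 2)) (\int[mu]_e ((K * arM a n e) ^+ 4)) => p q; lra.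
Qed.

(** For the Stein solution [f] attached to [h], the two identities combine into [E h(K M) - E h(N) =
    E[(1 - t) f'(K M)]], with [f'] bounded by [stein_cst] and [t] close to 1 in L^2. *)
Lemma arM_clt n (K v : R) (h : R -> R) : 0 <= v ->
  \int[mu]_e ((1 - K ^+ 2 * sg ^+ 2 * (arS a n e + arR a n e)) ^+ 2) <= v ^+ 2 ->
  (forall x y, `|h x - h y| <= `|x - y|) ->
  integ mu (fun e => h (K * arM a n e)) /\
  `|\int[mu]_e h (K * arM a n e) - \int[gamma 1]_x h x| <= stein_cst R * v.
Proof.
move=> v0; pose t e := K ^+ 2 * sg ^+ 2 * (arS a n e + arR a n e); move=> tv hL.
have hL1 x y : `|h x - h y| <= 1 * `|x - y| by rewrite mul1r.
have [f [f' [df cf' f'C eqn]]] := stein_solution ltr01 ltr01 hL1.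
rewrite divr1 mulr1 in f'C; set C := stein_cst R in f'C *.
have C0 : 0 <= C by exact: le_trans (f'C 0).
have flip := derive_bounded_lip df f'C.
have b1 (y : R) : `|f y| <= (`|f 0| + C) * (1 + `|y| ^+ 3) * 2.
  have := flip y 0; rewrite subr0 => fy.
  have h1 : `|f y| <= C * `|y| + `|f 0|.
    by rewrite -[f y](subrK (f 0)); apply: le_trans (ler_normD _ _) _; rewrite lerD2r.
  have h2 : `|y| <= 1 + `|y| ^+ 3.
    have := normr_ge0 y; move: `|y| => z z0.
    by have [z1|z1] := leP z 1; [have := exprn_ge0 3 z0; lra|have := sqr_ge0 z; nra].
  have h3 : 0 <= `|y| ^+ 3 by rewrite exprn_ge0.
  have := normr_ge0 (f 0); have := normr_ge0 y; nra.
have b1' (y : R) : `|f y| <= ((`|f 0| + C) * 2) * (1 + `|y| ^+ 3) by rewrite mulrAC.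
have b2' (y : R) : `|f' y| <= ((`|f 0| + C) * 2) * (1 + `|y| ^+ 3).
  apply: le_trans (f'C y) _.
  have h3 : 0 <= `|y| ^+ 3 by rewrite exprn_ge0.
  by have := normr_ge0 (f 0); nra.
have cf : continuous f.
  by move=> x; apply: differentiable_continuous; apply/derivable1_diffP; have [] := df x.
have aKM : allmom mu (fun e => K * arM a n e) by apply: allmomZ; exact: (allmom_arM a rs sg0).
have af : allmom mu (fun e => f (K * arM a n e)).
  by apply: (allmom_growth _ b1' aKM); exact: continuous_measurable_fun.
have af' : allmom mu (fun e => f' (K * arM a n e)).
  by apply: (allmom_growth _ b2' aKM); exact: continuous_measurable_fun.
have at_ : allmom mu t.
  by apply: allmomZ; apply: allmomD; [exact: (allmom_arS a rs sg0)|exact: (allmom_arR a rs sg0)].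
have a1t : allmom mu (fun e => 1 - t e) by apply: allmomB => //; exact: allmom_cst.
set m := \int[gamma 1]_x h x.
have hE e : h (K * arM a n e) = f' (K * arM a n e) - K * arM a n e * f (K * arM a n e) + m.
  by have := eqn (K * arM a n e); rewrite expr1n mul1r -/m => ->; ring.
have ifM : integ mu (fun e => K * arM a n e * f (K * arM a n e)) by apply: allmom_integ; exact: allmomM.
have if' : integ mu (fun e => f' (K * arM a n e)) by exact: allmom_integ.
have ih : integ mu (fun e => h (K * arM a n e)).
  have -> : (fun e => h (K * arM a n e)) =
    (fun e => f' (K * arM a n e) - K * arM a n e * f (K * arM a n e) + m) by apply/funext.
  by apply: integD; [exact: integB|exact: integ_cst].
split => //.
under eq_Rintegral do rewrite hE.
rewrite ED; [|exact: integB|exact: integ_cst].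
rewrite E_cst addrK EB// (stein_ibp n K df cf' b1' b2') -/t -EB//; last first.
  by apply: allmom_integ; exact: allmomM.
have -> : \int[mu]_x (f' (K * arM a n x) - t x * f' (K * arM a n x)) =
   \int[mu]_x ((1 - t x) * f' (K * arM a n x)).
  by apply: eq_Rintegral => e _; ring.
apply: le_trans (E_norm _) _; first by apply: allmom_integ; exact: allmomM.
have i1t : integ mu (fun e => `|1 - t e|) by apply: integ_norm; exact: allmom_integ.
apply: (@le_trans _ _ (\int[mu]_x (C * `|1 - t x|))).
  apply: E_le.
  - by apply: integ_norm; apply: allmom_integ; exact: allmomM.
  - exact: integZ.
  by move=> e; rewrite normrM mulrC ler_wpM2r.
rewrite EZ// ler_wpM2l//.
exact: E_norm_le_sqr.
Qed.

End martingale_clt.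

(** * Negative moments of averages of squares *)

Section negative_moments.
Context (R : realType).
Notation gamma s := (@normal_prob R 0 s).

Lemma continuous_quart_inv (eta : R) : 0 < eta -> continuous (quart_inv eta).
Proof.
move=> e0 x; apply: differentiable_continuous; apply/derivable1_diffP.
by have [] := is_derive_quart_inv x e0.
Qed.

Lemma quart_inv_le (eta z : R) : 0 < eta -> quart_inv eta z <= quart_inv eta 0.
Proof.
move=> e0; rewrite ler_expR lerN2 ler_pM2r ?invr_gt0// expr0n add0r.
by rewrite ler_ln ?posrE// ?lerDr ?sqr_ge0// ltr_wpDl// sqr_ge0.
Qed.

Section peeling.
Variables (alpha s : nat -> R) (mu : probability (seqR R) R).
Hypotheses (rs : resampling mu s) (s0 : forall i, s i != 0).

(** Coefficients and variances may vary with the step, because the sampling times of a window,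
    starting at time 0, are not equally spaced. *)
Fixpoint arv (n : nat) (e : seqR R) : R :=
  if n is k.+1 then alpha k * arv k e + e k else 0.

Lemma arv_upd n e i x : (n <= i)%N -> arv n (upd e i x) = arv n e.
Proof.
elim: n => //= n ih ni; rewrite ih ?(ltnW ni)// upd_neq//.
by rewrite neq_ltn ni.
Qed.

Lemma measurable_arv n : measurable_fun setT (arv n).
Proof.
elim: n => [|n ih]; first exact: measurable_cst.
apply: measurable_funD; last exact: measurable_coord.
by apply: measurable_funM => //; exact: measurable_cst.
Qed.

Definition qprod (eta : R) (m : nat) (e : seqR R) : R :=
  \prod_(k < m) quart_inv eta (arv k.+1 e).

Lemma qprod_gt0 eta m e : 0 < qprod eta m e.
Proof. by apply: prodr_gt0 => k _; exact: quart_inv_gt0. Qed.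

Lemma measurable_qprod eta m : 0 < eta -> measurable_fun setT (qprod eta m).
Proof.
move=> e0; elim: m => [|m ih].
  by rewrite [X in measurable_fun _ X](_ : _ = cst 1)//; apply/funext => e; rewrite /qprod big_ord0.
rewrite [X in measurable_fun _ X](_ : _ = fun e => qprod eta m e * quart_inv eta (arv m.+1 e)); last first.
  by apply/funext => e; rewrite /qprod big_ord_recr.
apply: measurable_funM => //; apply: measurableT_comp (measurable_arv m.+1).
by apply: continuous_measurable_fun; exact: continuous_quart_inv.
Qed.

Lemma qprod_le eta m e : 0 < eta -> qprod eta m e <= quart_inv eta 0 ^+ m.
Proof.
move=> e0; rewrite -[X in _ ^+ X]card_ord -prodr_const; apply: ler_prod => k _.
by rewrite ltW ?quart_inv_gt0//= quart_inv_le.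
Qed.

Lemma qprod_upd eta m e i x : (m <= i)%N -> qprod eta m (upd e i x) = qprod eta m e.
Proof.
move=> mi; apply: eq_bigr => k _; rewrite arv_upd//.
exact: leq_trans (ltn_ord k) mi.
Qed.

Lemma integ_qprod eta m : 0 < eta -> integ mu (qprod eta m).
Proof.
move=> e0; apply: (@integ_bounded _ _ _ _ _ (quart_inv eta 0 ^+ m)); first exact: measurable_qprod.
move=> e.
by rewrite ger0_norm ?(ltW (qprod_gt0 _ _ _))//; exact: qprod_le.
Qed.

Lemma E_qprod_le eta m (K : R) : 0 < eta ->
  (forall i, (i < m)%N -> 16 + 2 * (1 + s i ^+ 2) / s i ^+ 2 <= K) ->
  \int[mu]_e qprod eta m e <= K ^+ m.
Proof.
move=> e0; elim: m => [|m ih] sK.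
  under eq_Rintegral do rewrite /qprod big_ord0.
  by rewrite E_cst.
have K0 : 0 <= K.
  apply: le_trans (sK m (ltnSn m)); rewrite addr_ge0//.
  by rewrite divr_ge0 ?sqr_ge0// mulr_ge0// addr_ge0// sqr_ge0.
have F e x : qprod eta m.+1 (upd e m x) = qprod eta m e * quart_inv eta (alpha m * arv m e + x).
  by rewrite {1}/qprod big_ord_recr -/(qprod eta m _) /= upd_eq arv_upd// qprod_upd.
have iq e : integ (gamma (s m)) (fun x => quart_inv eta (alpha m * arv m e + x)).
  by have [] := quart_inv_gauss (alpha m * arv m e) (s0 m) e0.
have [|iI ->] := resampling_E (i := m) rs (integ_qprod m.+1 e0).
  by move=> e; under eq_fun do rewrite F; exact: integZ.
apply: (@le_trans _ _ (\int[mu]_e (K * qprod eta m e))).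
  apply: E_le => //; first by apply: integZ; exact: integ_qprod.
  move=> e; under eq_Rintegral do rewrite F.
  rewrite EZ// mulrC ler_wpM2r ?(ltW (qprod_gt0 _ _ _))//.
  have [_ /le_trans] := quart_inv_gauss (alpha m * arv m e) (s0 m) e0; apply.
  exact: sK.
rewrite EZ; last exact: integ_qprod.
by rewrite exprS ler_wpM2l// ih// => i im; apply: sK; rewrite ltnW.
Qed.

(** Coordinate [i] enters none of the first [m] values, so it integrates out separately. This serves
    the finiteness of the distances at a fixed sample size. *)
Lemma E_coord_qprod_le eta m i (K : R) : 0 < eta -> (m <= i)%N ->
  (forall i, (i < m)%N -> 16 + 2 * (1 + s i ^+ 2) / s i ^+ 2 <= K) ->
  integ mu (fun e => `|e i| * qprod eta m e) /\
  \int[mu]_e (`|e i| * qprod eta m e) <= (1 + s i ^+ 2) / 2 * K ^+ m.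
Proof.
move=> e0 mi sK.
have aci : allmom mu (fun e : seqR R => `|e i|).
  by apply: allmom_norm; exact: (allmom_coord rs s0).
have aq : allmom mu (qprod eta m).
  apply: (@allmom_bounded _ _ _ _ (quart_inv eta 0 ^+ m)); first exact: measurable_qprod.
  move=> e.
  by rewrite ger0_norm ?(ltW (qprod_gt0 _ _ _))//; exact: qprod_le.
have iF : integ mu (fun e : seqR R => `|e i| * qprod eta m e).
  by apply: allmom_integ; exact: allmomM.
split => //.
have F e x : `|upd e i x i| * qprod eta m (upd e i x) = qprod eta m e * `|x|.
  by rewrite upd_eq qprod_upd// mulrC.
have [|iI ->] := resampling_E (i := i) rs iF.
  by move=> e; under eq_fun do rewrite F; apply: integZ; exact: integ_gauss_norm.
apply: (@le_trans _ _ (\int[mu]_e ((1 + s i ^+ 2) / 2 * qprod eta m e))).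
  apply: E_le => //; first by apply: integZ; exact: integ_qprod.
  move=> e; under eq_Rintegral do rewrite F.
  rewrite EZ; last exact: integ_gauss_norm.
  by rewrite mulrC ler_wpM2r ?(ltW (qprod_gt0 _ _ _))// gauss_norm_le.
rewrite EZ; last exact: integ_qprod.
rewrite ler_wpM2l ?E_qprod_le//.
by rewrite divr_ge0// addr_ge0// sqr_ge0.
Qed.

End peeling.

(** Jensen's inequality for [y^-4], through the tangent at the mean [b]:
    [y^-4 >= b^-4 (5 - 4 y / b)]. *)
Lemma inv4_convex (m : nat) (B : nat -> R) : (0 < m)%N -> (forall i, 0 < B i) ->
  ((\sum_(i < m) B i) / m%:R)^-1 ^+ 4 <= (\sum_(i < m) (B i)^-1 ^+ 4) / m%:R.
Proof.
move=> m0 B0.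
have tangent0 (b : R) i : 0 < b -> b^-1 ^+ 4 * (5 - 4 * (B i / b)) <= (B i)^-1 ^+ 4.
  move=> b0; have u0 : 0 < B i / b by rewrite divr_gt0.
  have -> : B i = B i / b * b by rewrite divfK// gt_eqF.
  rewrite mulfK ?gt_eqF//; move: (B i / b) u0 => u u0.
  rewrite invfM exprMn mulrC ler_wpM2r ?exprn_ge0 ?invr_ge0 ?(ltW b0)//.
  rewrite exprVn -[leRHS]mul1r ler_pdivlMr ?exprn_gt0//.
  rewrite -subr_ge0.
  have -> : 1 - (5 - 4 * u) * u ^+ 4 = (u - 1) ^+ 2 * (4 * u ^+ 3 + 3 * u ^+ 2 + 2 * u + 1) by ring.
  by rewrite mulr_ge0 ?sqr_ge0// !addr_ge0// mulr_ge0// ?exprn_ge0// ltW.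
set b := (\sum_(i < m) B i) / m%:R.
have mr : 0 < m%:R :> R by rewrite ltr0n.
have b0 : 0 < b.
  apply: divr_gt0 => //; case: m m0 @b mr => // m _ _ _.
  by rewrite big_ord_recr ltr_wpDl// sumr_ge0// => i _; exact: ltW.
have tangent i := tangent0 b i b0.
rewrite ler_pdivlMr//; apply: le_trans (ler_sum _ (fun (i : 'I_m) _ => tangent i)).
rewrite -mulr_sumr ler_wpM2l ?exprn_ge0 ?invr_ge0 ?(ltW b0)//.
rewrite sumrB sumr_const card_ord -mulr_sumr -mulr_suml.
have -> : \sum_(i < m) B i = b * m%:R by rewrite /b divfK// gt_eqF.
rewrite le_eqVlt; apply/orP; left; apply/eqP; rewrite -[5 *+ m]mulr_natr.
by field; rewrite gt_eqF.
Qed.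

(** The arithmetic-geometric inequality over 16 terms bounds the mean to the power -4 by the product
    to the power [-4/16 = -1/4], which is the exponent in [quart_inv]. *)
Lemma inv4_AGM (m : nat) (z : nat -> R) (eta : R) : 0 < eta ->
  ((\sum_(k < 16) (z k ^+ 2 + eta)) / 16)^-1 ^+ 4 <= \prod_(k < 16) quart_inv eta (z k).
Proof.
move=> e0; have y0 k : 0 < z k ^+ 2 + eta by rewrite ltr_wpDl// sqr_ge0.
have q0 : 0 < \prod_(k < 16) quart_inv eta (z k) by apply: prodr_gt0 => k _; exact: quart_inv_gt0.
have s0 : 0 < (\sum_(k < 16) (z k ^+ 2 + eta)) / 16.
  by rewrite divr_gt0// big_ord_recr ltr_wpDl// sumr_ge0// => i _; exact: ltW.
rewrite -(@ler_pXn2r _ 4)// ?nnegrE ?(ltW q0) ?exprn_ge0 ?invr_ge0 ?(ltW s0)//.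
rewrite -prodrXl; under eq_bigr do rewrite quart_invX4//.
rewrite prodfV -exprM exprVn lef_pV2 ?posrE ?exprn_gt0//; last by apply: prodr_gt0.
have [H _] := @leif_AGM R 'I_16 xpredT (fun k => z k ^+ 2 + eta) (fun k _ => ltW (y0 k)).
by rewrite card_ord in H.
Qed.

(** Each of the 16 shifts of the block of [m] starting points stays inside the full sum. With
    [n <= 2 * m], the average of the window means is at most [2 * (S / n + eta)], which costs the
    factor [16 = 2^4]. Jensen then handles the average over windows, the arithmetic-geometric
    inequality each window. *)
Lemma inv4_window (n m L : nat) (x : nat -> R) (eta : R) : 0 < eta ->
  (0 < m)%N -> (n <= 2 * m)%N -> (m + 16 * L <= n)%N ->
  ((\sum_(i < n) x i ^+ 2) / n%:R + eta)^-1 ^+ 4 <=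
  16 * ((\sum_(i < m) \prod_(k < 16) quart_inv eta (x (i + k.+1 * L)%N)) / m%:R).
Proof.
move=> e0 m0 nm mLn.
have sc (N : nat) (y : R) : \sum_(k < N) y = N%:R * y by rewrite sumr_const card_ord mulr_natl.
have mr : 0 < m%:R :> R by rewrite ltr0n.
have n0 : (0 < n)%N by apply: leq_trans mLn; rewrite addn_gt0 m0.
have nr : 0 < n%:R :> R by rewrite ltr0n.
pose S := \sum_(i < n) x i ^+ 2.
pose B (i : nat) := (\sum_(k < 16) (x (i + k.+1 * L)%N ^+ 2 + eta)) / 16.
have B0 i : 0 < B i.
  rewrite divr_gt0// big_ord_recr ltr_wpDl//; last by rewrite ltr_wpDl// sqr_ge0.
  by rewrite sumr_ge0// => k _; rewrite addr_ge0 ?sqr_ge0// ltW.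
have S0 : 0 <= S by apply: sumr_ge0 => i _; exact: sqr_ge0.
pose b := (\sum_(i < m) B i) / m%:R.
have b0 : 0 < b.
  apply: divr_gt0 => //; case: m m0 {nm mLn mr} @b => // m _ _.
  by rewrite big_ord_recr ltr_wpDl// sumr_ge0// => i _; exact: ltW.
have win (k : 'I_16) : \sum_(i < m) x (i + k.+1 * L)%N ^+ 2 <= S.
  rewrite -(big_mkord xpredT (fun i => x (i + k.+1 * L)%N ^+ 2)) /=.
  rewrite -{1}[m](addnK (k.+1 * L)) -(big_addn 0 _ _ xpredT (fun i => x i ^+ 2)) add0n.
  rewrite /S -(big_mkord xpredT (fun i => x i ^+ 2)).
  have kn : (m + k.+1 * L <= n)%N.
    by apply: leq_trans mLn; rewrite leq_add2l leq_mul2r ltn_ord orbT.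
  rewrite [leRHS](big_cat_nat (leq0n _) (leq_trans (leq_addl m _) kn))/=.
  rewrite [X in _ <= _ + X](big_cat_nat (leq_addl _ _) kn)/=.
  by rewrite addrCA lerDl addr_ge0// sumr_ge0// => i _; exact: sqr_ge0.
have bS : b <= 2 * (S / n%:R + eta).
  have -> : b = (\sum_(k < 16) \sum_(i < m) x (i + k.+1 * L)%N ^+ 2) / 16 / m%:R + eta.
    rewrite /b /B -mulr_suml.
    have -> : \sum_(i < m) \sum_(k < 16) (x (i + k.+1 * L)%N ^+ 2 + eta) =
      \sum_(k < 16) \sum_(i < m) x (i + k.+1 * L)%N ^+ 2 + 16 * m%:R * eta.
      rewrite exchange_big/= -[16 * m%:R * eta]mulrA.
      rewrite (_ : 16 * (m%:R * eta) = \sum_(k < 16) \sum_(i < m) eta); last first.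
        by rewrite !sc.
      rewrite -big_split; apply: eq_bigr => k _; exact: big_split.
    by field; rewrite gt_eqF.
  have h1 : \sum_(k < 16) \sum_(i < m) x (i + k.+1 * L)%N ^+ 2 <= 16 * S.
    apply: le_trans (ler_sum _ (fun k _ => win k)) _.
    by rewrite sc.
  have h2 : (\sum_(k < 16) \sum_(i < m) x (i + k.+1 * L)%N ^+ 2) / 16 <= S.
    by rewrite ler_pdivrMr// mulrC.
  have h3 : (\sum_(k < 16) \sum_(i < m) x (i + k.+1 * L)%N ^+ 2) / 16 / m%:R <= S / m%:R.
    by rewrite ler_wpM2r// invr_ge0 ltW.
  have h4 : S / m%:R <= 2 * (S / n%:R).
    rewrite mulrCA ler_wpM2l// ler_pdivlMr// mulrC ler_pdivrMr//.
    by rewrite -natrM ler_nat.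
  lra.
have A0 : 0 < S / n%:R + eta by rewrite ltr_wpDl// divr_ge0// ltW.
have bE : b = (\sum_(i < m) B i) / m%:R by [].
clearbody b.
apply: (@le_trans _ _ (16 * b^-1 ^+ 4)).
  rewrite -/S (_ : 16 * b^-1 ^+ 4 = (b / 2)^-1 ^+ 4); last first.
    by field; rewrite gt_eqF.
  rewrite ler_pXn2r ?nnegrE ?invr_ge0 ?(ltW A0) ?divr_ge0 ?(ltW b0)//.
  by rewrite lef_pV2 ?posrE// ?divr_gt0// ler_pdivrMr// mulrC.
rewrite ler_wpM2l// bE; apply: le_trans (inv4_convex m0 B0) _.
rewrite ler_wpM2r ?invr_ge0 ?(ltW mr)//; apply: ler_sum => i _.
exact: (inv4_AGM 0 (fun k => x (i + k.+1 * L)%N)).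
Qed.

End negative_moments.

(** * Estimates in terms of [theta], [Delta] and [T] *)

Section sampled_autoregression.
Context (R : realType) (theta Delta : R) (n : nat) (mu : probability (seqR R) R).
Notation gamma s := (@normal_prob R 0 s).
Notation a := (expR (- (theta * Delta))).
Notation c := ((2 * theta)^-1).
Notation T := (n%:R * Delta).
Notation kappa := (Num.sqrt (2 * theta / T)).

Definition ar_sd : R := Num.sqrt (c * (1 - a ^+ 2)).

Hypotheses (theta0 : 0 < theta) (Delta0 : 0 < Delta).

Lemma ar_coef_lt1 : a < 1.
Proof. by rewrite -expR0 ltr_expR oppr_lt0 mulr_gt0. Qed.

Lemma ar_coefX2 : a ^+ 2 = expR (- (2 * theta * Delta)).
Proof. by rewrite -expRM_natl; congr expR; ring. Qed.

Lemma ar_c_gt0 : 0 < c.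
Proof. by rewrite invr_gt0 mulr_gt0. Qed.

Lemma ar_rho_gt0 : 0 < 1 - a ^+ 2.
Proof. by rewrite subr_gt0 expr_lt1 ?expR_ge0// ar_coef_lt1. Qed.

Lemma ar_sd_gt0 : 0 < ar_sd.
Proof. by rewrite sqrtr_gt0 mulr_gt0 ?ar_c_gt0 ?ar_rho_gt0. Qed.

Lemma ar_sdX2 : ar_sd ^+ 2 = c * (1 - a ^+ 2).
Proof. by rewrite sqr_sqrtr// mulr_ge0// ltW ?ar_c_gt0 ?ar_rho_gt0. Qed.

Lemma expRN_le (y : R) : 0 <= y -> expR (- y) <= (1 + y)^-1.
Proof.
move=> y0; rewrite expRN lef_pV2 ?posrE ?expR_gt0 ?expR_ge1Dx//.
by rewrite ltr_wpDr.
Qed.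

Lemma ar_rho_le : 1 - a ^+ 2 <= 2 * theta * Delta.
Proof.
rewrite ar_coefX2; have := expR_ge1Dx (- (2 * theta * Delta)); lra.
Qed.

Lemma ar_rho_ge : 2 * theta * Delta * (1 - 2 * theta * Delta) <= 1 - a ^+ 2.
Proof.
set y := 2 * theta * Delta; have y0 : 0 < y by rewrite !mulr_gt0.
have := expRN_le (ltW y0); rewrite ar_coefX2 -/y => h.
have : (1 + y)^-1 <= 1 - y * (1 - y).
  rewrite -[leLHS]mul1r ler_pdivrMr ?ltr_wpDr ?(ltW y0)//; nra.
lra.
Qed.

Lemma ar_bias : `|(1 - a) / Delta - theta| <= theta ^+ 2 * Delta.
Proof.
set y := theta * Delta; have y0 : 0 < y by rewrite mulr_gt0.
have h1 := expRN_le (ltW y0); have h2 := expR_ge1Dx (- y).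
have h3 : (1 + y)^-1 <= 1 - y + y ^+ 2.
  rewrite -[leLHS]mul1r ler_pdivrMr ?ltr_wpDr ?(ltW y0)//.
  have -> : (1 - y + y ^+ 2) * (1 + y) = 1 + y ^+ 3 by ring.
  by rewrite lerDl exprn_ge0// ltW.
have -> : (1 - expR (- y)) / Delta - theta = (1 - expR (- y) - y) / Delta.
  by rewrite /y; field; rewrite gt_eqF.
rewrite normrM [X in _ * X]gtr0_norm ?invr_gt0// ler_pdivrMr//.
have -> : theta ^+ 2 * Delta * Delta = y ^+ 2 by rewrite /y; ring.
by rewrite ler_norml; apply/andP; split; lra.
Qed.

Hypotheses (rs : resampling mu (fun=> ar_sd)).
Hypotheses (Delta_small : 8 * theta * Delta <= 1) (T_large : 1 <= T) (T_large' : 2 <= theta * T).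

(** Smallness of [Delta] makes [2 * (1 - 2 * theta * Delta)] at least 1. With [2 <= theta * T], the
    lower bound supplies the condition of [E_arS_dev] and [stein_defect]. *)
Lemma ar_nrho : theta * T <= n%:R * (1 - a ^+ 2) <= 2 * theta * T.
Proof.
have nD : 0 <= n%:R :> R by [].
have h1 := ler_wpM2l nD ar_rho_ge; have h2 := ler_wpM2l nD ar_rho_le.
have T0 : 0 < T by exact: lt_le_trans T_large.
apply/andP; split; last by apply: le_trans h2 _; rewrite le_eqVlt; apply/orP; left; apply/eqP; ring.
apply: le_trans h1.
have -> : n%:R * (2 * theta * Delta * (1 - 2 * theta * Delta)) = theta * T * (2 * (1 - 2 * theta * Delta)) by ring.
have : 0 < theta * T by exact: mulr_gt0.
move: (theta * T) => z z0; rewrite ler_peMr ?(ltW z0)//; move: Delta_small; lra.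
Qed.

Lemma ar_scale : kappa ^+ 2 * ar_sd ^+ 2 = (1 - a ^+ 2) / T.
Proof.
have T0 : 0 < T by exact: lt_le_trans T_large.
rewrite ar_sdX2 sqr_sqrtr; last by rewrite divr_ge0 ?(ltW T0)// mulr_ge0// ltW.
have n0 : n%:R != 0 :> R by apply: contraTneq T0 => ->; rewrite mul0r ltxx.
by field; rewrite n0 !gt_eqF.
Qed.

(** In [stein_defect], [l * n * c] equals [(1 - a^2) / (2 theta Delta)], which lies within
    [2 theta Delta] of 1; the fluctuation term is of order [1 / T]. *)
Lemma ar_defect :
  \int[mu]_e ((1 - kappa ^+ 2 * ar_sd ^+ 2 * (arS a n e + arR a n e)) ^+ 2) <=
  3 * (4 * theta ^+ 2 * Delta ^+ 2 + 31 * c / T).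
Proof.
have T0 : 0 < T by exact: lt_le_trans T_large.
have n0 : n%:R != 0 :> R by apply: contraTneq T0 => ->; rewrite mul0r ltxx.
have /andP[nr1 nr2] := ar_nrho.
have nr : 1 <= n%:R * (1 - a ^+ 2) by apply: le_trans nr1; move: T_large'; lra.
apply: le_trans (stein_defect rs ar_sd_gt0 (expR_gt0 _) ar_coef_lt1 ar_c_gt0 ar_sdX2 _ nr) _.
rewrite ar_scale ler_wpM2l//; apply: lerD.
  have -> : (1 - a ^+ 2) / T * n%:R * c = (1 - a ^+ 2) / (2 * theta * Delta).
    by field; rewrite n0 !gt_eqF.
  have y0 : 0 < 2 * theta * Delta by rewrite !mulr_gt0.
  have r1 : (1 - a ^+ 2) / (2 * theta * Delta) <= 1 by rewrite ler_pdivrMr// mul1r ar_rho_le.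
  have r2 : 1 - 2 * theta * Delta <= (1 - a ^+ 2) / (2 * theta * Delta).
    by rewrite ler_pdivlMr// mulrC ar_rho_ge.
  have -> : 4 * theta ^+ 2 * Delta ^+ 2 = (2 * theta * Delta) ^+ 2 by ring.
  rewrite ler_pXn2r ?nnegrE ?(ltW y0) ?subr_ge0//.
  move: r2; lra.
have rho0 := ar_rho_gt0.
have -> : ((1 - a ^+ 2) / T) ^+ 2 * (31 * c ^+ 2 * n%:R / (1 - a ^+ 2)) =
   (n%:R * (1 - a ^+ 2)) * (31 * c ^+ 2 / T ^+ 2).
  by field; rewrite n0 !gt_eqF.
have -> : 31 * c / T = 2 * theta * T * (31 * c ^+ 2 / T ^+ 2).
  by field; rewrite n0 !gt_eqF.
apply: ler_wpM2r nr2; rewrite divr_ge0 ?exprn_ge0 ?(ltW T0)// mulr_ge0// exprn_ge0// ltW//.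
exact: ar_c_gt0.
Qed.

(** The coefficients 4 and 10 round up the square roots of [12 = 3 * 4] and [93 = 3 * 31] from
    [ar_defect]. *)
Lemma ar_clt (h : R -> R) : (forall x y, `|h x - h y| <= `|x - y|) ->
  integ mu (fun e => h (- kappa * arM a n e)) /\
  `|\int[mu]_e h (- kappa * arM a n e) - \int[gamma 1]_x h x| <=
  stein_cst R * (4 * theta * Delta + 10 * Num.sqrt c / Num.sqrt T).
Proof.
have T0 : 0 < T by exact: lt_le_trans T_large.
move=> hL; apply: (arM_clt rs ar_sd_gt0 _ _ hL).
  by rewrite addr_ge0 ?mulr_ge0 ?(ltW theta0) ?(ltW Delta0)//.
rewrite sqrrN; apply: le_trans ar_defect _.
have -> : (4 * theta * Delta + 10 * Num.sqrt c / Num.sqrt T) ^+ 2 =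
  16 * theta ^+ 2 * Delta ^+ 2 + 100 * (Num.sqrt c) ^+ 2 / (Num.sqrt T) ^+ 2 +
  8 * theta * Delta * (10 * Num.sqrt c / Num.sqrt T).
  by field; rewrite gt_eqF// sqrtr_gt0.
rewrite !sqr_sqrtr ?(ltW T0) ?(ltW ar_c_gt0)//.
have h1 : 0 <= 8 * theta * Delta * (10 * Num.sqrt c / Num.sqrt T).
  by rewrite mulr_ge0 ?divr_ge0 ?sqrtr_ge0 ?mulr_ge0 ?sqrtr_ge0 ?(ltW theta0) ?(ltW Delta0).
have h2 : 0 <= theta ^+ 2 * Delta ^+ 2 by rewrite mulr_ge0// sqr_ge0.
have h3 : 0 <= c / T by rewrite divr_ge0// ltW// ar_c_gt0.
move: h1 h2 h3; rewrite -![31 * c / T]mulrA -![100 * c / T]mulrA.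
rewrite -![4 * theta ^+ 2 * _]mulrA -![16 * theta ^+ 2 * _]mulrA.
move: (theta ^+ 2 * Delta ^+ 2) (c / T) (8 * theta * _ * _) => p q r; lra.
Qed.

Lemma ar_fourth : \int[mu]_e ((- kappa * arM a n e) ^+ 4) <= 18 * (4 + 93 * c).
Proof.
have T0 : 0 < T by exact: lt_le_trans T_large.
have := @E_arM4_le _ a _ _ rs ar_sd_gt0 n (- kappa) (3 * (4 * theta ^+ 2 * Delta ^+ 2 + 31 * c / T)).
rewrite sqrrN => /(_ ar_defect) /le_trans; apply.
have h1 : theta ^+ 2 * Delta ^+ 2 <= 1 / 64.
  rewrite -exprMn (_ : 1 / 64 = (1 / 8) ^+ 2); last by field.
  rewrite ler_pXn2r ?nnegrE ?mulr_ge0 ?(ltW theta0) ?(ltW Delta0)//.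
  move: Delta_small; lra.
have h2 : c / T <= c.
  by rewrite ler_pdivrMr// ler_peMr// ltW// ar_c_gt0.
rewrite -mulrA -[31 * c / T]mulrA.
move: h1 h2; move: (theta ^+ 2 * Delta ^+ 2) (c / T) c => p q z; lra.
Qed.

Lemma ar_average : \int[mu]_e ((arS a n e / n%:R - c) ^+ 2) <= 27 * c ^+ 2 / theta / T.
Proof.
have T0 : 0 < T by exact: lt_le_trans T_large.
have n0 : 0 < n%:R :> R by rewrite -(pmulr_lgt0 _ Delta0).
have /andP[nr1 nr2] := ar_nrho.
have nr : 1 <= n%:R * (1 - a ^+ 2) by apply: le_trans nr1; move: T_large'; lra.
have E e : (arS a n e / n%:R - c) ^+ 2 = n%:R ^- 2 * (arS a n e - n%:R * c) ^+ 2.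
  by field; rewrite !gt_eqF.
under eq_Rintegral do rewrite E.
rewrite EZ; last first.
  apply: allmom_integ; apply: allmomX; apply: allmomB; last exact: allmom_cst.
  exact: (allmom_arS a rs ar_sd_gt0).
have := E_arS_dev rs ar_sd_gt0 (expR_gt0 _) ar_coef_lt1 ar_c_gt0 ar_sdX2 nr.
have n20 : 0 <= n%:R ^- 2 :> R by rewrite invr_ge0 sqr_ge0.
move=> /(ler_wpM2l n20) /le_trans; apply.
have rho0 := ar_rho_gt0.
have -> : n%:R ^- 2 * (27 * c ^+ 2 * n%:R / (1 - a ^+ 2)) = 27 * c ^+ 2 / (n%:R * (1 - a ^+ 2)).
  by field; rewrite !gt_eqF.
rewrite -[leRHS]mulrA -invfM ler_wpM2l//; first by rewrite mulr_ge0// sqr_ge0.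
by rewrite lef_pV2 ?posrE ?mulr_gt0.
Qed.

(** Summing the geometric series in [E_arM2] gives exactly [(1 - a^2) / (2 theta Delta) - (c / T) (1
    - a^(2 n))]. *)
Lemma ar_variance :
  1 - 2 * theta * Delta - c / T <= 2 * theta / T * \int[mu]_e (arM a n e ^+ 2) <= 1.
Proof.
have T0 : 0 < T by exact: lt_le_trans T_large.
have n0 : 0 < n%:R :> R by rewrite -(pmulr_lgt0 _ Delta0).
have rho0 := ar_rho_gt0.
rewrite (E_arM2 rs ar_sd_gt0 ar_sdX2) ar_sdX2 -mulr_sumr.
have geo : (1 - a ^+ 2) * \sum_(i < n) (1 - a ^+ 2 ^+ i) = (1 - a ^+ 2) * n%:R - (1 - a ^+ 2 ^+ n).
  rewrite sumrB sumr_const card_ord mulrBr -[1 *+ n]/(n%:R); congr (_ - _).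
  by rewrite -[X in _ = X - _](expr1n _ n) subrXX; congr (_ * _); apply: eq_bigr => i _; rewrite expr1n mul1r.
have -> : 2 * theta / T * (c * (1 - a ^+ 2) * (c * \sum_(i < n) (1 - a ^+ 2 ^+ i))) =
   c / T * ((1 - a ^+ 2) * \sum_(i < n) (1 - a ^+ 2 ^+ i)) by field; rewrite !gt_eqF.
rewrite geo mulrBr.
have an : 0 <= a ^+ 2 ^+ n <= 1 by rewrite exprn_ge0 ?sqr_ge0// exprn_ile1 ?sqr_ge0// -subr_ge0 ltW.
have -> : c / T * ((1 - a ^+ 2) * n%:R) = (1 - a ^+ 2) / (2 * theta * Delta) by field; rewrite !gt_eqF.
have y0 : 0 < 2 * theta * Delta by rewrite !mulr_gt0.
have r1 : (1 - a ^+ 2) / (2 * theta * Delta) <= 1 by rewrite ler_pdivrMr// mul1r ar_rho_le.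
have r2 : 1 - 2 * theta * Delta <= (1 - a ^+ 2) / (2 * theta * Delta).
  by rewrite ler_pdivlMr// mulrC ar_rho_ge.
have cT : 0 <= c / T by rewrite divr_ge0// ltW// ar_c_gt0.
case/andP: an => an0 an1.
have h1 : 0 <= c / T * (1 - a ^+ 2 ^+ n) by rewrite mulr_ge0// subr_ge0.
have h2 : c / T * (1 - a ^+ 2 ^+ n) <= c / T by rewrite ler_piMr// gerBl.
by apply/andP; split; [move: r2 h2|move: r1 h1]; lra.
Qed.

End sampled_autoregression.

(** * Negative moments of the sampled process; its autoregression *)

Section OU_sampling.
Context d (Omega : measurableType d) (R : realType) (P : probability Omega R).
Variables (theta : R) (W X : R -> {RV P >-> R}).
Hypotheses (theta_gt0 : 0 < theta) (BM : brownian_motion W) (OU : OU_process theta W X).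

(** The bound of [quart_inv_gauss], [16 + 2 (1 + v) / v = 18 + 2 / v], at the noise variance [v]
    over one unit of time. *)
Definition quart_bound : R := 18 + 4 * theta / (1 - expR (- (2 * theta))).

Lemma quart_bound_ge0 : 0 <= quart_bound.
Proof.
rewrite addr_ge0// divr_ge0// ?mulr_ge0 ?(ltW theta_gt0)// subr_ge0.
by rewrite -expR0 ler_expR oppr_le0 mulr_ge0// ltW.
Qed.

(** Gaps of at least one unit of time keep every noise variance above its value for a unit gap, so
    one bound serves all factors. *)
Lemma OU_neg_moment (t : nat -> R) (eta : R) (m : nat) : 0 < eta ->
  t 0%N = 0 -> (forall l, 1 <= t l.+1 - t l) ->
  integ P (fun w => \prod_(k < m) quart_inv eta (X (t k.+1) w)) /\
  \int[P]_w (\prod_(k < m) quart_inv eta (X (t k.+1) w)) <= quart_bound ^+ m.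
Proof.
move=> eta0 t0 t1.
have tS l : t l < t l.+1 by rewrite -subr_gt0 (lt_le_trans ltr01).
have t00 : 0 <= t 0%N by rewrite t0.
have [mu [rs _ muE]] := OU_grid_law theta_gt0 BM OU t00 tS.
have s0 i : OU_noise_sd theta t i != 0 by rewrite gt_eqF// OU_noise_sd_gt0.
pose alpha k := expR (- (theta * (t k.+1 - t k))).
have arX : {ae P, forall w, forall k, arv alpha k (OU_noise theta X t ^~ w) = X (t k) w}.
  apply: filterS OU => w [_ X0 _]; elim=> [|k ih]; first by rewrite t0 X0.
  by rewrite /= ih /OU_noise addrC subrK.
have mX : measurable_fun setT (fun w => \prod_(k < m) quart_inv eta (X (t k.+1) w)).
  apply: (measurable_prod_ord m xpredT (f := fun k w => quart_inv eta (X (t k.+1) w))) => k.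
  apply: measurableT_comp; last exact: measurable_funP.
  by apply: continuous_measurable_fun; exact: continuous_quart_inv.
have [iq Eq] := muE _ (integ_qprod alpha mu m eta0).
have ae : {ae P, forall w, \prod_(k < m) quart_inv eta (X (t k.+1) w) =
    qprod alpha eta m (OU_noise theta X t ^~ w)}.
  by apply: filterS arX => w wX; apply: eq_bigr => k _; rewrite wX.
split; first exact: integ_ae ae iq.
rewrite (E_ae mX (integ_meas iq) ae) -Eq.
apply: (E_qprod_le alpha rs s0 eta0) => i im.
have sd0 := OU_noise_sd_gt0 theta_gt0 tS i.
have v0 : 0 < (1 - expR (- (2 * theta))) / (2 * theta).
  by rewrite divr_gt0 ?mulr_gt0// subr_gt0 -expR0 ltr_expR oppr_lt0 mulr_gt0.
have vle : (1 - expR (- (2 * theta))) / (2 * theta) <= OU_noise_sd theta t i ^+ 2.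
  rewrite sqr_sqrtr; last first.
    by rewrite ltW// -sqrtr_gt0.
  rewrite ler_wpM2r ?invr_ge0 ?mulr_ge0 ?(ltW theta_gt0)// lerD2l lerN2 ler_expR lerN2.
  by rewrite ler_peMr ?mulr_ge0 ?(ltW theta_gt0).
have sd20 : 0 < OU_noise_sd theta t i ^+ 2 by rewrite exprn_gt0.
move: (OU_noise_sd theta t i ^+ 2) vle sd20 => v vle vp.
have -> : 16 + 2 * (1 + v) / v = 18 + 2 / v by field; rewrite gt_eqF.
rewrite /quart_bound lerD2l.
have -> : 4 * theta / (1 - expR (- (2 * theta))) = 2 / ((1 - expR (- (2 * theta))) / (2 * theta)).
  by field; rewrite !gt_eqF// subr_gt0 -expR0 ltr_expR oppr_lt0 mulr_gt0.
by rewrite ler_wpM2l// lef_pV2 ?posrE.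
Qed.

(** A step of [L] grid points lasts between 1 and 2 units of time. Since [64 = 32 * 2], this gives
    [32 * L <= n], so [m = n - 16 * L] starting points leave room for 16 steps and still make up at
    least half of the sample. *)
Lemma OU_avg_neg_moment (Delta eta : R) (n : nat) :
  0 < Delta -> Delta <= 1 -> 64 <= n%:R * Delta -> 0 < eta ->
  let A w := (\sum_(i < n) X (i%:R * Delta) w ^+ 2) / n%:R in
  integ P (fun w => (A w + eta)^-1 ^+ 4) /\
  \int[P]_w ((A w + eta)^-1 ^+ 4) <= 16 * quart_bound ^+ 16.
Proof.
move=> D0 D1 T64 eta0 A.
pose L := (Num.truncn Delta^-1).+1.
have Di0 : 0 <= Delta^-1 by rewrite invr_ge0 ltW.
have /andP[L1 L2] := truncn_itv Di0.
have LD : 1 <= L%:R * Delta by rewrite -ler_pdivrMr// mul1r ltW.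
have LD2 : L%:R * Delta <= 2.
  rewrite -ler_pdivlMr// /L -natr1; apply: le_trans (lerD L1 (lexx _)) _.
  have : 1 <= Delta^-1 by rewrite invf_ge1.
  lra.
have n32 : (32 * L <= n)%N.
  rewrite -(ler_nat R) natrM -(ler_pM2r D0) -mulrA; apply: le_trans T64.
  have -> : 64 = 32 * 2 :> R by ring.
  by rewrite ler_wpM2l.
pose m := (n - 16 * L)%N.
have L0 : (0 < L)%N by [].
have m0 : (0 < m)%N by rewrite subn_gt0 (leq_trans _ n32)// ltn_mul2r L0.
have nm : (n <= 2 * m)%N by
  rewrite /m mulnBr mulnA leq_subRL ?mul2n -?addnn ?leq_add2r// (leq_trans n32)// leq_addr.
have mn : (m + 16 * L <= n)%N by rewrite /m subnK// (leq_trans _ n32)// leq_mul2r orbT.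
(* Index 0 is sent to time 0, where the recursion starts from [X = 0]. The first gap depends on [i],
   but it too is at least 1. *)
pose tt (i l : nat) : R := if l is 0%N then 0 else (i + l * L)%:R * Delta.
have tt1 i l : 1 <= tt i l.+1 - tt i l.
  case: l => [|l] /=.
    rewrite subr0 mul1n; apply: le_trans LD _.
    by rewrite ler_wpM2r ?(ltW D0)// ler_nat leq_addl.
  rewrite -mulrBl mulSn addnCA natrD addrK; exact: LD.
have neg i := OU_neg_moment 16 eta0 (erefl : tt i 0%N = 0) (tt1 i).
have A0 w : 0 <= A w by rewrite divr_ge0// sumr_ge0// => i _; exact: sqr_ge0.
have mA : measurable_fun setT (fun w => (A w + eta)^-1 ^+ 4).
  have mA1 : measurable_fun setT A.
    apply: measurable_funM; last exact: measurable_cst.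
    by apply: measurable_sum => i; apply: measurable_funX; exact: measurable_funP.
  have -> : (fun w => (A w + eta)^-1 ^+ 4) = (fun y => (`|y| + eta)^-1 ^+ 4) \o A.
    by apply/funext => w /=; rewrite ger0_norm.
  apply: measurableT_comp mA1; apply: continuous_measurable_fun => y.
  apply: (@continuous_comp _ _ _ (fun y => (`|y| + eta)^-1) (fun z => z ^+ 4)); last exact: exprn_continuous.
  apply: cvgV; first by rewrite gt_eqF// ltr_wpDl.
  by apply: cvgD; [exact: norm_continuous|exact: cvg_cst].
have dom w : (A w + eta)^-1 ^+ 4 <=
    16 / m%:R * \sum_(i < m) \prod_(k < 16) quart_inv eta (X (tt i k.+1) w).
  rewrite -[leRHS]mulrA [_^-1 * _]mulrC.
  exact: (@inv4_window R n m L (fun i => X (i%:R * Delta) w) eta eta0 m0 nm mn).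
have iS : integ P (fun w => \sum_(i < m) \prod_(k < 16) quart_inv eta (X (tt i k.+1) w)).
  by apply: (integ_sum (F := fun i w => _)) => i; exact: (neg i).1.
have iA : integ P (fun w => (A w + eta)^-1 ^+ 4).
  apply: (integ_le mA (integZ (16 / m%:R) iS)) => w.
  by rewrite ger0_norm ?dom// exprn_ge0// invr_ge0 addr_ge0// ltW.
split => //.
apply: le_trans (E_le iA (integZ (16 / m%:R) iS) dom) _.
rewrite EZ// (E_sum (F := fun i w => \prod_(k < 16) quart_inv eta (X (tt i k.+1) w))); last first.
  by move=> i; exact: (neg i).1.
have mr : 0 < m%:R :> R by rewrite ltr0n.
apply: (@le_trans _ _ (16 / m%:R * \sum_(i < m) quart_bound ^+ 16)).
  rewrite ler_wpM2l ?divr_ge0 ?(ltW mr)//; apply: ler_sum => i _; exact: (neg i).2.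
rewrite sumr_const card_ord -[quart_bound ^+ 16 *+ m]mulr_natl.
by rewrite mulrA divfK// gt_eqF.
Qed.

Definition sample_noise (Delta : R) (l : nat) (w : Omega) : R :=
  X (l.+1%:R * Delta) w - expR (- (theta * Delta)) * X (l%:R * Delta) w.

Lemma OU_sample_law (Delta : R) : 0 < Delta ->
  exists mu : probability (seqR R) R,
  [/\ resampling mu (fun=> ar_sd theta Delta),
      forall F : seqR R -> R, integ mu F ->
        integ P (fun w => F (sample_noise Delta ^~ w)) /\
        \int[mu]_e F e = \int[P]_w F (sample_noise Delta ^~ w) &
      {ae P, forall w, forall n, X (n%:R * Delta) w =
        ar (expR (- (theta * Delta))) n (sample_noise Delta ^~ w)}].
Proof.
move=> D0; pose t (l : nat) : R := l%:R * Delta.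
have tD l : t l.+1 - t l = Delta by rewrite /t -natr1; ring.
have tS l : t l < t l.+1 by rewrite -subr_gt0 tD.
have t00 : 0 <= t 0%N by rewrite /t mul0r.
have [mu [rs _ muE]] := OU_grid_law theta_gt0 BM OU t00 tS.
have nE : OU_noise theta X t = sample_noise Delta.
  by apply/funext => l; apply/funext => w; rewrite /OU_noise tD.
exists mu; split.
- rewrite (_ : (fun=> _) = OU_noise_sd theta t)//; apply/funext => l.
  rewrite /ar_sd /OU_noise_sd tD mulrC; congr (Num.sqrt ((_ - _) / _)).
  by rewrite -expRM_natl; congr expR; ring.
- by move=> F iF; have := muE F iF; rewrite nE.
- apply: filterS OU => w [_ X0 _]; elim=> [|k ih]; first by rewrite mul0r X0.
  by rewrite /= -ih /sample_noise addrC subrK.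
Qed.

End OU_sampling.

(** * Wasserstein bounds by coupling *)

Section coupling.
Context d (Omega : measurableType d) (R : realType) (P : probability Omega R).
Context d' (Omega' : measurableType d') (Q : probability Omega' R) (N : {RV Q >-> R}).
Hypothesis lawN : forall A : set R, measurable A -> distribution Q N A = normal_prob 0 1 A.
Notation gamma s := (@normal_prob R 0 s).

Lemma E_gaussian_rv (f : R -> R) : (forall x y, `|f x - f y| <= `|x - y|) ->
  'E_Q[f \o N]%E = (\int[gamma 1]_x f x)%:E.
Proof.
move=> fL.
have fL1 x y : `|f x - f y| <= 1 * `|x - y| by rewrite mul1r.
have ifg : integ (gamma 1) f by apply: integ_gauss_lip fL1; exact: oner_neq0.
have mf : measurable_fun setT f by apply: continuous_measurable_fun; exact: lip_continuous fL1.
have mN0 : measurable_fun setT (N : Omega' -> R) by exact: measurable_funP.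
have mN : measurable_fun setT (N : Omega' -> measurableTypeR R) by exact: mN0.
pose nu0 : {measure set (measurableTypeR R) -> \bar R} := pushforward Q (N : Omega' -> measurableTypeR R).
pose nu := nu0 mN.
have nuE (g : R -> \bar R) : (\int[nu]_x g x = \int[gamma 1]_x g x)%E.
  by apply: eq_measure_integral => A mA _; exact: lawN.
have inu : integ nu f.
  have /integrableP[mf' ff] := ifg; apply/integrableP; split => //.
  by rewrite nuE.
rewrite unlock -E_fine// -nuE.
have iP : integ Q (fun w => f (N w)).
  apply/integrableP; split; first by apply/measurable_EFinP; exact: measurableT_comp mf mN.
  have /integrableP[_] := inu; rewrite (ge0_integral_pushforward mN)//.
  by apply: measurableT_comp => //; exact/measurable_EFinP.
by rewrite (integral_pushforward mN)//; exact/measurable_EFinP.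
Qed.

(** A 1-Lipschitz [f] changes by at most [|U - g|] between [g] and [U]. Integrability of [f (U)] is
    deduced from that of [f (g)] and of [U - g]. *)
Lemma wasserstein_coupling (U g : Omega -> R) (B1 B2 : R) :
  measurable_fun setT U ->
  (forall f : R -> R, (forall x y, `|f x - f y| <= `|x - y|) ->
    integ P (fun w => f (g w)) /\
    `|\int[P]_w f (g w) - \int[gamma 1]_x f x| <= B1) ->
  (\int[P]_w `|U w - g w|%:E <= B2%:E)%E ->
  (wasserstein P Q U N <= (B1 + B2)%:E)%E.
Proof.
move=> mU fg UgB.
apply: ge_ereal_sup => _ [f /= fL <-].
have fL1 x y : `|f x - f y| <= `|x - y|.
  by have := fL (x, y); rewrite /= mul1r; apply.
have [ifg Bfg] := fg f fL1.
have [ig _] := fg id (fun x y => lexx _).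
have mf : measurable_fun setT f.
  apply: continuous_measurable_fun; apply: (@lip_continuous _ 1) => x y.
  by rewrite mul1r.
have iUg : integ P (fun w => U w - g w).
  by apply: integ_fin UgB; apply: measurable_funB => //; exact: integ_meas ig.
have iUgn := integ_norm iUg.
have ifU : integ P (fun w => f (U w)).
  apply: (integ_le _ (integD (integ_norm ifg) iUgn)).
    exact: measurableT_comp mf mU.
  move=> w; rewrite -[f (U w)](subrK (f (g w))) addrC.
  by apply: le_trans (ler_normD _ _) _; rewrite lerD2l.
rewrite E_gaussian_rv// unlock (E_fine ifU) -EFinB abse_EFin lee_fin.
have -> : \int[P]_w f (U w) - \int[gamma 1]_x f x =
   (\int[P]_w f (g w) - \int[gamma 1]_x f x) + \int[P]_w (f (U w) - f (g w)).
  by rewrite EB//; ring.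
apply: le_trans (ler_normD _ _) _; apply: lerD => //.
apply: le_trans (E_norm (integB ifU ifg)) _.
apply: (@le_trans _ _ (\int[P]_w `|U w - g w|)).
  by apply: E_le => //; apply: integ_norm; exact: integB.
by rewrite -lee_fin -E_fine.
Qed.

(** Coupling with the constant 0, which is at distance at most [E|N|] from the normal law. *)
Lemma wasserstein_finite (U : Omega -> R) (B : R) :
  measurable_fun setT U -> (\int[P]_w `|U w|%:E <= B%:E)%E ->
  (wasserstein P Q U N <= (\int[gamma 1]_x `|x| + B)%:E)%E.
Proof.
move=> mU UB; apply: (@wasserstein_coupling U (fun=> 0)) => //; last first.
  by under eq_integral do rewrite subr0.
move=> f fL; split; first exact: integ_cst.
have fL1 x y : `|f x - f y| <= 1 * `|x - y| by rewrite mul1r.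
have i1 : integ (gamma 1) f by apply: integ_gauss_lip fL1; exact: oner_neq0.
have i0 : integ (gamma 1) (fun=> f 0) by exact: integ_cst.
rewrite E_cst -[f 0](E_cst (gamma 1)) -EB//.
apply: le_trans (E_norm (integB i0 i1)) _.
apply: E_le.
- exact: integ_norm (integB i0 i1).
- by apply: integ_gauss_norm; exact: oner_neq0.
- by move=> x; rewrite -[X in _ <= X]normrN -[- x]add0r.
Qed.

End coupling.

(** * Ratios with a denominator that may vanish *)

Section ratios.
Context d (T : measurableType d) (R : realType).

(** The approximants [y / (y^2 + 1/k)] are continuous and equal 0 at 0, in accordance with
    [0^-1 = 0]. *)
Lemma measurable_inv (q : T -> R) : measurable_fun setT q ->
  measurable_fun setT (fun w => (q w)^-1).
Proof.
move=> mq.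
apply: (@measurable_fun_cvg _ _ _ _ (fun k w => q w / (q w ^+ 2 + k.+1%:R^-1))).
  move=> k; have -> : (fun w => q w / (q w ^+ 2 + k.+1%:R^-1)) =
      (fun y => y / (y ^+ 2 + k.+1%:R^-1)) \o q by [].
  apply: measurableT_comp mq; apply: continuous_measurable_fun => y.
  apply: cvgM; first exact: cvg_id.
  apply: cvgV; first by rewrite gt_eqF// ltr_wpDl ?sqr_ge0// invr_gt0.
  by apply: cvgD; [exact: exprn_continuous|exact: cvg_cst].
move=> w _; have [->|q0] := eqVneq (q w) 0.
  by rewrite invr0; under eq_fun do rewrite mul0r; exact: cvg_cst.
have E : (q w)^-1 = q w / (q w ^+ 2 + 0) by rewrite addr0 expr2 invfM mulrA divff// mul1r.
rewrite E; apply: cvgM; first exact: cvg_cst.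
apply: cvgV; first by rewrite addr0 expf_neq0.
by apply: cvgD; [exact: cvg_cst|exact: cvg_harmonic].
Qed.

(** Bounds uniform in a regularization of the denominator pass to the ratio itself, so negative
    moments need only be estimated after regularization. *)
Lemma E_ratio_fatou (P : probability T R) (p q : T -> R) (B : R) :
  measurable_fun setT p -> measurable_fun setT q ->
  (forall w, 0 <= p w) -> (forall w, 0 <= q w) -> {ae P, forall w, 0 < q w} ->
  (forall k, (\int[P]_w (p w / (q w + k.+1%:R^-1))%:E <= B%:E)%E) ->
  (\int[P]_w (p w / q w)%:E <= B%:E)%E.
Proof.
move=> mp mq p0 q0 qpos H.
apply: (E_fatou (f_ := fun k w => p w / (q w + k.+1%:R^-1))).
- by move=> k; apply: measurable_funM => //; apply: measurable_inv; apply: measurable_funD.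
- by apply: measurable_funM => //; exact: measurable_inv.
- by move=> k w; rewrite divr_ge0// addr_ge0.
- apply: filterS qpos => w qw; apply: cvgM; first exact: cvg_cst.
  apply: cvgV; first by rewrite gt_eqF.
  by rewrite -[X in _ --> X]addr0; apply: cvgD; [exact: cvg_cst|exact: cvg_harmonic].
- exact: nearW.
Qed.

End ratios.

(** * Pointwise bounds on the terms of [M / S] *)

Section ratio_terms.
Context (R : realType).
Implicit Types a x y S eta : R.

(** To be used with [x = ar 1] and [y = e 1], so that [a * x + y] is [ar 2]: here the noise is not
    independent of the denominator, but is controlled by two values whose squares are in [S]. *)
Lemma second_term_bound a x y S eta : 0 <= a <= 1 -> 0 < eta ->
  x ^+ 2 + (a * x + y) ^+ 2 <= S -> `|x| * `|y| <= 2 * (S + 2 * eta).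
Proof.
move=> /andP[a0 a1] e0 h.
have ay : `|y| <= `|a * x + y| + `|x|.
  have {1}-> : y = (a * x + y) - a * x by ring.
  apply: le_trans (ler_normB _ _) _; rewrite lerD2l normrM ger0_norm//.
  by rewrite ler_piMl.
move: h; rewrite -[x ^+ 2]real_normK ?num_real// -[(_ + y) ^+ 2]real_normK ?num_real//.
have := ler_wpM2l (normr_ge0 x) ay.
have := sqr_ge0 (`|x| - `|a * x + y|).
move: `|y| `|x| `|a * x + y| => y' x' z'.
have := sqr_ge0 z'; have := sqr_ge0 x'; lra.
Qed.

(** Both [x^2] and the root of [(u1^2 + eta) (u2^2 + eta)] are at most [S + 2 eta], hence
    [|x| / (S + 2 eta)] is at most a regularized [|u1 u2|^(-1/2)]. One value alone would give the
    nonintegrable [1 / |u1|]. *)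
Lemma later_term_bound q x u1 u2 S eta : 0 < eta -> 0 < q ->
  u1 ^+ 2 + u2 ^+ 2 <= S -> x ^+ 2 <= S ->
  ((u1 ^+ 2 + eta) * (u2 ^+ 2 + eta))^-1 <= q ^+ 4 -> `|x| <= q * (S + 2 * eta).
Proof.
move=> e0 q0 uS xS q4.
have v1 : 0 < u1 ^+ 2 + eta by rewrite ltr_wpDl ?sqr_ge0.
have v2 : 0 < u2 ^+ 2 + eta by rewrite ltr_wpDl ?sqr_ge0.
have vT : u1 ^+ 2 + eta + (u2 ^+ 2 + eta) <= S + 2 * eta by lra.
have xT : x ^+ 2 <= S + 2 * eta by lra.
have T0 : 0 < S + 2 * eta by apply: lt_le_trans vT; exact: addr_gt0.
move: (S + 2 * eta) vT xT T0 => T vT xT T0.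
have vvT : (u1 ^+ 2 + eta) * (u2 ^+ 2 + eta) <= T ^+ 2.
  by move: v1 v2 vT; move: (u1 ^+ 2 + eta) (u2 ^+ 2 + eta) => y z; nra.
have qT : 1 <= q ^+ 4 * T ^+ 2.
  apply: (@le_trans _ _ ((T ^+ 2)^-1 * T ^+ 2)); first by rewrite mulVf// gt_eqF// exprn_gt0.
  rewrite ler_wpM2r ?sqr_ge0//; apply: le_trans q4.
  by rewrite lef_pV2 ?posrE ?exprn_gt0// mulr_gt0.
rewrite -(@ler_pXn2r _ 4)// ?nnegrE// ?(mulr_ge0 (ltW q0) (ltW T0))//.
apply: (@le_trans _ _ (T ^+ 2)).
  have -> : `|x| ^+ 4 = (x ^+ 2) ^+ 2 by rewrite -[x ^+ 2]real_normK ?num_real// -exprM.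
  by rewrite ler_pXn2r ?nnegrE ?sqr_ge0// ltW.
have -> : (q * T) ^+ 4 = q ^+ 4 * T ^+ 2 * T ^+ 2 by ring.
by rewrite ler_peMl// sqr_ge0.
Qed.

End ratio_terms.

(** * The estimation error, and its integrability for [n >= 3] *)

Section OU_estimator.
Context d (Omega : measurableType d) (R : realType) (P : probability Omega R).
Variables (theta : R) (W X : R -> {RV P >-> R}) (Delta : nat -> R) (n : nat).
Hypotheses (theta_gt0 : 0 < theta) (BM : brownian_motion W) (OU : OU_process theta W X).
Hypotheses (n_gt1 : (1 < n)%N) (Delta_gt0 : 0 < Delta n).
Notation gamma s := (@normal_prob R 0 s).
Notation D := (Delta n).
Notation a := (expR (- (theta * D))).

Definition noise (w : Omega) : seqR R := fun l => sample_noise theta X D l w.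
Definition sampleM (w : Omega) : R := arM a n (noise w).
Definition sampleS (w : Omega) : R := arS a n (noise w).

Lemma measurable_noise : measurable_fun setT noise.
Proof.
apply: measurable_fun_seqR => l; apply: measurable_funB; first exact: measurable_funP.
by apply: measurable_funM; [exact: measurable_cst|exact: measurable_funP].
Qed.

Lemma measurable_ar k : measurable_fun setT (@ar R a k).
Proof.
elim: k => [|k ih]; first exact: measurable_cst.
apply: measurable_funD; last exact: measurable_coord.
by apply: measurable_funM => //; exact: measurable_cst.
Qed.

Lemma measurable_sampleM : measurable_fun setT sampleM.
Proof.
apply: measurable_sum => i; apply: measurable_funM.
  exact: measurableT_comp (measurable_ar i) measurable_noise.
exact: measurableT_comp (measurable_coord i) measurable_noise.
Qed.

Lemma measurable_sampleS : measurable_fun setT sampleS.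
Proof.
apply: measurable_sum => i; apply: measurable_funX.
exact: measurableT_comp (measurable_ar i) measurable_noise.
Qed.

Lemma arS_le (b : R) (e : seqR R) m k : (m <= k)%N -> arS b m e <= arS b k e.
Proof.
move=> /subnKC <-; elim: (k - m)%N => [|j ih]; first by rewrite addn0.
by rewrite addnS arSS; apply: le_trans ih _; rewrite lerDl sqr_ge0.
Qed.

Lemma sampleS_ge0 w : 0 <= sampleS w.
Proof. by apply: sumr_ge0 => i _; exact: sqr_ge0. Qed.

(** The value [ar 1 = e 0] is Gaussian, hence almost surely nonzero, and its square is a term of [S]
    as soon as [1 < n]. *)
Lemma sampleS_gt0 : {ae P, forall w, 0 < sampleS w}.
Proof.
have [mu [rs muE _]] := OU_sample_law theta_gt0 BM OU Delta_gt0.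
have s0 (i : nat) : (fun _ : nat => ar_sd theta D) i != 0 by rewrite gt_eqF// ar_sd_gt0.
pose F (e : seqR R) : R := \1_[set 0 : R] (e 0%N : R).
have mI : measurable_fun setT (\1_[set 0 : R] : R -> R) by apply: measurable_indic.
have iF : integ mu F.
  apply: (@integ_bounded _ _ _ _ _ 1).
    exact: measurableT_comp mI (measurable_coord 0%N).
  by move=> e; rewrite /F indicE; case: (_ \in _); rewrite ?normr1 ?normr0.
have g0 : gamma (ar_sd theta D) [set 0] = 0%E.
  have := normal_prob_dominates (0 : R) (ar_sd theta D).
  by move=> /null_content_dominatesP; apply => //; exact: lebesgue_measure_set1.
have E0 : \int[mu]_e F e = 0.
  have Fu (e : seqR R) x : F (upd e 0%N x) = \1_[set 0 : R] x by rewrite /F upd_eq.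
  have [|_ ->] := resampling_E (i := 0%N) rs iF.
    move=> e; under eq_fun do rewrite Fu.
    apply: (@integ_bounded _ _ _ _ _ 1); first exact: mI.
    by move=> x; rewrite indicE; case: (_ \in _); rewrite ?normr1 ?normr0.
  under eq_Rintegral do under eq_Rintegral do rewrite Fu.
  have -> : \int[gamma (ar_sd theta D)]_x \1_[set 0 : R] x = 0 :> R.
    by rewrite /Rintegral integral_indic// setIT; exact: (congr1 fine g0).
  exact: E_cst.
have [iP EP] := muE F iF.
have mA : measurable [set w | noise w 0%N = 0].
  have m0 : measurable_fun setT (fun w => noise w 0%N : R).
    exact: measurableT_comp (measurable_coord 0%N) measurable_noise.
  have := m0 measurableT [set 0] (measurable_set1 0).
  by rewrite setTI.
have PA : P [set w | noise w 0%N = 0] = 0%E.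
  have -> : P [set w | noise w 0%N = 0] = (\int[P]_w (F (noise w))%:E)%E.
    by rewrite -[X in P X]setIT -integral_indic//.
  by rewrite (E_fine iP) -EP E0.
exists [set w | noise w 0%N = 0]; split => //= w; apply: contra_notP => /= w0.
rewrite lt0r sampleS_ge0 andbT; apply/eqP => S0; apply: w0.
have : ar a 1 (noise w) ^+ 2 <= 0.
  rewrite -S0; apply: le_trans (arS_le _ _ n_gt1); rewrite !arSS.
  by rewrite lerDr addr_ge0 ?sqr_ge0// sumr_ge0// => i _; exact: sqr_ge0.
rewrite /= mulr0 add0r => h; apply/eqP; rewrite -sqrf_eq0 eq_le h sqr_ge0//.
Qed.

Lemma estimator_error : {ae P, forall w,
  theta_hat Delta X n w - theta = ((1 - a) / D - theta) - sampleM w / (D * sampleS w)}.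
Proof.
have [mu [_ _ arX]] := OU_sample_law theta_gt0 BM OU Delta_gt0.
apply: filterS2 arX sampleS_gt0 => w wX S0.
have xE i : X (grid Delta n i) w = ar a i (noise w) by rewrite /grid wX.
rewrite /theta_hat.
have -> : \sum_(i < n) X (grid Delta n i) w ^+ 2 = sampleS w.
  by apply: eq_bigr => i _; rewrite xE.
have -> : \sum_(i < n) X (grid Delta n i) w * increment X (grid Delta n i) (grid Delta n i.+1) w =
    (a - 1) * sampleS w + sampleM w.
  rewrite /sampleS /sampleM /arS /arM mulr_sumr -big_split; apply: eq_bigr => i _ /=.
  by rewrite /increment !xE /=; ring.
by field; rewrite !gt_eqF.
Qed.

(** Term by term in [M / S]: the term of index 0 vanishes and that of index 1 is at most 2. From
    index 2 on, the noise is independent of [ar 1] and [ar 2], and [|ar i| / S] is dominated by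
    [|ar 1 * ar 2|^(-1/2)]; both squares are in [S] since [2 < n]. *)
Lemma E_sampleM_ratio_fin : (2 < n)%N ->
  exists B : R, (\int[P]_w (`|sampleM w| / sampleS w)%:E <= B%:E)%E.
Proof.
move=> n3.
have [mu [rs muE _]] := OU_sample_law theta_gt0 BM OU Delta_gt0.
have s0 (i : nat) : (fun _ : nat => ar_sd theta D) i != 0 by rewrite gt_eqF// ar_sd_gt0.
pose v := ar_sd theta D ^+ 2; pose K := 16 + 2 * (1 + v) / v.
have v0 : 0 < v by rewrite exprn_gt0// ar_sd_gt0.
have K0 : 0 <= K by rewrite addr_ge0// divr_ge0 ?(ltW v0)// mulr_ge0// addr_ge0// ltW.
pose b := 2 + (1 + v) / 2 * K ^+ 2.
have b2 : 2 <= b by rewrite lerDl mulr_ge0 ?exprn_ge0// divr_ge0// addr_ge0// ltW.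
exists (n%:R * b).
apply: E_ratio_fatou; [|exact: measurable_sampleS|by []|exact: sampleS_ge0|exact: sampleS_gt0|].
  by apply: measurableT_comp => //; exact: measurable_sampleM.
move=> k; pose eta : R := k.+1%:R^-1 / 2.
have eta0 : 0 < eta by rewrite divr_gt0.
have eta2 : k.+1%:R^-1 = 2 * eta by rewrite /eta; field; rewrite nat1r pnatr_eq0.
pose alpha (_ : nat) := a.
have arE j e : arv alpha j e = ar a j e by elim: j => //= j ->.
pose dom (i : nat) (e : seqR R) : R := if (i < 2)%N then 2 else `|e i| * qprod alpha eta 2 e.
have domE (i : nat) : integ mu (dom i) /\ \int[mu]_e dom i e <= b.
  rewrite /dom; case: ltnP => i2; first by split; [exact: integ_cst|rewrite E_cst].
  have [ii Ei] := @E_coord_qprod_le R alpha _ mu rs s0 eta 2 i K eta0 i2 (fun _ _ => lexx K).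
  by split => //; apply: le_trans Ei _; rewrite lerDr.
pose F (e : seqR R) := `|arM a n e| / (arS a n e + 2 * eta).
have S0 e : 0 <= arS a n e by apply: sumr_ge0 => i _; exact: sqr_ge0.
have S12 e : ar a 1 e ^+ 2 + ar a 2 e ^+ 2 <= arS a n e.
  apply: le_trans (arS_le _ e n3); rewrite !arSS.
  by rewrite -addrA lerDr addr_ge0 ?sqr_ge0// sumr_ge0// => i _; exact: sqr_ge0.
have Fdom e : F e <= \sum_(i < n) dom i e.
  have Sp : 0 < arS a n e + 2 * eta by rewrite ltr_wpDl// mulr_gt0.
  rewrite /F ler_pdivrMr// mulr_suml; apply: le_trans (ler_norm_sum _ _ _) _.
  apply: ler_sum => i _; rewrite normrM /dom.
  have x2S (j : 'I_n) : ar a j e ^+ 2 <= arS a n e.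
    by apply: le_trans (arS_le _ e (ltn_ord j)); rewrite arSS lerDr sumr_ge0// => ? _; exact: sqr_ge0.
  case: ifPn => [|_].
    case: i => -[|[|//]] /= im _; first by rewrite normr0 mul0r mulr_ge0// ltW.
    have := S12 e; rewrite /= !mulr0 !add0r; apply: second_term_bound => //.
    by rewrite expR_ge0 ltW// ar_coef_lt1.
  suff xq : `|ar a i e| <= qprod alpha eta 2 e * (arS a n e + 2 * eta).
    by rewrite mulrC -mulrA ler_wpM2l.
  apply: (later_term_bound eta0 (qprod_gt0 _ _ _ _) (S12 e) (x2S i)).
  have -> : qprod alpha eta 2 e = quart_inv eta (ar a 1 e) * quart_inv eta (ar a 2 e).
    by rewrite -!arE /qprod big_ord_recr big_ord1.
  by rewrite exprMn !quart_invX4// invfM.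
have mF : measurable_fun setT F.
  apply: measurable_funM.
    by apply: measurableT_comp => //; exact: (allmom_meas (allmom_arM a rs (ar_sd_gt0 theta_gt0 Delta_gt0) n)).
  apply: measurable_inv; apply: measurable_funD; last exact: measurable_cst.
  exact: (allmom_meas (allmom_arS a rs (ar_sd_gt0 theta_gt0 Delta_gt0) n)).
have idom : integ mu (fun e => \sum_(i < n) dom i e).
  by apply: (integ_sum (F := fun (i : 'I_n) e => dom i e)) => i; exact: (domE i).1.
have F0 e : 0 <= F e.
  by rewrite divr_ge0// addr_ge0// mulr_ge0// ltW.
have iF : integ mu F.
  by apply: (integ_le mF idom) => e; rewrite ger0_norm.
have [iP EP] := muE F iF.
rewrite eta2 (E_fine iP) lee_fin -EP.
apply: le_trans (E_le iF idom Fdom) _.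
rewrite (E_sum (F := fun (i : 'I_n) e => dom i e)); last by move=> i; exact: (domE i).1.
rewrite -[n in n%:R]card_ord mulr_natl -sumr_const; apply: ler_sum => i _; exact: (domE i).2.
Qed.

End OU_estimator.

(** * Quantitative comparison of the error with its Gaussian part *)

Section OU_rate.
Context d (Omega : measurableType d) (R : realType) (P : probability Omega R).
Variables (theta : R) (W X zeta : R -> {RV P >-> R}) (Delta : nat -> R) (n : nat).
Hypotheses (theta_gt0 : 0 < theta) (BM : brownian_motion W) (OU : OU_process theta W X).
Hypotheses (n_gt1 : (1 < n)%N) (Delta_gt0 : 0 < Delta n).
Notation gamma s := (@normal_prob R 0 s).
Notation D := (Delta n).
Notation T := (n%:R * Delta n).
Notation a := (expR (- (theta * D))).
Notation c := ((2 * theta)^-1).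
Notation kappa := (Num.sqrt (2 * theta / T)).
Notation sampleM := (sampleM theta X Delta n).
Notation sampleS := (sampleS theta X Delta n).
Notation noise := (noise theta X Delta n).

(** By [OU_zeta], the increment of [zeta] over a grid step times [exp (- theta t)] at its right end
    is the noise of that step. *)
Lemma G_stat_sampleM :
  (forall t : R, 0 <= t -> wiener_integral W (fun s => expR (theta * s)) t (zeta t)) ->
  {ae P, forall w, G_stat theta Delta X zeta n w = (Num.sqrt T)^-1 * sampleM w}.
Proof.
move=> wi.
have [mu [_ _ arX]] := OU_sample_law theta_gt0 BM OU Delta_gt0.
have zX : {ae P, forall w, forall i, zeta (grid Delta n i) w =
    expR (theta * grid Delta n i) * X (grid Delta n i) w}.
  apply: ae_foralln => i.
  have g0 : 0 <= grid Delta n i by rewrite mulr_ge0// ltW.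
  exact: (OU_zeta theta_gt0 OU g0 (wi _ g0)).
apply: filterS2 arX zX => w wX wz.
rewrite /G_stat /horizon; congr (_ * _); apply: eq_bigr => i _.
have xE j : X (grid Delta n j) w = ar a j (noise w) by rewrite /grid wX.
have uv : grid Delta n i.+1 = grid Delta n i + D by rewrite /grid -natr1; ring.
rewrite /increment !wz !xE uv /=.
move: (grid Delta n i) => u; move: (ar a i _) (noise w i) => x y.
have -> : expR (- theta * (u + D)) * x *
    (expR (theta * (u + D)) * (a * x + y) - expR (theta * u) * x) =
    x * ((expR (- theta * (u + D)) * expR (theta * (u + D))) * (a * x + y) -
         (expR (- theta * (u + D)) * expR (theta * u)) * x) by ring.
rewrite -!expRD.
have -> : - theta * (u + D) + theta * (u + D) = 0 by ring.
have -> : - theta * (u + D) + theta * u = - (theta * D) by ring.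
by rewrite expR0; ring.
Qed.

Hypotheses (D_small : 8 * theta * D <= 1) (D_le1 : D <= 1).
Hypotheses (T_large : 64 <= T) (thetaT_large : 2 <= theta * T).

Definition fourth_cst : R := 18 * (4 + 93 * c).
(** Half of the constant of [ar_average], plus a quarter of the two fourth-moment bounds: the
    weights of the inequality used in [E_sample_ratio]. *)
Definition ratio_cst : R :=
  27 * c ^+ 2 / theta / 2 + (fourth_cst + 16 * quart_bound theta ^+ 16) / 4.

Let T_ge1 : 1 <= T. Proof. by apply: le_trans T_large; rewrite ler1n. Qed.
Let T_gt0 : 0 < T. Proof. exact: lt_le_trans T_ge1. Qed.
Let n_gt0 : 0 < n%:R :> R. Proof. by rewrite -(pmulr_lgt0 _ Delta_gt0). Qed.

(** Pointwise, [g z y <= s z^2 / 2 + (g^4 + y^4) / (4 s)] with [s = sqrt T]. Since [z = |S/n - c|]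
    satisfies [E[z^2] = O(1/T)], both parts have mean of order [1 / s]. *)
Lemma E_sample_ratio : (\int[P]_w (`|- kappa * sampleM w| * `|sampleS w / n%:R - c| /
    (sampleS w / n%:R))%:E <= (ratio_cst / Num.sqrt T)%:E)%E.
Proof.
have [mu [rs muE arX]] := OU_sample_law theta_gt0 BM OU Delta_gt0.
have sd0 := ar_sd_gt0 theta_gt0 Delta_gt0.
have aM := allmom_arM a rs sd0 n; have aS := allmom_arS a rs sd0 n.
have s0 : 0 < Num.sqrt T by rewrite sqrtr_gt0.
have mM := @measurable_sampleM _ _ _ P theta X Delta n.
have mS := @measurable_sampleS _ _ _ P theta X Delta n.
have mA : measurable_fun setT (fun w => sampleS w / n%:R).
  by apply: measurable_funM => //; exact: measurable_cst.
apply: E_ratio_fatou.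
- apply: measurable_funM; apply: measurableT_comp => //.
    by apply: measurable_funM => //; exact: measurable_cst.
  by apply: measurable_funB => //; exact: measurable_cst.
- exact: mA.
- by move=> w; rewrite mulr_ge0.
- by move=> w; rewrite divr_ge0// sampleS_ge0.
- apply: filterS (sampleS_gt0 theta_gt0 BM OU n_gt1 Delta_gt0) => w Sw.
  by rewrite divr_gt0.
move=> k; set eta : R := k.+1%:R^-1.
have eta0 : 0 < eta by rewrite invr_gt0.
have [i1 E1] : integ P (fun w => (sampleS w / n%:R - c) ^+ 2) /\
    \int[P]_w ((sampleS w / n%:R - c) ^+ 2) <= 27 * c ^+ 2 / theta / T.
  have i : integ mu (fun e => (arS a n e / n%:R - c) ^+ 2).
    apply: allmom_integ; apply: allmomX; apply: allmomB; last exact: allmom_cst.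
    by apply: allmomM => //; exact: allmom_cst.
  have [iP EP] := muE _ i; split; first exact: iP.
  have := ar_average theta_gt0 Delta_gt0 rs D_small T_ge1 thetaT_large.
  by rewrite EP.
have [i2 E2] : integ P (fun w => (- kappa * sampleM w) ^+ 4) /\
    \int[P]_w ((- kappa * sampleM w) ^+ 4) <= fourth_cst.
  have i : integ mu (fun e => (- kappa * arM a n e) ^+ 4).
    by apply: allmom_integ; apply: allmomX; apply: allmomZ.
  have [iP EP] := muE _ i; split; first exact: iP.
  have := ar_fourth theta_gt0 Delta_gt0 rs D_small T_ge1 thetaT_large.
  by rewrite EP.
have [i3 E3] : integ P (fun w => (sampleS w / n%:R + eta)^-1 ^+ 4) /\
    \int[P]_w ((sampleS w / n%:R + eta)^-1 ^+ 4) <= 16 * quart_bound theta ^+ 16.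
  have [i E] := OU_avg_neg_moment theta_gt0 BM OU Delta_gt0 D_le1 T_large eta0.
  have m3 : measurable_fun setT (fun w => (sampleS w / n%:R + eta)^-1 ^+ 4).
    by apply: measurable_funX; apply: measurable_inv; apply: measurable_funD.
  have ae : {ae P, forall w, (sampleS w / n%:R + eta)^-1 ^+ 4 =
      ((\sum_(i < n) X (i%:R * D) w ^+ 2) / n%:R + eta)^-1 ^+ 4}.
    apply: filterS arX => w wX; congr ((_ / _ + _)^-1 ^+ _).
    by apply: eq_bigr => j _; rewrite wX.
  split; first exact: integ_ae ae i.
  by rewrite (E_ae m3 (integ_meas i) ae).
pose dom w := Num.sqrt T / 2 * (sampleS w / n%:R - c) ^+ 2 +
  (4 * Num.sqrt T)^-1 * ((- kappa * sampleM w) ^+ 4 + (sampleS w / n%:R + eta)^-1 ^+ 4).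
have idom : integ P dom.
  by apply: integD; apply: integZ => //; exact: integD.
apply: (@le_trans _ _ (\int[P]_w (dom w)%:E)%E); last first.
  rewrite (E_fine idom) lee_fin ED; [|exact: integZ|by apply: integZ; exact: integD].
  rewrite EZ// EZ; last exact: integD.
  rewrite ED//.
  have -> : ratio_cst / Num.sqrt T = Num.sqrt T / 2 * (27 * c ^+ 2 / theta / T) +
      (4 * Num.sqrt T)^-1 * (fourth_cst + 16 * quart_bound theta ^+ 16).
    have TE : T = Num.sqrt T ^+ 2 by rewrite sqr_sqrtr// ltW.
    rewrite /ratio_cst [X in _ * (27 * c ^+ 2 / theta / X)]TE.
    move: fourth_cst (_ ^+ 16) => f q.
    by field; rewrite !gt_eqF.
  apply: lerD; first by rewrite ler_wpM2l// divr_ge0// ltW.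
  by rewrite ler_wpM2l ?lerD// invr_ge0 mulr_ge0// ltW.
apply: ge0_le_integral => //.
- by move=> w _; rewrite lee_fin divr_ge0 ?mulr_ge0// addr_ge0 ?(ltW eta0)// divr_ge0// sampleS_ge0.
- apply/measurable_EFinP; apply: measurable_funM.
    apply: measurable_funM; apply: measurableT_comp => //.
      by apply: measurable_funM => //; exact: measurable_cst.
    by apply: measurable_funB => //; exact: measurable_cst.
  by apply: measurable_inv; apply: measurable_funD => //; exact: measurable_cst.
- by apply/measurable_EFinP; exact: integ_meas idom.
move=> w _; rewrite lee_fin /dom.
have A0 : 0 < sampleS w / n%:R + eta by rewrite ltr_wpDl// divr_ge0// sampleS_ge0.
have i0 : 0 <= (sampleS w / n%:R + eta)^-1 by rewrite invr_ge0 ltW.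
move: (sampleS w / n%:R + eta)^-1 i0 => y y0.
rewrite -[(sampleS w / n%:R - c) ^+ 2]real_normK ?num_real//.
have -> : (- kappa * sampleM w) ^+ 4 = `|- kappa * sampleM w| ^+ 4.
  by rewrite -[RHS]normrX ger0_norm// exprn_even_ge0.
move: `|- kappa * sampleM w| `|sampleS w / n%:R - c| => g z.
move: (Num.sqrt T) s0 => s s0.
rewrite -subr_ge0.
have -> : s / 2 * z ^+ 2 + (4 * s)^-1 * (g ^+ 4 + y ^+ 4) - g * z * y =
    (2 * s)^-1 * (s * z - g * y) ^+ 2 + (4 * s)^-1 * (g ^+ 2 - y ^+ 2) ^+ 2.
  by field; rewrite gt_eqF.
by rewrite addr_ge0// mulr_ge0 ?sqr_ge0// invr_ge0 mulr_ge0// ltW.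
Qed.

Lemma E_norm_g : integ P (fun w => `|- kappa * sampleM w|) /\
  \int[P]_w `|- kappa * sampleM w| <= 1 + fourth_cst.
Proof.
have [mu [rs muE arX]] := OU_sample_law theta_gt0 BM OU Delta_gt0.
have sd0 := ar_sd_gt0 theta_gt0 Delta_gt0.
have aM : allmom mu (fun e => - kappa * arM a n e) by apply: allmomZ; exact: (allmom_arM a rs sd0 n).
have i1 : integ mu (fun e => `|- kappa * arM a n e|) by apply: integ_norm; exact: allmom_integ.
have i4 : integ mu (fun e => (- kappa * arM a n e) ^+ 4) by apply: allmom_integ; exact: allmomX.
have [iP EP] := muE _ i1; split; first exact: iP.
rewrite -EP; apply: (@le_trans _ _ (\int[mu]_e (1 + (- kappa * arM a n e) ^+ 4))).
  apply: E_le => //; first by apply: integD => //; exact: integ_cst.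
  move=> e; have -> : (- kappa * arM a n e) ^+ 4 = (`|- kappa * arM a n e| ^+ 2) ^+ 2.
    by rewrite real_normK ?num_real// -exprM.
  move: `|_| => y; have := sqr_ge0 (y ^+ 2 - 1 / 2); have := sqr_ge0 (y - 1 / 2); lra.
rewrite ED//; last exact: integ_cst.
rewrite E_cst lerD2l.
exact: (ar_fourth theta_gt0 Delta_gt0 rs D_small T_ge1 thetaT_large).
Qed.

Lemma sample_clt (h : R -> R) : (forall x y, `|h x - h y| <= `|x - y|) ->
  integ P (fun w => h (- kappa * sampleM w)) /\
  `|\int[P]_w h (- kappa * sampleM w) - \int[gamma 1]_x h x| <=
  stein_cst R * (4 * theta * D + 10 * Num.sqrt c / Num.sqrt T).
Proof.
move=> hL.
have [mu [rs muE arX]] := OU_sample_law theta_gt0 BM OU Delta_gt0.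
have [i E] := ar_clt theta_gt0 Delta_gt0 rs D_small T_ge1 thetaT_large hL.
have [iP EP] := muE _ i; split; first exact: iP.
by move: E; rewrite EP.
Qed.

Lemma measurable_theta_hat : measurable_fun setT (theta_hat Delta X n).
Proof.
apply: measurableT_comp => //; apply: measurable_funM.
  apply: measurable_sum => i; apply: measurable_funM; first exact: measurable_funP.
  by apply: measurable_funB; exact: measurable_funP.
apply: measurable_inv; apply: measurable_funM; first exact: measurable_cst.
by apply: measurable_sum => i; apply: measurable_funX; exact: measurable_funP.
Qed.

(** Covers both normalizations: [r = 1] is the second one, and [r = 1 / sqrt q] the first, with [q]
    the ratio of [E[G^2]] to [c]. *)
Definition scaled_error (r : R) (w : Omega) : R :=
  r * (Num.sqrt (T / (2 * theta)) * (theta_hat Delta X n w - theta)).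

Lemma measurable_scaled_error r : measurable_fun setT (scaled_error r).
Proof.
apply: measurable_funM; first exact: measurable_cst.
apply: measurable_funM; first exact: measurable_cst.
by apply: measurable_funB; [exact: measurable_theta_hat|exact: measurable_cst].
Qed.

Lemma E_scaled_error (r : R) : 0 <= r <= 2 ->
  (\int[P]_w `|scaled_error r w - (- kappa * sampleM w)|%:E <=
   (`|r - 1| * (1 + fourth_cst) + 2 * (Num.sqrt c * theta ^+ 2 * (D * Num.sqrt T)) +
    2 * (ratio_cst / Num.sqrt T))%:E)%E.
Proof.
move=> /andP[r0 r2].
have s0 : 0 < Num.sqrt T by rewrite sqrtr_gt0.
have k2 : 0 < 2 * theta / T by rewrite divr_gt0// mulr_gt0.
have k0 : 0 < kappa by rewrite sqrtr_gt0.
have kE : kappa ^+ 2 = 2 * theta / T by rewrite sqr_sqrtr// ltW.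
have kV : Num.sqrt (T / (2 * theta)) = kappa^-1 by rewrite -invf_div sqrtrV// ltW.
have sT : Num.sqrt (T / (2 * theta)) = Num.sqrt c * Num.sqrt T.
  by rewrite mulrC sqrtrM// invr_ge0 mulr_ge0// ltW.
pose bias := Num.sqrt (T / (2 * theta)) * ((1 - a) / D - theta).
have biasB : `|bias| <= Num.sqrt c * theta ^+ 2 * (D * Num.sqrt T).
  rewrite /bias normrM ger0_norm ?sqrtr_ge0// sT.
  have -> : Num.sqrt c * theta ^+ 2 * (D * Num.sqrt T) =
    Num.sqrt c * Num.sqrt T * (theta ^+ 2 * D) by ring.
  by rewrite ler_wpM2l ?mulr_ge0 ?sqrtr_ge0// ar_bias.
pose q w := `|- kappa * sampleM w| * `|sampleS w / n%:R - c| / (sampleS w / n%:R).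
have mM := @measurable_sampleM _ _ _ P theta X Delta n.
have mS := @measurable_sampleS _ _ _ P theta X Delta n.
have mq : measurable_fun setT q.
  apply: measurable_funM.
    apply: measurable_funM; apply: measurableT_comp => //.
      by apply: measurable_funM => //; exact: measurable_cst.
    apply: measurable_funB; last exact: measurable_cst.
    by apply: measurable_funM => //; exact: measurable_cst.
  by apply: measurable_inv; apply: measurable_funM => //; exact: measurable_cst.
have q0 w : 0 <= q w by rewrite divr_ge0 ?mulr_ge0 ?invr_ge0 ?sampleS_ge0.
have iq : integ P q.
  apply: (integ_fin (C := ratio_cst / Num.sqrt T)) => //.
  by under eq_integral do rewrite (ger0_norm (q0 _)); exact: E_sample_ratio.
have Eq : \int[P]_w q w <= ratio_cst / Num.sqrt T.
  by rewrite -lee_fin -(E_fine iq); exact: E_sample_ratio.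
have [ig Eg] := E_norm_g.
pose dom w := `|r - 1| * `|- kappa * sampleM w| + (2 * `|bias| + 2 * q w).
have idom : integ P dom.
  apply: integD; first exact: integZ.
  by apply: integD; [exact: integ_cst|exact: integZ].
apply: (@le_trans _ _ (\int[P]_w (dom w)%:E)%E); last first.
  rewrite (E_fine idom) lee_fin ED; [|exact: integZ|by apply: integD; [exact: integ_cst|exact: integZ]].
  rewrite EZ// ED; [|exact: integ_cst|exact: integZ].
  rewrite E_cst EZ// addrA; apply: lerD; last by rewrite ler_wpM2l.
  by apply: lerD; [rewrite ler_wpM2l|rewrite ler_wpM2l].
have ae : {ae P, forall w, `|scaled_error r w - (- kappa * sampleM w)| <= dom w}.
  apply: filterS2 (estimator_error theta_gt0 BM OU n_gt1 Delta_gt0)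
    (sampleS_gt0 theta_gt0 BM OU n_gt1 Delta_gt0) => w we Sw.
  have A0 : 0 < sampleS w / n%:R by rewrite divr_gt0.
  (* Bias, Gaussian part, and the cost of replacing [S / n] by [c], which equals
     [1 / (kappa^2 T)]. *)
  have key : Num.sqrt (T / (2 * theta)) * (theta_hat Delta X n w - theta) =
     bias + (- kappa * sampleM w) + (- kappa * sampleM w) * (c - sampleS w / n%:R) / (sampleS w / n%:R).
    rewrite we mulrBr -/bias -addrA; congr (_ + _).
    rewrite kV; have -> : c = (kappa ^+ 2 * T)^-1.
      by rewrite kE divfK// gt_eqF.
    by field; rewrite !gt_eqF.
  rewrite /scaled_error key; set g := - kappa * sampleM w.
  have -> : r * (bias + g + g * (c - sampleS w / n%:R) / (sampleS w / n%:R)) - g =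
    (r - 1) * g + (r * bias + r * (g * (c - sampleS w / n%:R) / (sampleS w / n%:R))) by ring.
  apply: le_trans (ler_normD _ _) _; rewrite normrM lerD2l.
  apply: le_trans (ler_normD _ _) _; apply: lerD.
    by rewrite normrM (ger0_norm r0) ler_wpM2r.
  rewrite normrM (ger0_norm r0) /q -/g.
  have -> : `|g * (c - sampleS w / n%:R) / (sampleS w / n%:R)| =
     `|g| * `|sampleS w / n%:R - c| / (sampleS w / n%:R).
    by rewrite !normrM (distrC c) normfV [`|sampleS w / n%:R|]gtr0_norm.
  by rewrite ler_wpM2r// divr_ge0 ?(ltW A0)// mulr_ge0.
apply: ae_ge0_le_integral => //.
- apply/measurable_EFinP; apply: measurableT_comp => //; apply: measurable_funB.
    exact: measurable_scaled_error.
  by apply: measurable_funM => //; exact: measurable_cst.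
- move=> w _; rewrite lee_fin; apply: addr_ge0; first exact: mulr_ge0.
  by apply: addr_ge0; apply: mulr_ge0.
- by apply/measurable_EFinP; exact: integ_meas idom.
- by apply: filterS ae => w we _; rewrite lee_fin.
Qed.

(** Here [q] is the variance of [kappa M]. The lower bound makes the two normalizations agree up to
    [O(Delta + 1/T)]. *)
Lemma E_G_stat :
  (forall t : R, 0 <= t -> wiener_integral W (fun s => expR (theta * s)) t (zeta t)) ->
  exists q : R, [/\ 1 - 2 * theta * D - c / T <= q, q <= 1 &
    fine ('E_P[fun w => (G_stat theta Delta X zeta n w ^+ 2)%R])%E = c * q].
Proof.
move=> wi; have ae := G_stat_sampleM wi.
have [mu [rs muE arX]] := OU_sample_law theta_gt0 BM OU Delta_gt0.
have sd0 := ar_sd_gt0 theta_gt0 Delta_gt0.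
have i2 : integ mu (fun e => arM a n e ^+ 2) by apply: allmom_integ; apply: allmomX; exact: (allmom_arM a rs sd0 n).
have [iP EP] := muE _ i2.
have /andP[v1 v2] := ar_variance theta_gt0 Delta_gt0 rs T_ge1.
exists (2 * theta / T * \int[mu]_e (arM a n e ^+ 2)); split => //.
rewrite unlock -/(Rintegral P setT (fun w => G_stat theta Delta X zeta n w ^+ 2)).
have mM := @measurable_sampleM _ _ _ P theta X Delta n.
rewrite (_ : Rintegral _ _ _ = \int[P]_w (T^-1 * sampleM w ^+ 2)).
  rewrite EZ//.
  have -> : \int[P]_x (sampleM x ^+ 2) = \int[mu]_e (arM a n e ^+ 2) by rewrite EP.
  by field; rewrite !gt_eqF.
apply: E_ae.
- apply: measurable_funX; apply: measurable_funM; first exact: measurable_cst.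
  apply: measurable_sum => i; apply: measurable_funM.
    by apply: measurable_funM; [exact: measurable_cst|exact: measurable_funP].
  by apply: measurable_funB; exact: measurable_funP.
- by apply: measurable_funM; [exact: measurable_cst|exact: measurable_funX].
- apply: filterS ae => w ->.
  by rewrite exprMn exprVn sqr_sqrtr// ltW.
Qed.

End OU_rate.

(** * The rate, with explicit constants *)

Section wasserstein_rate.
Context (R : realType) (theta : R).
Hypothesis theta_gt0 : 0 < theta.
Notation c := ((2 * theta)^-1).
Notation gamma s := (@normal_prob R 0 s).

Lemma stein_cst_ge0 : 0 <= stein_cst R.
Proof.
have m0 : 0 <= \int[gamma 1]_x `|x|.
  have iid : integ (gamma 1) (fun x : R => x).
    by apply: (@integ_gauss_lip _ _ 1) => [|x y]; rewrite ?oner_neq0 ?mul1r.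
  exact: le_trans (normr_ge0 _) (E_norm iid).
rewrite !addr_ge0// divr_ge0 ?mulr_ge0// ltW// normal_pdf_gt0//.
Qed.

Lemma fourth_cst_ge0 : 0 <= fourth_cst theta.
Proof. by rewrite mulr_ge0// addr_ge0// mulr_ge0// invr_ge0 mulr_ge0// ltW. Qed.

Lemma ratio_cst_ge0 : 0 <= ratio_cst theta.
Proof.
rewrite addr_ge0// divr_ge0//.
  by rewrite divr_ge0 ?(ltW theta_gt0)// mulr_ge0// sqr_ge0.
rewrite addr_ge0 ?fourth_cst_ge0// mulr_ge0// exprn_ge0// quart_bound_ge0//.
Qed.

(** In order: normal approximation of the Gaussian part, mismatch [|r - 1|] of the normalization,
    bias, random denominator. *)
Definition rate_cst : R :=
  stein_cst R * (4 * theta + 10 * Num.sqrt c) +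
  (4 * theta + 2 * c) * (1 + fourth_cst theta) +
  2 * (Num.sqrt c * theta ^+ 2) + 2 * ratio_cst theta.

Lemma rate_cst_gt0 : 0 < rate_cst.
Proof.
have th0 := ltW theta_gt0; have c0 : 0 < c by rewrite invr_gt0 mulr_gt0.
rewrite ltr_wpDr ?mulr_ge0 ?ratio_cst_ge0// ltr_wpDr ?mulr_ge0 ?sqrtr_ge0 ?sqr_ge0//.
rewrite ltr_wpDl// ?mulr_ge0 ?stein_cst_ge0 ?addr_ge0 ?mulr_ge0 ?sqrtr_ge0//.
rewrite mulr_gt0//; last by rewrite ltr_wpDr ?fourth_cst_ge0.
by rewrite addr_gt0// mulr_gt0.
Qed.

Lemma rate_gt0 (Delta : nat -> R) n : (0 < n)%N -> 0 < Delta n -> 0 < rate Delta n.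
Proof.
move=> n0 D0; rewrite ltr_wpDr ?sqrtr_ge0// invr_gt0 sqrtr_gt0.
by rewrite mulr_gt0// ltr0n.
Qed.

Context d (Omega : measurableType d) (P : probability Omega R).
Variables (W X zeta : R -> {RV P >-> R}) (Delta : nat -> R) (n : nat).
Context d' (Omega' : measurableType d') (Q : probability Omega' R) (N : {RV Q >-> R}).
Hypotheses (BM : brownian_motion W) (OU : OU_process theta W X).
Hypothesis wi : forall t : R, 0 <= t ->
  wiener_integral W (fun s => expR (theta * s)) t (zeta t).
Hypothesis lawN : forall A : set R, measurable A -> distribution Q N A = normal_prob 0 1 A.
Hypotheses (n_gt1 : (1 < n)%N) (Delta_gt0 : 0 < Delta n).
Notation D := (Delta n).
Notation T := (n%:R * Delta n).

Lemma E_error_fin : (2 < n)%N ->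
  exists2 B : R, 0 <= B & (\int[P]_w `|theta_hat Delta X n w - theta|%:E <= B%:E)%E.
Proof.
move=> n3; have [B EB] := E_sampleM_ratio_fin theta_gt0 BM OU n_gt1 Delta_gt0 n3.
pose a := expR (- (theta * D)).
pose q w := `|sampleM theta X Delta n w| / sampleS theta X Delta n w.
have mM := @measurable_sampleM _ _ _ P theta X Delta n.
have mS := @measurable_sampleS _ _ _ P theta X Delta n.
have mq : measurable_fun setT q.
  by apply: measurable_funM; [exact: measurableT_comp|exact: measurable_inv].
have q0 w : 0 <= q w by rewrite divr_ge0// sampleS_ge0.
have iq : integ P q.
  by apply: (integ_fin (C := B)) => //; under eq_integral do rewrite (ger0_norm (q0 _)).
have Eq0 : 0 <= \int[P]_w q w.
  by apply: le_trans (normr_ge0 _) _; apply: le_trans (E_norm iq) _; apply: E_le => // [|w];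
     [exact: integ_norm|rewrite ger0_norm].
pose dom w := `|(1 - a) / D - theta| + D^-1 * q w.
have idom : integ P dom by apply: integD; [exact: integ_cst|exact: integZ].
exists (`|(1 - a) / D - theta| + D^-1 * \int[P]_w q w).
  by rewrite addr_ge0// mulr_ge0// invr_ge0 ltW.
have -> : (`|(1 - a) / D - theta| + D^-1 * \int[P]_w q w)%:E = (\int[P]_w (dom w)%:E)%E.
  by rewrite (E_fine idom) ED ?E_cst ?EZ//; [exact: integ_cst|exact: integZ].
apply: ae_ge0_le_integral => //.
- apply/measurable_EFinP; apply: measurableT_comp => //.
  by apply: measurable_funB; [exact: measurable_theta_hat|exact: measurable_cst].
- by move=> w _; rewrite lee_fin addr_ge0// mulr_ge0// invr_ge0 ltW.
- by apply/measurable_EFinP; exact: integ_meas idom.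
apply: filterS2 (estimator_error theta_gt0 BM OU n_gt1 Delta_gt0)
  (sampleS_gt0 theta_gt0 BM OU n_gt1 Delta_gt0) => w we Sw _.
rewrite lee_fin we; apply: le_trans (ler_normB _ _) _; rewrite lerD2l.
rewrite normrM normfV normrM !(gtr0_norm Delta_gt0) (gtr0_norm Sw) invfM /q.
by rewrite mulrCA.
Qed.

(** The constant depends on [n] and on the processes; it is only meant for finitely many sample
    sizes. *)
Lemma wasserstein_bounds_fin : (2 < n)%N ->
  exists C, wasserstein_bounds Q N theta Delta X zeta C n.
Proof.
move=> n3; have [B B0 EB] := E_error_fin n3.
have rp : 0 < rate Delta n by rewrite rate_gt0// (ltn_trans _ n_gt1).
have fin (k : R) : (wasserstein P Q (fun w => k * (theta_hat Delta X n w - theta))%R N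
    <= (\int[gamma 1]_x `|x| + `|k| * B)%:E)%E.
  apply: wasserstein_finite => //.
    apply: measurable_funM; first exact: measurable_cst.
    by apply: measurable_funB; [exact: measurable_theta_hat|exact: measurable_cst].
  have mE : measurable_fun setT (fun w => `|theta_hat Delta X n w - theta|%:E).
    apply/measurable_EFinP; apply: measurableT_comp => //.
    by apply: measurable_funB; [exact: measurable_theta_hat|exact: measurable_cst].
  under eq_integral do rewrite normrM EFinM.
  rewrite ge0_integralZl//.
  by rewrite EFinM lee_wpmul2l// lee_fin.
rewrite /wasserstein_bounds.
set k1 := _ / _; set k2 := Num.sqrt (_ / _).
exists ((\int[gamma 1]_x `|x| + (`|k1| + `|k2|) * B) / rate Delta n).
rewrite divfK ?gt_eqF//; split.
  apply: le_trans (fin k1) _; rewrite lee_fin lerD2l ler_wpM2r// lerDl//.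
apply: le_trans (fin k2) _; rewrite lee_fin lerD2l ler_wpM2r// lerDr//.
Qed.

Hypotheses (D_small : 8 * theta * D <= 1) (D_le1 : D <= 1).
Hypotheses (T_large : 64 <= T) (thetaT_large : 2 <= theta * T).

Let T_ge1 : 1 <= T. Proof. by apply: le_trans T_large; rewrite ler1n. Qed.
Let T_gt0 : 0 < T. Proof. exact: lt_le_trans T_ge1. Qed.

Lemma wasserstein_scaled_error (r : R) : 0 <= r <= 2 ->
  `|r - 1| <= 4 * theta * D + 2 * c / T ->
  (wasserstein P Q (scaled_error theta X Delta n r) N <= (rate_cst * rate Delta n)%:E)%E.
Proof.
move=> r02 r1.
have s0 : 0 < Num.sqrt T by rewrite sqrtr_gt0.
have s1 : 1 <= Num.sqrt T by rewrite -[X in X <= _]sqrtr1 ler_wsqrtr.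
have sE : T = Num.sqrt T ^+ 2 by rewrite sqr_sqrtr// ltW.
have th0 := ltW theta_gt0; have D0 := ltW Delta_gt0.
have c0 : 0 <= c by rewrite invr_ge0 mulr_ge0.
(* As [1 <= T], the terms of order [Delta] and [1 / T] are below [Delta * sqrt T] and [1 / sqrt T]
   respectively. *)
have rateE : rate Delta n = (Num.sqrt T)^-1 + D * Num.sqrt T.
  congr (_ + _); have -> : n%:R * D ^+ 3 = D ^+ 2 * T by ring.
  by rewrite sqrtrM ?sqr_ge0// sqrtr_sqr ger0_norm.
have u0 : 0 <= (Num.sqrt T)^-1 by rewrite invr_ge0 ltW.
have v0 : 0 <= D * Num.sqrt T by rewrite mulr_ge0// ltW.
have DD : D <= D * Num.sqrt T by rewrite ler_peMr.
have Ti : T^-1 <= (Num.sqrt T)^-1.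
  by rewrite sE lef_pV2 ?posrE ?exprn_gt0// expr2 sqrtr_sqr ger0_norm ?(ltW s0)// ler_peMl// ltW.
apply: le_trans (wasserstein_coupling lawN _
  (sample_clt theta_gt0 BM OU Delta_gt0 D_small T_large thetaT_large)
  (E_scaled_error theta_gt0 BM OU n_gt1 Delta_gt0 D_small D_le1 T_large thetaT_large r02)) _.
  exact: measurable_scaled_error.
rewrite lee_fin rateE.
set u := (Num.sqrt T)^-1 in u0 Ti *; set v := D * Num.sqrt T in v0 DD *.
have p1 : stein_cst R * (4 * theta * D + 10 * Num.sqrt c * u) <=
    stein_cst R * (4 * theta + 10 * Num.sqrt c) * (u + v).
  rewrite -[leRHS]mulrA ler_wpM2l ?stein_cst_ge0// [leRHS]mulrDl; apply: lerD.
    by rewrite ler_wpM2l ?mulr_ge0// (le_trans DD)// lerDr.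
  by rewrite ler_wpM2l ?mulr_ge0 ?sqrtr_ge0// lerDl.
have p2 : `|r - 1| * (1 + fourth_cst theta) <=
    (4 * theta + 2 * c) * (1 + fourth_cst theta) * (u + v).
  rewrite mulrAC ler_wpM2r ?addr_ge0 ?fourth_cst_ge0//; apply: le_trans r1 _.
  rewrite [leRHS]mulrDl; apply: lerD.
    by rewrite ler_wpM2l ?mulr_ge0// (le_trans DD)// lerDr.
  by rewrite ler_wpM2l ?mulr_ge0// (le_trans Ti)// lerDl.
have p3 : 2 * (Num.sqrt c * theta ^+ 2 * v) <= 2 * (Num.sqrt c * theta ^+ 2) * (u + v).
  by rewrite -[leRHS]mulrA ler_wpM2l// ler_wpM2l ?mulr_ge0 ?sqrtr_ge0 ?sqr_ge0// lerDr.
have p4 : 2 * (ratio_cst theta * u) <= 2 * ratio_cst theta * (u + v).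
  by rewrite -[leRHS]mulrA ler_wpM2l// ler_wpM2l ?ratio_cst_ge0// lerDl.
apply: le_trans (lerD p1 (lerD (lerD p2 p3) p4)) _; rewrite /rate_cst.
move: (stein_cst R) (fourth_cst theta) (ratio_cst theta) (Num.sqrt c) => p q x y.
by rewrite le_eqVlt; apply/orP; left; apply/eqP; ring.
Qed.

Lemma wasserstein_bounds_large : wasserstein_bounds Q N theta Delta X zeta rate_cst n.
Proof.
have c0 : 0 < c by rewrite invr_gt0 mulr_gt0.
have th0 := ltW theta_gt0; have D0 := ltW Delta_gt0.
have cT0 : 0 <= 2 * c / T by rewrite divr_ge0 ?(ltW T_gt0)// mulr_ge0// ltW.
split; last first.
  rewrite (_ : (fun w => _) = scaled_error theta X Delta n 1); last first.
    by apply/funext => w; rewrite /scaled_error mul1r.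
  apply: wasserstein_scaled_error; first by rewrite ler01 ler1n.
  by rewrite subrr normr0 addr_ge0// !mulr_ge0.
have [q [q1 q2 ->]] := E_G_stat theta_gt0 BM OU Delta_gt0 T_large wi.
have cT : c / T <= 1 / 4.
  rewrite ler_pdivrMr// -[leLHS]mul1r ler_pdivrMr ?mulr_gt0//.
  by move: thetaT_large; lra.
(* Each of the two losses [2 theta Delta] and [c / T] is at most [1/4]. *)
have q4 : 1 / 4 <= q by move: q1 cT D_small; lra.
have q0 : 0 < q by apply: lt_le_trans q4.
pose s := Num.sqrt q.
have s2 : s ^+ 2 = q by rewrite sqr_sqrtr// ltW.
have s_ge : 1 / 2 <= s.
  rewrite -(@ler_pXn2r _ 2)// ?nnegrE ?sqrtr_ge0// s2.
  by apply: le_trans q4; rewrite le_eqVlt; apply/orP; left; apply/eqP; field.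
have s0 : 0 < s by apply: lt_le_trans s_ge.
have s_le : s <= 1 by rewrite -sqrtr1 ler_wsqrtr.
rewrite (_ : (fun w => _) = scaled_error theta X Delta n s^-1); last first.
  apply/funext => w; rewrite /scaled_error mulrA; congr (_ * _).
  rewrite (sqrtrM q (ltW c0)) -/s [T / _]mulrC (sqrtrM T (ltW c0)).
  have sc0 : 0 < Num.sqrt c by rewrite sqrtr_gt0.
  rewrite -{1}[c](sqr_sqrtr (ltW c0)) /horizon.
  by field; rewrite !gt_eqF.
apply: wasserstein_scaled_error.
  rewrite invr_ge0 (ltW s0)/= -[leRHS]invrK lef_pV2 ?posrE// ?invr_gt0//.
  by move: s_ge; lra.
rewrite ger0_norm; last by rewrite subr_ge0 invf_ge1.
(* With [q = s^2] and [1/2 <= s <= 1]: [1/s - 1 <= 2 (1 - s^2)] because [2 s (1 + s) >= 1]. *)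
apply: (@le_trans _ _ (2 * (1 - q))); last by move: q1; lra.
rewrite -s2; have -> : s^-1 - 1 = (1 - s) / s by field; rewrite gt_eqF.
rewrite ler_pdivrMr//; have : 0 <= (1 - s) * (2 * s * (1 + s) - 1).
  by rewrite mulr_ge0 ?subr_ge0//; move: s_ge s_le; nra.
lra.
Qed.

End wasserstein_rate.

(** * Assembly over all sample sizes *)

Lemma wasserstein_bounds_le (R : realType) d (Omega : measurableType d)
    (P : probability Omega R) d' (Omega' : measurableType d')
    (Q : probability Omega' R) (N : Omega' -> R) (theta : R) (Delta : nat -> R)
    (X zeta : R -> {RV P >-> R}) (C C' : R) (n : nat) :
  0 <= rate Delta n -> C <= C' ->
  wasserstein_bounds Q N theta Delta X zeta C n ->
  wasserstein_bounds Q N theta Delta X zeta C' n.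
Proof.
move=> r0 CC [H1 H2].
by split; [apply: le_trans H1 _|apply: le_trans H2 _]; rewrite lee_fin ler_wpM2r.
Qed.

Unset Implicit Arguments.

(** [C] is [rate_cst theta], chosen before the processes and the mesh; it applies once [Delta n] is
    small and [n Delta n] large, which fixes [n0]. [C'] also absorbs the finitely many finite
    distances from [n = 3] up to [n0]. *)
Theorem theorem4p1 (R : realType) (theta : R) (theta_gt0 : 0 < theta) :
  exists2 C : R, 0 < C &
  forall (d : measure_display) (Omega : measurableType d)
    (P : probability Omega R) (W X zeta : R -> {RV P >-> R})
    (d' : measure_display) (Omega' : measurableType d')
    (Q : probability Omega' R) (N : {RV Q >-> R}) (Delta : nat -> R),
  brownian_motion W ->
  OU_process theta W X ->
  (forall t : R, 0 <= t ->
     wiener_integral W (fun s => expR (theta * s)) t (zeta t)) ->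
  (forall A : set R, measurable A -> distribution Q N A = normal_prob 0 1 A) ->
  (forall n : nat, (1 <= n)%N -> 0 < Delta n) ->
  Delta n @[n --> \oo] --> 0 ->
  (n%:R * Delta n) @[n --> \oo] --> +oo ->
  (exists n0 : nat, forall n : nat, (n0 <= n)%N ->
     wasserstein_bounds Q N theta Delta X zeta C n) /\
  (exists2 C' : R, 0 < C' & forall n : nat, (3 <= n)%N ->
     wasserstein_bounds Q N theta Delta X zeta C' n).
Proof.
exists (rate_cst theta); first exact: rate_cst_gt0.
move=> d Omega P W X zeta d' Omega' Q N Delta BM OU wi lawN Dpos D0 Tinf.
have [n0 large] : exists n0 : nat, forall n : nat, (n0 <= n)%N ->
    wasserstein_bounds Q N theta Delta X zeta (rate_cst theta) n.
  have t8 : 0 < (8 * theta)^-1 by rewrite invr_gt0 mulr_gt0.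
  have : \forall n \near \oo, wasserstein_bounds Q N theta Delta X zeta (rate_cst theta) n.
    near=> n.
    have n1 : (1 < n)%N by near: n; exact: nbhs_infty_gt.
    have Dn : 0 < Delta n by apply: Dpos; exact: ltnW.
    apply: (wasserstein_bounds_large theta_gt0 BM OU wi lawN n1 Dn).
    - rewrite -ler_pdivlMl ?mulr_gt0// mulr1; apply: ltW.
      by near: n; exact: (cvgr_lt 0 D0).
    - by apply: ltW; near: n; exact: (cvgr_lt 0 D0 _ ltr01).
    - by near: n; move/cvgryPge: Tinf; exact.
    - rewrite -ler_pdivrMl//; near: n; move/cvgryPge: Tinf; exact.
  by move=> [n0 _ H]; exists n0 => n; exact: H.
split; first by exists n0.
(* Induction on [m]: the indices below [m] are added one at a time to those from [n0] on, taking the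
   maximum of the constants. At [m = n0] nothing is missing. *)
have small : forall m : nat, exists2 C' : R, 0 < C' & forall n : nat, (3 <= n)%N ->
    (n < m)%N || (n0 <= n)%N -> wasserstein_bounds Q N theta Delta X zeta C' n.
  have rate0 n : (3 <= n)%N -> 0 <= rate Delta n.
    move=> n3; apply: ltW; apply: rate_gt0; first by apply: leq_trans n3.
    by apply: Dpos; apply: leq_trans n3.
  elim=> [|m [C' C'0 ih]].
    by exists (rate_cst theta); [exact: rate_cst_gt0|move=> n _ /= /large].
  have [m3|m3] := leqP 3 m; last first.
    exists C' => // n n3; rewrite ltnS => nm; apply: ih => //.
    by case/orP: nm => [nm|->]; rewrite ?orbT//; have := leq_trans (leq_trans n3 nm) m3; rewrite ltnn.
  have m1 : (1 < m)%N by apply: leq_trans m3.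
  have Dm : 0 < Delta m by apply: Dpos; apply: leq_trans m3.
  have [C Cm] := wasserstein_bounds_fin theta_gt0 zeta BM OU lawN m1 Dm m3.
  exists (Num.max C C'); first by rewrite lt_max C'0 orbT.
  move=> n n3; rewrite ltnS leq_eqVlt -orbA => /orP[/eqP ->|nm].
    by apply: wasserstein_bounds_le Cm; [exact: rate0|rewrite le_max lexx].
  by apply: wasserstein_bounds_le (ih n n3 nm); [exact: rate0|rewrite le_max lexx orbT].
have [C' C'0 H] := small n0; exists C' => // n n3; apply: H => //.
by case: ltnP.
Unshelve. all: end_near. Qed.
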